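(* Let $\Omega\subset\mathbb{R}^N$ be a bounded open connected set and $h\in C(\Omega)$ with $h\ge0$ on $\Omega$. Then the map $\Theta(x):=\{(r,A)\in\mathcal{Q}:(-r)^{N+2}\det A\ge h(x)\}$ is a Hausdorff continuous proper elliptic map and $\partial\Theta(x)\subset\{(r,A)\in\mathbb{R}\times\mathcal{S}(N):(-r)^{N+2}\det A=h(x)\}$ for all $x\in\Omega$. Moreover, if $u\in\mathrm{USC}(\overline\Omega)$ restricts to a $\mathcal{Q}$-admissible viscosity subsolution and $v\in\mathrm{LSC}(\overline\Omega)$ restricts to a $\mathcal{Q}$-admissible viscosity supersolution of $[-u(x)]^{N+2}\det D^2u(x)=h(x)$ in $\Omega$, then $u\le v$ on $\partial\Omega$ implies $u\le v$ in $\Omega$.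
   Context: $\mathcal{S}(N)$: real symmetric $N\times N$ matrices with usual partial order, eigenvalues $\lambda_i(A)$. $\mathcal{Q}:=\{(s,P)\in\mathbb{R}\times\mathcal{S}(N): s\le0,\ P\ge0\}$. A proper elliptic map assigns to each $x\in\Omega$ a closed, nonempty set $\subsetneq\mathbb{R}\times\mathcal{S}(N)$ invariant under adding elements of $\mathcal Q$. Hausdorff continuity: with norm $\|(r,A)\|=\max\{|r|,\max_i|\lambda_i(A)|\}$ and the Hausdorff distance $d_{\mathcal H}$ (possibly $+\infty$), for all $x\in\Omega,\eta>0$ there is $\delta>0$ with $d_{\mathcal H}(\Theta(x),\Theta(y))<\eta$ for $y\in\Omega$, $|x-y|<\delta$. Let $F(x,r,A):=(-r)^{N+2}\det A-h(x)$. $J^+_{x_0}u:=\{(\varphi(x_0),D^2\varphi(x_0)):\varphi$ is $C^2$ near $x_0$, $u\le\varphi$ near $x_0$, $u(x_0)=\varphi(x_0)\}$, $J^-_{x_0}u$ likewise with $u\ge\varphi$. $u\in\mathrm{USC}(\Omega)$ is a $\mathcal Q$-admissible viscosity subsolution if for all $x_0\in\Omega$, $(r,A)\in J^+_{x_0}u$: $F(x_0,r,A)\ge0$ and $(r,A)\in\mathcal Q$. $v\in\mathrm{LSC}(\Omega)$ is a $\mathcal Q$-admissible viscosity supersolution if for all $x_0$, $(r,A)\in J^-_{x_0}v$: $F(x_0,r,A)\le0$ or $(r,A)\notin\mathcal Q^\circ$. *)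

(* Defs.v *)
From HB Require Import structures.
From mathcomp Require Import all_boot all_order all_algebra.
From mathcomp Require Import all_classical all_reals all_analysis.
Set Implicit Arguments. Unset Strict Implicit. Unset Printing Implicit Defensive.
Import Order.TTheory GRing.Theory Num.Theory.
Import numFieldNormedType.Exports.
Local Open Scope classical_set_scope.
Local Open Scope ring_scope.

Section Defs.
Variables (R : realType) (N : nat).

Notation pt := 'rV[R]_N.
Notation pair := (R * 'M[R]_N)%type.

Definition symmetric_mx (A : 'M[R]_N) : Prop := A^T = A.
Definition SymPairs : set pair := [set p | symmetric_mx p.2].

Definition psd (P : 'M[R]_N) : Prop := forall x : 'rV[R]_N, 0 <= (x *m P *m x^T) 0 0.

Definition Qset : set pair := [set p | symmetric_mx p.2 /\ p.1 <= 0 /\ psd p.2].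

Definition spec_norm (A : 'M[R]_N) : R := sup [set `|a| | a in [set a | eigenvalue A a]].

Definition pdist (p q : pair) : R := Num.max `|p.1 - q.1| (spec_norm (p.2 - q.2)).

Definition rinterior (S : set pair) : set pair :=
  [set p | SymPairs p /\ exists2 e : R, 0 < e &
     forall q, SymPairs q -> pdist p q < e -> S q].
Definition rclosure (S : set pair) : set pair :=
  [set p | SymPairs p /\ forall e : R, 0 < e -> exists2 q, S q & pdist p q < e].
Definition rclosed (S : set pair) : Prop := rclosure S `<=` S.
Definition rboundary (S : set pair) : set pair := rclosure S `\` rinterior S.

Definition padd (p q : pair) : pair := (p.1 + q.1, p.2 + q.2).

Definition proper_elliptic (Omega : set pt) (Theta : pt -> set pair) : Prop :=
  forall x, Omega x ->
    [/\ Theta x `<=` SymPairs, rclosed (Theta x), Theta x !=set0,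
        Theta x != SymPairs &
        forall p q, Theta x p -> Qset q -> Theta x (padd p q)].

Definition dist_to (p : pair) (S : set pair) : \bar R :=
  ereal_inf [set (pdist p q)%:E | q in S].
Definition hausdorff_dist (S T : set pair) : \bar R :=
  maxe (ereal_sup [set dist_to p T | p in S]) (ereal_sup [set dist_to q S | q in T]).

Definition hausdorff_continuous (Omega : set pt) (Theta : pt -> set pair) : Prop :=
  forall x, Omega x -> forall eta : R, 0 < eta ->
    exists2 delta : R, 0 < delta &
      forall y, Omega y -> `|x - y| < delta ->
        (hausdorff_dist (Theta x) (Theta y) < eta%:E)%E.

Definition Fop (h : pt -> R) (x : pt) (r : R) (A : 'M[R]_N) : R :=
  (- r) ^+ (N + 2) * \det A - h x.

Definition usc_on (D : set pt) (u : pt -> R) : Prop :=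
  forall x, D x -> forall e : R, 0 < e -> exists2 d : R, 0 < d &
    forall y, D y -> `|y - x| < d -> u y < u x + e.
Definition lsc_on (D : set pt) (u : pt -> R) : Prop :=
  forall x, D x -> forall e : R, 0 < e -> exists2 d : R, 0 < d &
    forall y, D y -> `|y - x| < d -> u x - e < u y.

Definition ebasis (i : 'I_N) : pt := delta_mx 0 i.
Definition partial (f : pt -> R) (i : 'I_N) : pt -> R := fun y => derive f y (ebasis i).
Definition hessian (f : pt -> R) (x : pt) : 'M[R]_N :=
  \matrix_(i, j) partial (partial f j) i x.

Definition C2_near (phi : pt -> R) (x0 : pt) : Prop :=
  exists2 r : R, 0 < r & forall x, ball x0 r x ->
    [/\ {for x, continuous phi},
        forall i, derivable phi x (ebasis i) /\ {for x, continuous (partial phi i)},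
        forall i j, derivable (partial phi j) x (ebasis i) &
        forall i j, {for x, continuous (partial (partial phi j) i)}].

Definition jet_plus (Omega : set pt) (u : pt -> R) (x0 : pt) : set pair :=
  [set p | exists phi, [/\ C2_near phi x0,
     (exists2 r : R, 0 < r & forall y, Omega y -> ball x0 r y -> u y <= phi y),
     u x0 = phi x0 & p = (phi x0, hessian phi x0)]].
Definition jet_minus (Omega : set pt) (u : pt -> R) (x0 : pt) : set pair :=
  [set p | exists phi, [/\ C2_near phi x0,
     (exists2 r : R, 0 < r & forall y, Omega y -> ball x0 r y -> phi y <= u y),
     u x0 = phi x0 & p = (phi x0, hessian phi x0)]].

Definition Q_subsolution (Omega : set pt) (h : pt -> R) (u : pt -> R) : Prop :=
  forall x0, Omega x0 -> forall p, jet_plus Omega u x0 p ->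
    0 <= Fop h x0 p.1 p.2 /\ Qset p.
Definition Q_supersolution (Omega : set pt) (h : pt -> R) (v : pt -> R) : Prop :=
  forall x0, Omega x0 -> forall p, jet_minus Omega v x0 p ->
    Fop h x0 p.1 p.2 <= 0 \/ ~ rinterior Qset p.

Definition ThetaMA (h : pt -> R) (x : pt) : set pair :=
  [set p | Qset p /\ h x <= (- p.1) ^+ (N + 2) * \det p.2].

End Defs.

(* Main.v *)
Require Import Defs.
From HB Require Import structures.
From mathcomp Require Import all_boot all_order all_algebra.
From mathcomp Require Import all_classical all_reals all_analysis.
From mathcomp Require Import ring lra.
Import Order.TTheory GRing.Theory Num.Theory.
Import numFieldNormedType.Exports.
Local Open Scope classical_set_scope.
Local Open Scope ring_scope.

(** The elliptic map is handled by shifting: [(r, A)] is replaced by [(r - t, A + t I)], and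
    superadditivity of the determinant on positive semidefinite matrices gives a gain of
    [t^(2 N + 2)] in [(-r)^(N+2) det A].

    For the comparison principle no theorem on sums is needed, because the operator is concave.
    A subsolution [u] is nonpositive and locally convex, hence locally Lipschitz, and
    [det D^2 u >= q] in the viscosity sense is equivalent to the family of linear inequalities
    [tr (S D^2 u S^T) >= c] with constant [S].  Each of them survives averaging over translations,
    so a [C^2] average [f] of [u], uniformly close to [u], satisfies [det D^2 f >= q] classically,
    and [f], slightly perturbed, is an admissible test function for the supersolution at a maximum
    point of [f - v].

    That averages preserve a linear inequality is shown with the resolvent of
    [L := tr (S D^2 . S^T)].  Since plane waves are eigenfunctions of [L], the equation
    [w - k^2 L w = p] is solved explicitly for trigonometric polynomials [p], and Bernstein
    polynomials in shifted cosines yield a partition of unity by such [p] around a point [y].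
    The maximum principle, applied to a viscosity subsolution of [L g >= c] and to a [C^2] function
    of the form [w + barrier], gives [g y <= sum_i om_i g(y_i) - k^2 c + O(k^4)] with nodes [y_i]
    and weights [om_i] that do not depend on [g].  This inequality can be averaged over translates
    of [u], and comparing it with the one for [-f] as [k] tends to [0] gives [L f >= c]. *)

Set Implicit Arguments. Unset Strict Implicit. Unset Printing Implicit Defensive.

(** * Row vectors and symmetric matrices *)

(** Concavity is available only in the matrix argument, whereas the equation also contains [u] and
    [x]. These are frozen near a maximum point [xd] of [u - v] plus a small convex paraboloid:
    [(-u)^(N+2)] is bounded above by a constant [P] and [h] below by [h xd - tau]. Since the maximum
    is positive, [- v] exceeds [- u] by a definite amount, and the same [P] bounds the coefficient
    of the supersolution from below. The paraboloid supplies the strict inequality, through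
    superadditivity of the determinant. Averages are iterated over coordinate segments, twice in
    each direction, so that one-variable antiderivatives suffice and every partial derivative is a
    difference quotient. The error in the resolvent inequality must be [o(k^2)], since the
    information sits in the term [k^2 c]. Localisation therefore uses a barrier of size [k^4] at the
    centre, and the slack [s], which measures the partition of unity, can be as small as [k^2]
    requires because the partition is chosen after [k]. *)

Lemma continuous_sumr (R : realType) (T : topologicalType) (I : Type) (r : seq I)
    (F : I -> T -> R) (x : T) :
  (forall i, {for x, continuous (F i)}) ->
  {for x, continuous (fun y => \sum_(i <- r) F i y)}.
Proof.
move=> H; elim: r => [|i r IH].
  rewrite (_ : (fun _ => _) = (fun=> 0)); last by apply/funext => y; rewrite big_nil.
  exact: cst_continuous.
rewrite (_ : (fun _ => _) = (fun y => F i y + \sum_(j <- r) F j y)).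
  exact: continuousD (H i) IH.
by apply/funext => y; rewrite big_cons.
Qed.

Section RowVectorNorm.
Variables (R : realType) (n : nat).
Implicit Types x y : 'rV[R]_n.

Lemma coord_le_norm x i : `|x 0 i| <= `|x|.
Proof.
by rewrite (_ : `|x| = mx_norm x)// mx_normrE; apply/bigmax_geP; right; exists (0, i).
Qed.

Lemma rV_norm_le x (M : R) : 0 <= M -> (forall i, `|x 0 i| <= M) -> `|x| <= M.
Proof.
move=> M0 H; rewrite (_ : `|x| = mx_norm x)// mx_normrE; apply/bigmax_leP; split=> // -[i j] _ /=.
by rewrite (ord1 i).
Qed.

Lemma rV_norm_lt x (M : R) : 0 < M -> (forall i, `|x 0 i| < M) -> `|x| < M.
Proof.
move=> M0 H; rewrite (_ : `|x| = mx_norm x)// mx_normrE; apply/bigmax_ltP; split=> // -[i j] _ /=.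
by rewrite (ord1 i).
Qed.

Lemma dotmxE m (u v : 'rV[R]_m) : (u *m v^T) 0 0 = \sum_i u 0 i * v 0 i.
Proof. by rewrite mxE; apply: eq_bigr => i _; rewrite mxE. Qed.

Lemma dotmxC m (u v : 'rV[R]_m) : (u *m v^T) 0 0 = (v *m u^T) 0 0.
Proof. by rewrite !dotmxE; apply: eq_bigr => i _; rewrite mulrC. Qed.

Lemma sqn_ge0 x : 0 <= (x *m x^T) 0 0.
Proof. by rewrite dotmxE; apply: sumr_ge0 => i _; rewrite -expr2 sqr_ge0. Qed.

Lemma sqr_coord_le_sqn x i : x 0 i ^+ 2 <= (x *m x^T) 0 0.
Proof.
rewrite dotmxE (bigD1 i)//= -expr2 lerDl; apply: sumr_ge0 => j _.
by rewrite -expr2 sqr_ge0.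
Qed.

Lemma sqr_norm_le_sqn x : `|x| ^+ 2 <= (x *m x^T) 0 0.
Proof.
rewrite -[leRHS]sqr_sqrtr ?sqn_ge0// ler_pXn2r ?nnegrE ?sqrtr_ge0//.
apply: rV_norm_le; first exact: sqrtr_ge0.
move=> i; rewrite -sqrtr_sqr ler_wsqrtr//; exact: sqr_coord_le_sqn.
Qed.

Lemma sqn_eq0 x : (x *m x^T) 0 0 = 0 -> x = 0.
Proof.
move=> x0; apply/rowP => i; rewrite [RHS]mxE; apply/eqP.
by rewrite -sqrf_eq0 eq_le sqr_ge0 andbT -x0 sqr_coord_le_sqn.
Qed.

Lemma sqn_le_norm x : (x *m x^T) 0 0 <= n%:R * `|x| ^+ 2.
Proof.
rewrite dotmxE -[X in X%:R * _]card_ord mulr_natl -sumr_const.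
apply: ler_sum => i _; rewrite -expr2 -real_normK ?num_real//.
by rewrite ler_pXn2r ?nnegrE// coord_le_norm.
Qed.

Lemma continuous_quadform (A : 'M[R]_n) :
  continuous (fun x : 'rV[R]_n => (x *m A *m x^T) 0 0).
Proof.
have -> : (fun x : 'rV[R]_n => (x *m A *m x^T) 0 0) =
    (fun x => \sum_(i < n) (\sum_(j < n) x 0 j * A j i) * x 0 i).
  by apply/funext => x; rewrite dotmxE; apply: eq_bigr => i _; rewrite mxE.
move=> x; apply: continuous_sumr => i; apply: continuousM; last exact: coord_continuous.
apply: continuous_sumr => j; apply: continuousM; first exact: coord_continuous.
exact: cst_continuous.
Qed.

Lemma continuous_sqn : continuous (fun x : 'rV[R]_n => (x *m x^T) 0 0).
Proof.
rewrite (_ : (fun _ => _) = (fun x : 'rV[R]_n => (x *m 1%:M *m x^T) 0 0)).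
  exact: continuous_quadform.
by apply/funext => x; rewrite mulmx1.
Qed.

End RowVectorNorm.

Section SymmetricMatrices.
Variable R : realType.

Lemma addmx00 (A B : 'M[R]_1) : (A + B) 0 0 = A 0 0 + B 0 0.
Proof. by rewrite mxE. Qed.

Lemma oppmx00 (A : 'M[R]_1) : (- A) 0 0 = - A 0 0.
Proof. by rewrite mxE. Qed.

Lemma scalemx00 (a : R) (A : 'M[R]_1) : (a *: A) 0 0 = a * A 0 0.
Proof. by rewrite mxE. Qed.

Definition mx00E := (addmx00, oppmx00, scalemx00).

Lemma mx11_tr (a : 'M[R]_1) : a^T = a.
Proof. by rewrite [a]mx11_scalar tr_scalar_mx. Qed.

Lemma symmx_bilin n (A : 'M[R]_n) (x y : 'rV[R]_n) : A^T = A ->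
  (y *m A *m x^T) 0 0 = (x *m A *m y^T) 0 0.
Proof.
by move=> sA; rewrite -[x *m A *m y^T]mx11_tr !trmx_mul trmxK sA mulmxA.
Qed.

Lemma quadformD n (A : 'M[R]_n) (x y : 'rV[R]_n) (t : R) : A^T = A ->
  ((x + t *: y) *m A *m (x + t *: y)^T) 0 0 =
  (x *m A *m x^T) 0 0 + t *+ 2 * (x *m A *m y^T) 0 0 + t ^+ 2 * (y *m A *m y^T) 0 0.
Proof.
move=> sA; rewrite linearD/= linearZ/= !mulmxDl !mulmxDr -!scalemxAl -!scalemxAr.
by rewrite !mx00E (symmx_bilin x y sA); ring.
Qed.

(** The form at [x + t *: y] with [y = x *m A] is [2 t |y|^2 + t^2 c] and nonnegative for all [t],
    which forces [y = 0]. *)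
Lemma psd_kernel n (A : 'M[R]_n) (x : 'rV[R]_n) : A^T = A -> psd A ->
  (x *m A *m x^T) 0 0 = 0 -> x *m A = 0.
Proof.
move=> sA pA x0; apply: sqn_eq0; set y := x *m A.
set b : R := (y *m y^T) 0 0; set c : R := (y *m A *m y^T) 0 0.
have b0 : 0 <= b := sqn_ge0 _.
have c0 : 0 <= c := pA _.
have H t : 0 <= t *+ 2 * b + t ^+ 2 * c.
  by have := pA (x + t *: y); rewrite quadformD// x0 add0r.
have [//|bn0] := eqVneq b 0.
have bp : 0 < b by rewrite lt_neqAle eq_sym bn0.
have c1 : 0 < c + 1 by rewrite ltr_wpDl.
(* [- b / c] would minimise the quadratic; [c + 1] keeps the denominator positive when [c = 0]. *)
have := H (- b / (c + 1)).
have -> : - b / (c + 1) *+ 2 * b + (- b / (c + 1)) ^+ 2 * c =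
   - (b ^+ 2 * (c + 2) / (c + 1) ^+ 2) by field; rewrite gt_eqF.
by rewrite oppr_ge0 leNgt divr_gt0// ?mulr_gt0 ?exprn_gt0// ltr_wpDl.
Qed.

(** Take a maximiser [x] of the quadratic form on the unit sphere, with value [a]. The form of
    [a%:M - A] is nonnegative and vanishes at [x], so [psd_kernel] turns maximality into the
    eigenvector equation. *)
Lemma symmx_eigenvector n (A : 'M[R]_n.+1) : A^T = A ->
  exists a (x : 'rV[R]_n.+1), (x *m x^T) 0 0 = 1 /\ x *m A = a *: x.
Proof.
move=> sA; pose S : set 'rV[R]_n.+1 := [set x | (x *m x^T) 0 0 = 1].
have S0 : S !=set0.
  exists (delta_mx 0 0); rewrite /S/= dotmxE (bigD1 0)//= big1 ?addr0 ?mxE ?eqxx ?mulr1//.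
  by move=> i /negbTE i0; rewrite !mxE i0 mulr0.
have cS : compact S.
  apply: bounded_closed_compact.
    exists 1; split; first exact: num_real.
    move=> M M1 x Sx; apply: le_trans (ltW M1).
    by rewrite -(@ler_pXn2r _ 2)// ?nnegrE// expr1n (le_trans (sqr_norm_le_sqn _))// Sx.
  have -> : S = (fun x : 'rV[R]_n.+1 => (x *m x^T) 0 0) @^-1` [set 1] by [].
  by apply: preimage_closed => [x _|]; [exact: continuous_sqn|exact: closed_eq].
have [|x] := EVT_max_rV S0 cS (f := fun x => (x *m A *m x^T) 0 0).
  by apply: continuous_subspaceT; exact: continuous_quadform.
rewrite inE => Sx maxx; exists ((x *m A *m x^T) 0 0), x; split=> //.
set a := (_ 0 0); apply/eqP; rewrite eq_sym -subr_eq0 -mul_mx_scalar -mulmxBr; apply/eqP.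
have qE (y : 'rV[R]_n.+1) : (y *m (a%:M - A) *m y^T) 0 0 =
   a * (y *m y^T) 0 0 - (y *m A *m y^T) 0 0.
  by rewrite mulmxBr mulmxBl mul_mx_scalar -scalemxAl !mx00E.
apply: psd_kernel; last by rewrite qE Sx mulr1 subrr.
  by rewrite linearB/= tr_scalar_mx sA.
move=> y; rewrite qE; have [->|y0] := eqVneq y 0.
  by rewrite !mul0mx mxE mulr0 subrr.
have sy : 0 < (y *m y^T) 0 0.
  by rewrite lt_neqAle sqn_ge0 andbT eq_sym; apply: contra_neq y0 => /sqn_eq0.
pose s := Num.sqrt ((y *m y^T) 0 0); have s0 : 0 < s by rewrite sqrtr_gt0.
have s2 : s ^+ 2 = (y *m y^T) 0 0 by rewrite sqr_sqrtr// ltW.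
have := maxx (s^-1 *: y); rewrite !inE /S/=.
rewrite -!scalemxAl linearZ/= -!scalemxAr !mx00E -/a -s2.
have E : s^-1 * (s^-1 * s ^+ 2) = 1 by field; rewrite gt_eqF.
move=> /(_ E); rewrite mulrA -invfM -expr2 mulrC ler_pdivrMr ?exprn_gt0// => ?.
by rewrite subr_ge0.
Qed.

End SymmetricMatrices.

(** * The spectral theorem for real symmetric matrices *)

Section Spectral.
Variable R : realType.

(* Householder reflection exchanging the first basis vector and [x]. *)
Lemma reflection_to n (x : 'rV[R]_(1 + n)) : (x *m x^T) 0 0 = 1 ->
  exists Q : 'M[R]_(1 + n), [/\ Q^T = Q, Q *m Q = 1%:M & delta_mx 0 0 *m Q = x].
Proof.
move=> x1; pose e : 'rV[R]_(1 + n) := delta_mx 0 0.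
have e1 : (e *m e^T) 0 0 = 1.
  rewrite dotmxE (bigD1 0)//= big1 ?addr0 ?mxE ?eqxx ?mulr1//.
  by move=> i /negbTE i0; rewrite !mxE i0 mulr0.
have [->|xe] := eqVneq x e; first by exists 1%:M; rewrite trmx1 !mulmx1.
pose w := e - x; pose s : R := (w *m w^T) 0 0.
have s0 : s != 0 by apply: contra_neq xe => /sqn_eq0/eqP; rewrite subr_eq0 => /eqP.
have sE : s = 2 * (e *m w^T) 0 0.
  rewrite /s /w linearB/= mulmxBl !mulmxBr !mx00E e1 x1 (dotmxC x e); ring.
have wwE : w *m w^T = s%:M by rewrite [LHS]mx11_scalar.
exists (1%:M - (2 / s) *: (w^T *m w)); split.
- by rewrite linearB/= trmx1 linearZ/= trmx_mul trmxK.
- have WW : (w^T *m w) *m (w^T *m w) = s *: (w^T *m w).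
    by rewrite -mulmxA (mulmxA w) wwE mul_scalar_mx -scalemxAr.
  move: (w^T *m w) WW => W WW; rewrite mulmxBl mul1mx mulmxBr mulmx1 -scalemxAl -scalemxAr WW !scalerA -addrA.
  rewrite -[RHS]addr0 -opprD; congr (_ + _).
  rewrite addrA -scalerDl -scalerBl (_ : _ - _ = 0) ?scale0r ?oppr0//; by field.
- rewrite -/e mulmxBr mulmx1 -scalemxAr mulmxA [e *m w^T]mx11_scalar mul_scalar_mx scalerA.
  rewrite (_ : 2 / s * _ = 1); last by rewrite mulrAC -sE divff.
  by rewrite scale1r /w opprB addrC subrK.
Qed.

(** Deflation: after conjugation by a reflection carrying the first basis vector to a unit
    eigenvector, the first row is diagonal, symmetry clears the first column, and induction handles
    the remaining block. *)
Theorem spectral_symmx n (A : 'M[R]_n) : A^T = A ->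
  exists (P : 'M[R]_n) (d : 'rV[R]_n), P *m P^T = 1%:M /\ A = P^T *m diag_mx d *m P.
Proof.
elim: n A => [|n IH] A sA.
  by exists 1%:M, 0; split; apply/matrixP => -[].
have [a [x [x1 xA]]] := symmx_eigenvector sA.
have [Q [sQ QQ eQ]] := @reflection_to n x x1.
have [B defB] : exists B : 'M[R]_(1 + n), B = Q *m A *m Q by exists (Q *m A *m Q).
have sB : B^T = B by rewrite defB !trmx_mul sQ sA mulmxA.
have B0 : row 0 B = a *: delta_mx 0 0.
  by rewrite rowE defB !mulmxA eQ xA -scalemxAl -{1}eQ -mulmxA QQ mulmx1.
have Bul : ulsubmx B = a%:M.
  rewrite [LHS]mx11_scalar; congr (_%:M).
  have := congr1 (fun M : 'rV[R]_(1+n) => M 0 0) B0.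
  rewrite !mxE eqxx mulr1 => <-; apply: (congr2 B); exact: val_inj.
have Bur : ursubmx B = 0.
  apply/rowP => j; have := congr1 (fun M : 'rV[R]_(1+n) => M 0 (rshift 1 j)) B0.
  by rewrite !mxE/= mulr0 => <-; apply: (congr2 B); exact: val_inj.
have Bdl : dlsubmx B = 0 by rewrite -{1}sB -trmx_ursub Bur trmx0.
have sC : (drsubmx B)^T = drsubmx B by rewrite trmx_drsub sB.
have [P1 [d1 [P1P1 BE]]] := IH _ sC.
exists ((block_mx 1%:M 0 0 P1 : 'M[R]_(1 + n)) *m Q), (row_mx (const_mx a) d1 : 'rV[R]_(1 + n)); split.
  rewrite trmx_mul mulmxA -(mulmxA _ Q) sQ QQ mulmx1.
  rewrite (@tr_block_mx _ 1 n 1 n) !trmx0 trmx1 (@mulmx_block _ 1 n 1 n 1 n).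
  by rewrite !mulmx0 !mul0mx !addr0 !add0r mulmx1 P1P1 -scalar_mx_block.
have AE : A = Q *m B *m Q by rewrite defB !mulmxA QQ mul1mx -mulmxA QQ mulmx1.
rewrite AE trmx_mul sQ -!mulmxA; congr (_ *m _); rewrite !mulmxA; congr (_ *m _).
rewrite -[LHS](@submxK _ 1 n 1 n) Bul Bur Bdl BE.
have -> : diag_mx (row_mx (const_mx a) d1 : 'rV[R]_(1 + n)) =
    block_mx (diag_mx (const_mx a)) 0 0 (diag_mx d1) by exact: diag_mx_row.
rewrite (@tr_block_mx _ 1 n 1 n) !trmx0 trmx1 !(@mulmx_block _ 1 n 1 n 1 n).
rewrite !mulmx0 !mul0mx !addr0 !add0r !mulmx1 !mul1mx; congr block_mx.
  by apply/matrixP => i j; rewrite !ord1 !mxE.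
by rewrite mul0mx.
Qed.

End Spectral.

(** * Positive semidefinite matrices: determinant, trace and spectral norm *)

Section PsdMatrices.
Variable R : realType.

Lemma psd_conj m n (A : 'M[R]_n) (S : 'M[R]_(m, n)) : psd A -> psd (S *m A *m S^T).
Proof.
by move=> pA x; have := pA (x *m S); rewrite trmx_mul !mulmxA.
Qed.

Lemma symmx_conj m n (A : 'M[R]_n) (S : 'M[R]_(m, n)) : A^T = A ->
  (S *m A *m S^T)^T = S *m A *m S^T.
Proof. by move=> sA; rewrite !trmx_mul trmxK sA mulmxA. Qed.

Lemma psdD n (A B : 'M[R]_n) : psd A -> psd B -> psd (A + B).
Proof. by move=> pA pB x; rewrite mulmxDr mulmxDl !mx00E addr_ge0. Qed.

Lemma quadform_scalar n (c : R) (x : 'rV[R]_n) :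
  (x *m c%:M *m x^T) 0 0 = c * (x *m x^T) 0 0.
Proof. by rewrite mul_mx_scalar -scalemxAl mx00E. Qed.

Lemma psd_scalar n (c : R) : 0 <= c -> psd (c%:M : 'M[R]_n).
Proof. by move=> c0 x; rewrite quadform_scalar mulr_ge0// sqn_ge0. Qed.

Lemma psd_diag n (d : 'rV[R]_n) : psd (diag_mx d) -> forall i, 0 <= d 0 i.
Proof.
move=> pd i; have := pd (delta_mx 0 i).
rewrite -rowE row_diag_mx dotmxE (bigD1 i)//= big1 => [|j /negbTE ji].
  by rewrite !mxE !eqxx !mulr1 addr0.
by rewrite !mxE ji/= !mulr0.
Qed.

Lemma psd_trace_ge0 n (A : 'M[R]_n) : psd A -> 0 <= \tr A.
Proof.
move=> pA; apply: sumr_ge0 => i _; have := pA (delta_mx 0 i).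
by rewrite -rowE trmx_delta -colE !mxE.
Qed.

Lemma psd_spectral n (A : 'M[R]_n) : A^T = A -> psd A ->
  exists (P : 'M[R]_n) (d : 'rV[R]_n),
    [/\ P *m P^T = 1%:M, P^T *m P = 1%:M, A = P^T *m diag_mx d *m P & forall i, 0 <= d 0 i].
Proof.
move=> sA pA; have [P [d [PP AE]]] := spectral_symmx sA.
have PP' := mulmx1C PP; exists P, d; split=> //; apply: psd_diag.
have -> : diag_mx d = P *m A *m P^T by rewrite AE !mulmxA PP mul1mx -mulmxA PP mulmx1.
exact: psd_conj.
Qed.

Lemma det_orthogonal_conj n (P D : 'M[R]_n) : P *m P^T = 1%:M ->
  \det (P^T *m D *m P) = \det D.
Proof.
move=> PP; rewrite !det_mulmx mulrAC -det_mulmx.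
by rewrite (mulmx1C PP) det1 mul1r.
Qed.

Lemma psd_det_ge0 n (A : 'M[R]_n) : A^T = A -> psd A -> 0 <= \det A.
Proof.
move=> sA pA; have [P [d [PP _ -> d0]]] := psd_spectral sA pA.
by rewrite det_orthogonal_conj// det_diag prodr_ge0.
Qed.

Lemma psd_det_le_trace n (A : 'M[R]_n) : A^T = A -> psd A ->
  n%:R ^+ n * \det A <= (\tr A) ^+ n.
Proof.
move=> sA pA; have [P [d [PP P'P -> d0]]] := psd_spectral sA pA.
rewrite det_orthogonal_conj// det_diag mxtrace_mulC mulmxA PP mul1mx mxtrace_diag.
have [n0|n0] := posnP n.
  by move: P d PP P'P d0 {sA pA}; rewrite n0 => *; rewrite !expr0 big_ord0 mulr1.
have := (@leif_AGM _ _ predT (fun i => d 0 i) (fun i _ => d0 i)).1.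
rewrite card_ord expr_div_n ler_pdivlMr ?exprn_gt0 ?ltr0n// mulrC.
exact.
Qed.

Lemma prod_add_ge n (d e : 'I_n -> R) : (0 < n)%N -> (forall i, 0 <= d i) -> (forall i, 0 <= e i) ->
  \prod_i d i + \prod_i e i <= \prod_i (d i + e i).
Proof.
elim: n d e => // n IH d e _ d0 e0; case: n IH d e d0 e0 => [|n] IH d e d0 e0.
  by rewrite !big_ord_recl !big_ord0 !mulr1.
rewrite big_ord_recl [X in _ + X]big_ord_recl [leRHS]big_ord_recl.
set D := \prod_(_ < _) _; set E := \prod_(_ < _) _; set F := \prod_(_ < _) _.
have F1 : D + E <= F by exact: IH.
have D0 : 0 <= D by apply: prodr_ge0 => i _; exact: d0.
have E0 : 0 <= E by apply: prodr_ge0 => i _; exact: e0.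
have := d0 ord0; have := e0 ord0; move: (d ord0) (e ord0) => a b b0 a0.
rewrite (le_trans _ (ler_wpM2l (addr_ge0 a0 b0) F1))//.
by rewrite mulrDl !mulrDr; have := mulr_ge0 a0 E0; have := mulr_ge0 b0 D0; lra.
Qed.

(** Takes [S = D^(-1/2) P] from the spectral form. It reduces superadditivity to the case of the
    identity, and later supplies the optimal coefficients in the duality argument. *)
Lemma psd_normalize n (A : 'M[R]_n) : A^T = A -> psd A -> \det A != 0 ->
  exists S : 'M[R]_n, S *m A *m S^T = 1%:M /\ \det S ^+ 2 * \det A = 1.
Proof.
move=> sA pA dA; suff [S SE] : exists S : 'M[R]_n, S *m A *m S^T = 1%:M.
  exists S; split=> //; have := congr1 determinant SE.
  by rewrite !det_mulmx det_tr det1 => <-; ring.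
have [P [d [PP _ AE d0]]] := psd_spectral sA pA.
have dn0 i : d 0 i != 0.
  move: dA; rewrite AE det_orthogonal_conj// det_diag; apply: contra_neq => di.
  by rewrite (bigD1 i)//= di mul0r.
pose D := diag_mx (\row_i (Num.sqrt (d 0 i))^-1); exists (D *m P).
rewrite trmx_mul AE !mulmxA -(mulmxA D) PP mulmx1 -!mulmxA (mulmxA P) PP mul1mx.
rewrite tr_diag_mx !mulmx_diag -diag_const_mx; congr diag_mx.
apply/rowP => i; rewrite !mxE; set s := Num.sqrt _.
have s2 : s ^+ 2 = d 0 i by rewrite sqr_sqrtr.
have s0 : s != 0 by apply: contra_neq (dn0 i) => s0; rewrite -s2 s0 expr0n.
by rewrite -s2; field.
Qed.

(** Congruence with the normaliser of [A] turns the claim into [1 + prod d_i <= prod (1 + d_i)].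
    When both determinants vanish, nonnegativity of the right side is enough. *)
Lemma psd_det_superadd n (A B : 'M[R]_n) : (0 < n)%N -> A^T = A -> B^T = B -> psd A -> psd B ->
  \det A + \det B <= \det (A + B).
Proof.
move=> n0; wlog dA : A B / \det A != 0.
  move=> H sA sB pA pB; have [dA|dA] := eqVneq (\det A) 0; last exact: H.
  have [dB|dB] := eqVneq (\det B) 0; last by rewrite addrC (addrC A); exact: H.
  rewrite dA dB addr0; apply: psd_det_ge0; last exact: psdD.
  by rewrite linearD/= sA sB.
move=> sA sB pA pB.
have [S [SA dS]] := psd_normalize sA pA dA.
pose C := S *m B *m S^T.
have sC : C^T = C by exact: symmx_conj.
have pC : psd C by exact: psd_conj.
have S2 : 0 < \det S ^+ 2.
  rewrite lt_neqAle sqr_ge0 andbT eq_sym; apply/eqP => S0.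
  by move: dS => /eqP; rewrite S0 mul0r eq_sym oner_eq0.
rewrite -(ler_pM2l S2) mulrDr dS.
have -> : \det S ^+ 2 * \det B = \det C by rewrite /C !det_mulmx det_tr; ring.
have -> : \det S ^+ 2 * \det (A + B) = \det (1%:M + C).
  by rewrite -SA /C -mulmxDl -mulmxDr !det_mulmx det_tr; ring.
have [P [d [PP P'P CE d0]]] := psd_spectral sC pC.
have -> : 1%:M + C = P^T *m (diag_mx (const_mx 1 + d)) *m P.
  by rewrite linearD/= mulmxDr mulmxDl -CE diag_const_mx mulmx1 P'P.
rewrite CE !det_orthogonal_conj// !det_diag.
have := @prod_add_ge n (fun=> 1) (fun i => d 0 i) n0 (fun=> ler01) d0.
by rewrite big1//; under [X in _ -> _ <= X]eq_bigr do rewrite !mxE.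
Qed.

Lemma psd_det_le n (A B : 'M[R]_n) : (0 < n)%N -> A^T = A -> B^T = B -> psd A -> psd (B - A) ->
  \det A <= \det B.
Proof.
move=> n0 sA sB pA pBA; have sBA : (B - A)^T = B - A by rewrite linearB/= sA sB.
have := psd_det_superadd n0 sA sBA pA pBA; rewrite (addrC A (B - A)) subrK => H; apply: le_trans H.
by rewrite lerDl; exact: psd_det_ge0.
Qed.

Lemma eigenvalue_orthogonal_diag n (P : 'M[R]_n) (d : 'rV[R]_n) a : P *m P^T = 1%:M ->
  eigenvalue (P^T *m diag_mx d *m P) a <-> exists i, a = d 0 i.
Proof.
move=> PP; have P'P := mulmx1C PP; split=> [/eigenvalueP[v vE v0]|[i ->]]; last first.
  apply/eigenvalueP; exists (delta_mx 0 i *m P).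
    rewrite !mulmxA -(mulmxA _ P) PP mulmx1 -[delta_mx 0 i *m diag_mx d]rowE row_diag_mx.
    by rewrite -scalemxAl.
  apply/eqP => /(congr1 (mulmx^~ P^T)); rewrite mul0mx -mulmxA PP mulmx1.
  by move=> /rowP/(_ i)/eqP; rewrite !mxE !eqxx oner_eq0.
pose w := v *m P^T.
have wE : w *m diag_mx d = a *: w.
  have := congr1 (mulmx^~ P^T) vE.
  by rewrite !mulmxA -!scalemxAl -(mulmxA _ P) PP mulmx1.
have : exists i, w 0 i != 0.
  apply/existsP; rewrite -negb_forall; apply: contra v0 => /forallP w0.
  have w00 : w = 0 by apply/rowP => i; rewrite [RHS]mxE; apply/eqP; exact: w0.
  by rewrite -[v]mulmx1 -P'P mulmxA -/w w00 mul0mx.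
case=> i wi; exists i; apply: (mulfI wi).
have := congr1 (fun M : 'rV[R]_n => M 0 i) wE; rewrite mul_mx_diag !mxE => ->.
by rewrite mulrC.
Qed.

(** Translates smallness of the spectral norm into the semidefinite order, in which monotonicity of
    the determinant applies. *)
Lemma spec_norm_psd n (A : 'M[R]_n) (e : R) : A^T = A -> spec_norm A < e ->
  psd (e%:M - A) /\ psd (e%:M + A).
Proof.
move=> sA; have [P [d [PP AE]]] := spectral_symmx sA; have P'P := mulmx1C PP.
move=> sAe; have dle i : `|d 0 i| <= e.
  apply: ltW; apply: le_lt_trans sAe; apply: ub_le_sup.
    exists (\sum_i `|d 0 i|) => _ [a /= + <-].
    rewrite AE => /(eigenvalue_orthogonal_diag _ _ PP)[j ->].
    by rewrite (bigD1 j)//= lerDl sumr_ge0.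
  by exists (d 0 i) => //=; rewrite AE; apply/(eigenvalue_orthogonal_diag _ _ PP); exists i.
have H (c : R) (x : 'rV[R]_n) : (x *m (e%:M + c *: A) *m x^T) 0 0 =
    \sum_i (e + c * d 0 i) * (x *m P^T) 0 i ^+ 2.
  have -> : e%:M + c *: A = P^T *m diag_mx (const_mx e + c *: d) *m P.
    rewrite linearD/= linearZ/= diag_const_mx mulmxDr mulmxDl AE -scalemxAr -scalemxAl.
    by rewrite mul_mx_scalar -scalemxAl P'P scalemx1.
  rewrite !mulmxA -(mulmxA _ P x^T) (_ : P *m x^T = (x *m P^T)^T); last first.
    by rewrite trmx_mul trmxK.
  rewrite dotmxE; apply: eq_bigr => i _.
  by rewrite mul_mx_diag !mxE expr2 [in RHS]mulrA [in RHS]mulrAC [in LHS](mulrC _ (e + _)).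
have HP (c : R) : `|c| <= 1 -> psd (e%:M + c *: A).
  move=> c1 x; rewrite H; apply: sumr_ge0 => i _; rewrite mulr_ge0 ?sqr_ge0//.
  rewrite -lerBlDr sub0r; have := dle i; have : `|c * d 0 i| <= `|d 0 i|.
    by rewrite normrM ler_piMl.
  by move=> h1 /(le_trans h1); rewrite ler_norml => /andP[+ _]; rewrite lerNl.
split; [have := HP (-1)|have := HP 1]; rewrite ?scaleN1r ?scale1r; apply.
  by rewrite normrN1.
by rewrite normr1.
Qed.

Lemma spec_norm_scalar n (c : R) : (0 < n)%N -> spec_norm (c%:M : 'M[R]_n) = `|c|.
Proof.
case: n => // n _; rewrite /spec_norm.
rewrite (_ : [set _ | _ in _] = [set `|c|]) ?sup1//.
apply/seteqP; split=> [_ [a /= /eigenvalueP[v vE v0] <-]|_ ->] /=.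
  move: vE; rewrite mul_mx_scalar => /eqP; rewrite -subr_eq0 -scalerBl scaler_eq0 (negbTE v0) orbF.
  by rewrite subr_eq0 => /eqP ->.
exists c => //; apply/eigenvalueP; exists (delta_mx 0 0); first by rewrite mul_mx_scalar.
by apply/eqP => /rowP/(_ 0)/eqP; rewrite !mxE !eqxx oner_eq0.
Qed.

End PsdMatrices.

(** * The elliptic map *)

Section EllipticMap.
Variables (R : realType) (N : nat).
Hypothesis hN : (0 < N)%N.
Implicit Types p q : (R * 'M[R]_N)%type.

Lemma horner_near0 (f : {poly R}) (eps : R) : 0 < eps ->
  exists2 d : R, 0 < d & forall e, `|e| < d -> `|f.[e] - f.[0]| < eps.
Proof.
move=> eps0; have /cvgrPdist_lt/(_ eps eps0) := @continuous_horner R f 0.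
rewrite -nbhs_nearE => /nbhs_ballP[d /= d0 dH].
exists d => // e ed; rewrite distrC; apply: dH.
by rewrite -ball_normE /ball_ /= sub0r normrN.
Qed.

Lemma horner_ge_at0 (f : {poly R}) (c : R) : (forall e, 0 < e -> c <= f.[e]) -> c <= f.[0].
Proof.
move=> H; rewrite leNgt; apply/negP => fc.
have [|d d0 dH] := @horner_near0 f (c - f.[0]); first by rewrite subr_gt0.
have := dH (d / 2); rewrite ger0_norm ?divr_ge0 ?ltW// => /(_ _).
move=> /(_ ltac:(lra)); have := H (d / 2) ltac:(lra) => h1.
by rewrite ger0_norm; lra.
Qed.

Lemma horner_gt_at0 (f : {poly R}) (c d0 : R) : c < f.[0] -> 0 < d0 ->
  exists2 e, 0 < e <= d0 & c < f.[- e].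
Proof.
move=> fc dp; have [|d dd dH] := @horner_near0 f (f.[0] - c); first by rewrite subr_gt0.
exists (Num.min (d / 2) d0); first by rewrite lt_min ge_min lexx orbT; lra.
set e := Num.min _ _; have e1 : e <= d / 2 by rewrite ge_min lexx.
have e0 : 0 < e by rewrite lt_min; lra.
by have := dH (- e); rewrite normrN gtr0_norm// ltr_norml => /(_ ltac:(lra)); lra.
Qed.

Lemma det_addscalar_poly (A : 'M[R]_N) : A^T = A ->
  exists f : {poly R}, forall e, f.[e] = \det (A + e%:M).
Proof.
move=> sA; have [P [d [PP AE]]] := spectral_symmx sA; have P'P := mulmx1C PP.
exists (\prod_i ('X + (d 0 i)%:P)) => e.
have -> : A + e%:M = P^T *m diag_mx (d + const_mx e) *m P.
  rewrite linearD/= diag_const_mx mulmxDr mulmxDl -AE.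
  by rewrite mul_mx_scalar -scalemxAl P'P scalemx1.
rewrite det_orthogonal_conj// det_diag horner_prod; apply: eq_bigr => i _.
by rewrite !hornerE !mxE addrC.
Qed.

(** Along the shift [(r - e, A + e I)] the operator is a polynomial in [e], so the limits [e -> 0]
    needed for closedness and for the boundary reduce to continuity of polynomials in one
    variable. *)
Lemma MA_addscalar_poly (r : R) (A : 'M[R]_N) : A^T = A ->
  exists f : {poly R}, forall e, f.[e] = (- (r - e)) ^+ (N + 2) * \det (A + e%:M).
Proof.
move=> sA; have [f fE] := det_addscalar_poly sA.
exists (('X - r%:P) ^+ (N + 2) * f) => e.
by rewrite hornerM horner_exp !hornerE fE opprB.
Qed.

Lemma MA_mono (r r' : R) (A A' : 'M[R]_N) : A^T = A -> A'^T = A' -> psd A -> psd (A' - A) ->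
  r <= 0 -> r' <= r -> (- r) ^+ (N + 2) * \det A <= (- r') ^+ (N + 2) * \det A'.
Proof.
move=> sA sA' pA pA' r0 rr'; apply: ler_pM.
- by rewrite exprn_ge0// oppr_ge0.
- exact: psd_det_ge0.
- by rewrite lerXn2r ?nnegrE ?oppr_ge0 ?lerN2// (le_trans rr').
- exact: psd_det_le.
Qed.

Lemma pdist_lt p q (e : R) : SymPairs p -> SymPairs q -> pdist p q < e ->
  `|p.1 - q.1| < e /\ psd (e%:M - (p.2 - q.2)) /\ psd (e%:M + (p.2 - q.2)).
Proof.
move=> sp sq; rewrite gt_max => /andP[-> /spec_norm_psd H]; split=> //.
by apply: H; rewrite linearB/= sp sq.
Qed.

Lemma psd_lim0 (A : 'M[R]_N) : (forall e, 0 < e -> psd (A + e%:M)) -> psd A.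
Proof.
move=> H x; set a := (x *m A *m _) 0 0; set b := (x *m x^T) 0 0; have b0 : 0 <= b by exact: sqn_ge0.
apply/ler_addgt0Pl => e e0.
rewrite -[e](@divfK _ (b + 1)); last by rewrite gt_eqF// ltr_wpDl.
have eb : 0 < e / (b + 1) by rewrite divr_gt0// ltr_wpDl.
have := H _ eb x; rewrite mulmxDr mulmxDl mx00E quadform_scalar -/a -/b.
by move=> h; apply: le_trans h _; rewrite addrC lerD2r ler_pM2l// lerDl.
Qed.

(** A member of the set within distance [e] is dominated by the shifted pair [(r - e, A + e I)],
    which therefore satisfies the inequality by monotonicity; then [e] tends to [0]. *)
Lemma ThetaMA_closed (h : 'rV[R]_N -> R) x : rclosed (ThetaMA h x).
Proof.
move=> [r A] [sA H]; rewrite /SymPairs/symmetric_mx/= in sA.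
have near (e : R) : 0 < e -> [/\ r <= e, psd (A + e%:M) &
    h x <= (- (r - e)) ^+ (N + 2) * \det (A + e%:M)].
  move=> e0; have [[r' A'] [[sA' [r'0 pA']] hq] pq] := H e e0.
  have [/=] := @pdist_lt (r, A) (r', A') e sA sA' pq.
  rewrite ltr_norml => /andP[rr1 rr2] [_ pe].
  have dE : A + e%:M - A' = e%:M + (A - A') by rewrite addrAC addrC.
  have sAe : (A + e%:M)^T = A + e%:M by rewrite linearD/= tr_scalar_mx sA.
  split.
  - by move: r'0 => /= ?; lra.
  - by rewrite -[A + _](subrK A') dE; exact: psdD.
  - apply: (le_trans hq); apply: MA_mono => //=; last by lra.
    by rewrite dE.
have [f fE] := MA_addscalar_poly r sA.
split; first split; rewrite //=; first split.
- by apply/ler_addgt0Pl => e e0; rewrite addr0; case: (near e e0).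
- by apply: psd_lim0 => e e0; case: (near e e0).
- have := @horner_ge_at0 f (h x); rewrite fE subr0 raddf0 addr0; apply => e e0.
  by rewrite fE; case: (near e e0).
Qed.

Lemma ThetaMA_elliptic (h : 'rV[R]_N -> R) (Omega : set 'rV[R]_N) :
  proper_elliptic Omega (ThetaMA h).
Proof.
move=> x _; split.
- by move=> p [[]].
- exact: ThetaMA_closed.
(* With [m = max 1 (h x)], [m >= 1] gives [m^(N+2) >= m >= h x]. *)
- exists (- Num.max 1 (h x), 1%:M); split=> /=.
    split; first exact: trmx1.
    split=> /=; first by rewrite oppr_le0 le_max ler01.
    exact: psd_scalar ler01.
  rewrite opprK det1 mulr1; set m := Num.max _ _.
  have m1 : 1 <= m by rewrite le_max lexx.
  rewrite (le_trans (_ : h x <= m)) ?le_max ?lexx ?orbT//.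
  by rewrite -[leLHS]expr1 ler_weXn2l// addn2.
- apply/eqP => /seteqP[_ /(_ (1, 0))] /=.
  case; first by rewrite /SymPairs/symmetric_mx/= trmx0.
  by move=> [_ [/= +]]; rewrite ler10.
- move=> [r A] [s P] [[/= sA [/= r0 pA]] hA] [sP [/= s0 pP]].
  rewrite /symmetric_mx/= in sA sP; split=> /=.
    split; first by rewrite /symmetric_mx/= linearD/= sA sP.
    by split=> /=; [lra|exact: psdD].
  apply: (le_trans hA) => /=; apply: MA_mono => //=.
  + by rewrite linearD/= sA sP.
  + by rewrite addrC addrA addNr add0r.
  + by rewrite gerDl.
Qed.

(** The gain [t^(N+2) t^N] does not depend on [p]; this uniformity makes the Hausdorff distance of
    two unbounded sets small. *)
Lemma ThetaMA_shift (h : 'rV[R]_N -> R) x y p (t : R) : 0 < t ->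
  h y <= h x + t ^+ (N + 2) * t ^+ N -> ThetaMA h x p ->
  ThetaMA h y (p.1 - t, p.2 + t%:M).
Proof.
case: p => r A t0 hxy [[/= sA [/= r0 pA]] hA]; rewrite /symmetric_mx/= in sA.
have tP : psd (t%:M : 'M[R]_N) by apply: psd_scalar; exact: ltW.
split=> /=; first split=> /=.
- by rewrite /symmetric_mx linearD/= tr_scalar_mx sA.
- by split=> /=; [lra|exact: psdD].
- have dt := psd_det_superadd hN sA (tr_scalar_mx _ t) pA tP.
  rewrite det_scalar in dt; have dA := psd_det_ge0 sA pA.
  rewrite opprB addrC.
  have r0' : 0 <= - r by rewrite oppr_ge0.
  have rt : (- r) ^+ (N + 2) + t ^+ (N + 2) <= (- r + t) ^+ (N + 2).
    have := @prod_add_ge R (N + 2) (fun=> - r) (fun=> t); rewrite !prodr_const card_ord.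
    by apply => //; [rewrite addn2|move=> _; exact: ltW].
  apply: (le_trans hxy); rewrite (le_trans (lerD hA (lexx _)))//=.
  have a0 : 0 <= (- r) ^+ (N + 2) by rewrite exprn_ge0.
  have b0 : 0 <= t ^+ (N + 2) by rewrite exprn_ge0// ltW.
  have c0 : 0 <= t ^+ N by rewrite exprn_ge0// ltW.
  apply: (le_trans _ (ler_pM _ _ rt dt)); rewrite ?addr_ge0//.
  rewrite mulrDl !mulrDr; have := mulr_ge0 a0 c0; have := mulr_ge0 b0 dA; lra.
Qed.

Lemma dist_to_shift p t (S : set (R * 'M[R]_N)) : 0 < t -> S (p.1 - t, p.2 + t%:M) ->
  (dist_to p S <= t%:E)%E.
Proof.
move=> t0 Sp; apply: ereal_inf_lbound; exists (p.1 - t, p.2 + t%:M) => //.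
congr EFin; rewrite /pdist/= opprB addrCA subrr addr0 opprD addrA subrr sub0r.
by rewrite -raddfN/= spec_norm_scalar// normrN gtr0_norm// maxxx.
Qed.

Lemma within_open_continuous_near (Omega : set 'rV[R]_N) (h : 'rV[R]_N -> R) x (eps : R) :
  open Omega -> {within Omega, continuous h} -> Omega x -> 0 < eps ->
  exists2 d : R, 0 < d & forall y, `|x - y| < d -> Omega y /\ `|h x - h y| < eps.
Proof.
move=> oO cO Ox e0.
have hx : {for x, continuous h}.
  by move: cO; rewrite continuous_open_subspace// => /(_ x); rewrite inE; apply.
have /cvgrPdist_lt/(_ eps e0) := hx.
rewrite -nbhs_nearE => /nbhs_ballP[d1 /= d10 H1].
have /nbhs_ballP[d2 /= d20 H2] : nbhs x Omega by exact: open_nbhs_nbhs.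
exists (Num.min d1 d2); first by rewrite lt_min d10.
move=> y; rewrite lt_min => /andP[y1 y2]; split.
  by apply: H2; rewrite -ball_normE.
by apply: H1; rewrite -ball_normE.
Qed.

Lemma ThetaMA_hausdorff_continuous (Omega : set 'rV[R]_N) (h : 'rV[R]_N -> R) :
  open Omega -> {within Omega, continuous h} -> hausdorff_continuous Omega (ThetaMA h).
Proof.
move=> oO cO x Ox eta eta0; pose t := eta / 2.
have t0 : 0 < t by rewrite divr_gt0.
have c0 : 0 < t ^+ (N + 2) * t ^+ N by rewrite mulr_gt0// exprn_gt0.
have [d d0 H] := within_open_continuous_near oO cO Ox c0.
exists d => // y Oy xy; have [_] := H y xy; rewrite ltr_norml => /andP[h1 h2].
apply: (@le_lt_trans _ _ t%:E); last by rewrite lte_fin /t ltr_pdivrMr// ltr_pMr// ltr1n.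
rewrite /hausdorff_dist ge_max; apply/andP; split; apply: ub_ereal_sup => _ [p Tp <-];
  apply: dist_to_shift => //; apply: ThetaMA_shift Tp => //; lra.
Qed.

Lemma rinterior_Qset (r : R) (A : 'M[R]_N) (e : R) : A^T = A -> 0 < e -> r <= - e ->
  psd (A - e%:M) -> rinterior (@Qset R N) (r, A).
Proof.
move=> sA e0 re pA; split=> //; exists e => // -[r' A'] sA' pq.
have [/=] := @pdist_lt (r, A) (r', A') e sA sA' pq.
rewrite ltr_norml => /andP[rr1 rr2] [pe _]; split=> //=; split=> /=; first by lra.
rewrite (_ : A' = (A - e%:M) + (e%:M - (A - A'))); first exact: psdD.
by rewrite addrA subrK opprB addrC subrK.
Qed.

(** A pair with strict inequality is interior: [h x >= 0] makes the value of the operator positive,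
    so [r < 0] and [A] is definite; then [(r + e, A - e I)] keeps a value above [h x] for small [e],
    and every pair within distance [e] dominates it. *)
Lemma ThetaMA_boundary (h : 'rV[R]_N -> R) x : 0 <= h x ->
  rboundary (ThetaMA h x) `<=`
         [set p | SymPairs p /\ (- p.1) ^+ (N + 2) * \det p.2 = h x].
Proof.
move=> hx [r A] [/ThetaMA_closed[[/= sA [/= r0 pA]] hA] nint].
split=> //; rewrite /symmetric_mx/= in sA; move: hA; rewrite le_eqVlt => /orP[/eqP->//|/= hlt].
exfalso; apply: nint; split=> //.
have rA : 0 < (- r) ^+ (N + 2) * \det A by exact: le_lt_trans hlt.
have rneg : r < 0.
  rewrite lt_neqAle r0 andbT; apply/eqP => rz; move: rA.
  by rewrite rz oppr0 expr0n addn2 mul0r ltxx.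
have dA : 0 < \det A.
  rewrite lt_neqAle psd_det_ge0// andbT eq_sym; apply/eqP => dz.
  by move: rA; rewrite dz mulr0 ltxx.
have [m m0 pAm] : exists2 m, 0 < m & psd (A - m%:M).
  have [P [d [PP P'P AE d0]]] := psd_spectral sA pA.
  have dn0 i : 0 < d 0 i.
    rewrite lt_neqAle d0 andbT eq_sym; apply/eqP => di; move: dA.
    by rewrite AE det_orthogonal_conj// det_diag (bigD1 i)//= di mul0r ltxx.
  pose m := \big[Num.min/1]_i d 0 i; exists m.
    by apply: lt_bigmin => // i _; exact: dn0.
  have mle i : m <= d 0 i by exact: bigmin_le_cond.
  have -> : A - m%:M = P^T *m diag_mx (d - const_mx m) *m P.
    rewrite linearB/= diag_const_mx mulmxBr mulmxBl -AE.
    by rewrite mul_mx_scalar -scalemxAl P'P scalemx1.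
  rewrite -[X in _ *m _ *m X]trmxK; apply: psd_conj => y.
  rewrite dotmxE; apply: sumr_ge0 => i _; rewrite mul_mx_diag !mxE.
  by rewrite mulrAC -expr2 mulr_ge0 ?sqr_ge0// subr_ge0.
have [f fE] := MA_addscalar_poly r sA.
have [||e /andP[e0 ele] fe] := @horner_gt_at0 f (h x) (Num.min m (- r)).
- by rewrite fE subr0 raddf0 addr0.
- by rewrite lt_min m0 oppr_gt0.
move: ele; rewrite le_min => /andP[em er].
exists e => // -[r' A'] sA' pq.
have [/=] := @pdist_lt (r, A) (r', A') e sA sA' pq.
rewrite ltr_norml => /andP[rr1 rr2] [pe _].
have pAe : psd (A - e%:M).
  rewrite (_ : A - e%:M = (A - m%:M) + (m - e)%:M).
    by apply: psdD => //; apply: psd_scalar; rewrite subr_ge0.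
  by rewrite raddfB/= addrA subrK.
have E : A' - (A - e%:M) = e%:M - (A - A') by rewrite !opprB addrCA.
split=> /=; first split=> //=; first split=> /=; first by lra.
  by rewrite -[A'](subrK (A - e%:M)) E; exact: psdD.
apply: ltW; apply: (lt_le_trans fe); rewrite fE [(- e)%:M]raddfN/=; apply: MA_mono => //.
- by rewrite linearB/= tr_scalar_mx sA.
- by rewrite E.
- by lra.
- by lra.
Qed.

End EllipticMap.

(** * Twice continuously differentiable functions *)

Section DirectionalDerivative.
Variable R : realType.

Lemma continuous_cstM (T : topologicalType) (c : R) (g : T -> R) (x : T) :
  {for x, continuous g} -> {for x, continuous (fun y => c * g y)}.
Proof. exact/continuousM/cst_continuous. Qed.

Lemma is_derive_eps (V : normedModType R) (f : V -> R) (x v : V) (d : R) :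
  (forall e : R, 0 < e -> exists2 r : R, 0 < r &
     forall h, `|h| < r -> `|f (x + h *: v) - f x - h * d| <= e * `|h|) ->
  is_derive x v f d.
Proof.
move=> H.
have C : h^-1 *: ((f \o shift x) (h *: v) - f x) @[h --> 0^'] --> d.
  apply/cvgrPdist_le => e e0; have [r r0 Hr] := H e e0.
  rewrite near_withinE; near=> h => h0.
  have -> : d - h^-1 *: ((f \o shift x) (h *: v) - f x) =
      - (h^-1 * (f (x + h *: v) - f x - h * d)).
    by rewrite /GRing.scale/= (addrC x); field.
  rewrite normrN normrM normfV ler_pdivrMl ?normr_gt0// [leRHS]mulrC.
  apply: Hr; near: h; apply/nbhs_ballP; exists r => //= y.
  by rewrite -ball_normE/= sub0r normrN.
split; first by apply/cvg_ex; exists d.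
exact/cvg_lim.
Unshelve. all: by end_near. Qed.

Lemma eps_is_derive (V : normedModType R) (f : V -> R) (x v : V) (d : R) : is_derive x v f d ->
  forall e : R, 0 < e -> exists2 r : R, 0 < r &
     forall h, `|h| < r -> `|f (x + h *: v) - f x - h * d| <= e * `|h|.
Proof.
move=> [dv dE] e e0.
have /cvgrPdist_le/(_ e e0) : h^-1 *: ((f \o shift x) (h *: v) - f x) @[h --> 0^'] --> d.
  by rewrite -dE; exact: dv.
rewrite near_withinE -nbhs_nearE => /nbhs_ballP[r /= r0 Hr]; exists r => // h hr.
have [->|h0] := eqVneq h 0; first by rewrite scale0r addr0 subrr mul0r subr0 normr0 mulr0.
have := Hr h; rewrite -ball_normE/= sub0r normrN => /(_ hr h0).
have -> : d - h^-1 *: ((f \o shift x) (h *: v) - f x) =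
    - (h^-1 * (f (x + h *: v) - f x - h * d)).
  by rewrite /GRing.scale/= (addrC x); field.
by rewrite normrN normrM normfV ler_pdivrMl ?normr_gt0// [leRHS]mulrC.
Qed.

End DirectionalDerivative.

Section Derivatives.
Variables (R : realType) (N : nat).
Notation pt := 'rV[R]_N.

Lemma is_derive_line (f : pt -> R) (x v : pt) (t d : R) :
  is_derive (x + t *: v) v f d <-> is_derive t 1 (fun s : R => f (x + s *: v)) d.
Proof.
have E : (fun h : R => h^-1 *: ((f \o shift (x + t *: v)) (h *: v) - f (x + t *: v))) =
  (fun h : R => h^-1 *: (((fun s : R => f (x + s *: v)) \o shift t) (h *: 1) - f (x + t *: v))).
  apply/funext => h /=; rewrite /GRing.scale/= mulr1 addrCA -scalerDl.
  by rewrite -/(GRing.scale _ _).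
have Ed : derivable f (x + t *: v) v = derivable (fun s : R => f (x + s *: v)) t 1.
  by rewrite /derivable E.
have Ev : derive f (x + t *: v) v = derive (fun s : R => f (x + s *: v)) t 1.
  by rewrite /derive E.
by split=> -[dv dE]; split; [rewrite -Ed|rewrite -Ev|rewrite Ed|rewrite Ev].
Qed.

Lemma mean_value_line (f g : pt -> R) (x v : pt) (c e s : R) :
  (forall y, is_derive y v f (g y)) ->
  (forall t, `|t| <= `|s| -> `|g (x + t *: v) - c| <= e) ->
  `|f (x + s *: v) - f x - s * c| <= e * `|s|.
Proof.
wlog s0 : v c g s / 0 <= s => [H dg gc|].
  have [s0|s0] := leP 0 s; first exact: H.
  have dg' y : is_derive y (- v) f (- g y).
    apply: is_derive_eps => e' e'0; have [r r0 Hr] := eps_is_derive (dg y) e'0.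
    exists r => // h hr; have := Hr (- h); rewrite normrN => /(_ hr).
    by rewrite scaleNr scalerN mulrN mulNr.
  have -> : s *: v = (- s) *: (- v) by rewrite scalerN scaleNr opprK.
  rewrite -(normrN s) -mulrNN; apply: (H _ _ (fun y => - g y)) => //.
    by rewrite oppr_ge0 ltW.
  move=> t; rewrite normrN => ts; rewrite -opprD normrN scalerN -scaleNr; apply: gc.
  by rewrite normrN.
move=> dg gc; have [s00|sn0] := eqVneq s 0.
  by rewrite s00 scale0r addr0 subrr mul0r subr0 normr0 mulr0.
have sp : 0 < s by rewrite lt_neqAle eq_sym sn0.
have dl (t : R) : is_derive t 1 (fun t : R => f (x + t *: v)) (g (x + t *: v)).
  by apply/is_derive_line; exact: dg.
have [|t] := @MVT R (fun t : R => f (x + t *: v)) (fun t => g (x + t *: v)) 0 s sp (fun t _ => dl t).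
  apply: continuous_subspaceT => t; apply: differentiable_continuous.
  by apply/derivable1_diffP; case: (dl t).
rewrite in_itv/= => /andP[t0 ts]; rewrite scale0r addr0 subr0 => ->.
rewrite mulrC -mulrBr normrM mulrC ler_wpM2r//; apply: gc.
by rewrite !gtr0_norm// ltW.
Qed.

(* The mean value theorem in one coordinate at a time. *)
Lemma is_derive_C1 (f : pt -> R) (G : 'I_N -> pt -> R) (x v : pt) :
  (forall y i, is_derive y (ebasis R i) f (G i y)) -> (forall i, {for x, continuous (G i)}) ->
  is_derive x v f (\sum_i v 0 i * G i x).
Proof.
move=> dG cG; apply: is_derive_eps => e e0.
pose V := \sum_i `|v 0 i|; have V0 : 0 <= V by exact: sumr_ge0.
pose e1 := e / (V + 1); have e10 : 0 < e1 by rewrite divr_gt0// ltr_wpDl.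
have /(_ _)/cid2-/all_sig2[r r0 Hr] (i : 'I_N) : exists2 r : R, 0 < r &
    forall y, `|y - x| < r -> `|G i y - G i x| <= e1.
  have /cvgrPdist_le/(_ e1 e10) := cG i; rewrite -nbhs_nearE => /nbhs_ballP[r /= r0 Hr].
  by exists r => // y yx; rewrite distrC; apply: Hr; rewrite -ball_normE/= distrC.
pose r1 := \big[Num.min/1]_i r i.
have r10 : 0 < r1 by apply: lt_bigmin => // i _; exact: r0.
have r1i i : r1 <= r i by exact: bigmin_le_cond.
exists (r1 / (`|v| + 1)); first by rewrite divr_gt0// ltr_wpDl.
move=> h; rewrite ltr_pdivlMr ?ltr_wpDl// => hr.
have hv : `|h| * `|v| < r1 by rewrite (le_lt_trans _ hr)// ler_wpM2l// lerDl.
pose w (k : nat) : pt := \row_i (if (i < k)%N then x 0 i + h * v 0 i else x 0 i).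
have w0 : w 0%N = x by apply/rowP => i; rewrite mxE.
have wN : w N = x + h *: v by apply/rowP => i; rewrite !mxE ltn_ord.
have wS (k : 'I_N) : w k.+1 = w k + (h * v 0 k) *: ebasis R k.
  apply/rowP => i; rewrite !mxE eqxx/= ltnS leq_eqVlt.
  have [ik|ik] := eqVneq i k; first by rewrite ik eqxx ltnn mulr1.
  by rewrite mulr0 addr0 -(inj_eq val_inj) in ik *; rewrite (negbTE ik).
have wx (k : 'I_N) t : `|t| <= `|h * v 0 k| -> `|w k + t *: ebasis R k - x| < r k.
  move=> ht; apply: lt_le_trans (r1i k); apply: rV_norm_lt => // i.
  apply: le_lt_trans hv; rewrite !mxE eqxx/=.
  have [->|ik] := eqVneq i k.
    rewrite ltnn mulr1 addrAC subrr add0r (le_trans ht)// normrM ler_wpM2l//.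
    exact: coord_le_norm.
  rewrite mulr0 addr0; case: ifP => _; last by rewrite subrr normr0 mulr_ge0.
  by rewrite addrAC subrr add0r normrM ler_wpM2l// coord_le_norm.
have step (k : 'I_N) : `|f (w k.+1) - f (w k) - h * v 0 k * G k x| <= e1 * `|h * v 0 k|.
  by rewrite wS; apply: (mean_value_line (g := G k)) => t ht; apply: Hr; exact: wx.
have -> : f (x + h *: v) - f x - h * (\sum_i v 0 i * G i x) =
    \sum_(k < N) (f (w k.+1) - f (w k) - h * v 0 k * G k x).
  rewrite big_split/= sumrN mulr_sumr; congr (_ + _).
    rewrite -(big_mkord xpredT (fun k => f (w k.+1) - f (w k))).
    by rewrite telescope_sumr// w0 wN.
  by congr (- _); apply: eq_bigr => i _; rewrite mulrA.
apply: le_trans (ler_norm_sum _ _ _) _.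
apply: (@le_trans _ _ (\sum_(k < N) e1 * `|h| * `|v 0 k|)).
  by apply: ler_sum => k _; rewrite (le_trans (step k))// normrM mulrA.
rewrite -mulr_sumr -/V mulrAC ler_wpM2r// /e1 mulrAC ler_pdivrMr ?ltr_wpDl//.
by rewrite ler_pM2l// lerDl.
Qed.

(** The Hessian field is an explicit argument because the operators read it, while the gradient is
    only asserted to exist. The notion is global, so sums and translates need no bookkeeping of
    neighbourhoods. *)
Definition C2fun (f : pt -> R) (H : pt -> 'M[R]_N) : Prop :=
  exists G : 'I_N -> pt -> R,
    [/\ continuous f, forall i, continuous (G i),
        forall i j, continuous (fun x => H x i j),
        forall x i, is_derive x (ebasis R i) f (G i x) &
        forall x i j, is_derive x (ebasis R i) (G j) (H x i j)].

Lemma C2fun_C2_near f H x : C2fun f H -> C2_near f x /\ hessian f x = H x.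
Proof.
move=> [G [cf cG cH dG dH]].
have pE i : partial f i = G i by apply/funext => y; rewrite /partial derive_val.
have ppE i j : partial (partial f j) i = (fun y => H y i j).
  by apply/funext => y; rewrite pE /partial derive_val.
split; last by apply/matrixP => i j; rewrite mxE ppE.
exists 1 => // y _; split.
- exact: cf.
- by move=> i; split; [case: (dG y i)|rewrite pE; exact: cG].
- by move=> i j; rewrite pE; case: (dH y i j).
- by move=> i j; rewrite ppE; exact: cH.
Qed.

Lemma C2funD f g H K : C2fun f H -> C2fun g K ->
  C2fun (fun x => f x + g x) (fun x => H x + K x).
Proof.
move=> [G [cf cG cH dG dH]] [G' [cg cG' cK dG' dK]].
exists (fun i x => G i x + G' i x); split.
- by move=> x; apply: continuousD; [exact: cf|exact: cg].
- by move=> i x; apply: continuousD; [exact: cG|exact: cG'].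
- move=> i j; rewrite (_ : (fun _ => _) = (fun x => H x i j + K x i j)).
    by move=> x; apply: continuousD; [exact: cH|exact: cK].
  by apply/funext => x; rewrite mxE.
- by move=> x i; apply: is_deriveD.
- by move=> x i j; rewrite mxE; apply: is_deriveD.
Qed.

Lemma C2funZ f H c : C2fun f H -> C2fun (fun x => c * f x) (fun x => c *: H x).
Proof.
move=> [G [cf cG cH dG dH]]; exists (fun i x => c * G i x); split.
- by move=> x; apply: continuous_cstM; exact: cf.
- by move=> i x; apply: continuous_cstM; exact: cG.
- move=> i j; rewrite (_ : (fun _ => _) = (fun x => c * H x i j)).
    by move=> x; apply: continuous_cstM; exact: cH.
  by apply/funext => x; rewrite mxE.
- by move=> x i; apply: is_deriveZ.
- by move=> x i j; rewrite mxE; apply: is_deriveZ.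
Qed.

Lemma C2fun_ext f g H K : f =1 g -> H =1 K -> C2fun f H -> C2fun g K.
Proof. by move=> /funext-> /funext->. Qed.

Lemma C2fun_cst c : C2fun (fun=> c) (fun=> 0).
Proof.
exists (fun _ _ => 0); split.
- by move=> x; exact: cst_continuous.
- by move=> i x; exact: cst_continuous.
- by move=> i j x; exact: cst_continuous.
- by move=> x i; exact: is_derive_cst.
- by move=> x i j; rewrite mxE; exact: is_derive_cst.
Qed.

Lemma C2fun_sum (I : Type) (r : seq I) (f : I -> pt -> R) H :
  (forall i, C2fun (f i) (H i)) ->
  C2fun (fun x => \sum_(i <- r) f i x) (fun x => \sum_(i <- r) H i x).
Proof.
move=> fH; elim: r => [|i r IH].
  apply: C2fun_ext (C2fun_cst 0) => x; by rewrite big_nil.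
by apply: C2fun_ext (C2funD (fH i) IH) => x; rewrite big_cons.
Qed.

Lemma C2fun_shift f H (z : pt) : C2fun f H -> C2fun (fun x => f (x + z)) (fun x => H (x + z)).
Proof.
have sh (g : pt -> R) : continuous g -> continuous (fun x : pt => g (x + z)).
  move=> cg x; apply: (@continuous_comp _ _ _ (fun x : pt => x + z) g); last exact: cg.
  by apply: continuousD; [exact: id|exact: cst_continuous].
have dsh (g : pt -> R) (x v : pt) (d : R) :
    is_derive (x + z) v g d -> is_derive x v (fun x : pt => g (x + z)) d.
  move=> dg; apply: is_derive_eps => e e0; have [r r0 Hr] := eps_is_derive dg e0.
  by exists r => // h hr; rewrite (addrAC x); exact: Hr.
move=> [G [cf cG cH dG dH]]; exists (fun i x => G i (x + z)); split.
- exact: sh.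
- by move=> i; exact: sh.
- by move=> i j; exact: (sh (fun x => H x i j)).
- by move=> x i; exact: dsh.
- by move=> x i j; exact: dsh.
Qed.

(** If the second derivative along [v0] were negative, with [v0] signed so that the first derivative
    is nonpositive, the derivative would be negative on a short segment and the mean value theorem
    would contradict minimality. *)
Lemma C2fun_min_psd f H x (r : R) : C2fun f H -> 0 < r ->
  (forall y, `|y - x| < r -> f x <= f y) -> psd (H x).
Proof.
move=> [G [cf cG cH dG dH]] r0 fmin v0.
have chain v y : is_derive y v f (\sum_i v 0 i * G i y).
  by apply: is_derive_C1 => i; exact: cG.
have chain2 v : is_derive x v (fun y => \sum_i v 0 i * G i y) ((v *m H x *m v^T) 0 0).
  have dGj j : is_derive x v (G j) (\sum_i v 0 i * H x i j).
    by apply: is_derive_C1 => i; exact: cH.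
  have := @is_derive_sum _ _ _ N (fun j y => v 0 j * G j y) x v
    (fun j => v 0 j * \sum_i v 0 i * H x i j) (fun j => is_deriveZ (v 0 j) (dGj j)).
  rewrite (_ : (\sum_(i < N) _)%R = (fun y => \sum_i v 0 i * G i y)); last first.
    by apply/funext => y; rewrite fct_sumE.
  by rewrite dotmxE; under [X in _ -> is_derive _ _ _ X]eq_bigr do rewrite mulrC mxE.
wlog Dv : v0 / \sum_i v0 0 i * G i x <= 0.
  move=> W; have [|/ltW Dv] := leP (\sum_i v0 0 i * G i x) 0; first exact: W.
  have := W (- v0); rewrite [(- v0)^T]linearN/= mulmxN !mulNmx opprK; apply.
  rewrite (eq_bigr (fun i => - (v0 0 i * G i x))); last by move=> i _; rewrite mxE mulNr.
  by rewrite sumrN oppr_le0.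
rewrite leNgt; apply/negP => q0; set q : R := (_ 0 0) in q0.
have e0 : 0 < - q / 2 by rewrite divr_gt0// oppr_gt0.
have [r' r'0 Hr'] := eps_is_derive (chain2 v0) e0.
pose s := Num.min (r' / 2) (r / (2 * (`|v0| + 1))).
have v1 : 0 < `|v0| + 1 by rewrite ltr_wpDl.
have s0 : 0 < s by rewrite lt_min !divr_gt0// mulr_gt0.
have dl (t : R) : is_derive t 1 (fun t : R => f (x + t *: v0)) (\sum_i v0 0 i * G i (x + t *: v0)).
  by apply/is_derive_line; exact: chain.
have [|t] := @MVT R (fun t : R => f (x + t *: v0)) (fun t => \sum_i v0 0 i * G i (x + t *: v0))
    0 s s0 (fun t _ => dl t).
  apply: continuous_subspaceT => t; apply: differentiable_continuous.
  by apply/derivable1_diffP; case: (dl t).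
rewrite in_itv/= => /andP[t0 ts]; rewrite scale0r addr0 subr0 => E.
have : 0 <= f (x + s *: v0) - f x.
  rewrite subr_ge0; apply: fmin; rewrite addrAC subrr add0r normrZ gtr0_norm//.
  apply: (@le_lt_trans _ _ (s * (`|v0| + 1))); first by rewrite ler_pM2l// lerDl.
  rewrite -ltr_pdivlMr//; apply: (@le_lt_trans _ _ (r / (2 * (`|v0| + 1)))).
    by rewrite ge_min lexx orbT.
  by rewrite ltr_pM2l// ltf_pV2 ?posrE ?mulr_gt0// ltr_pMl// ltr1n.
rewrite E leNgt pmulr_llt0// => /negP; apply.
have := Hr' t; rewrite gtr0_norm// ler_norml => /(_ _)/andP.
have tr' : t < r'.
  apply: lt_trans ts _; apply: (@le_lt_trans _ _ (r' / 2)); first by rewrite ge_min lexx.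
  by rewrite ltr_pdivrMr// ltr_pMr// ltr1n.
move=> /(_ tr')[_]; rewrite -/q lerBlDr lerBlDr => h1.
apply: (le_lt_trans h1); have := mulr_gt0 t0 (_ : 0 < - q); rewrite oppr_gt0 => /(_ q0) h2.
by move: Dv h2; set a := \sum_i _; lra.
Qed.

End Derivatives.

(** * Ridge functions, plane waves and the resolvent *)

Section RidgeFunctions.
Variables (R : realType) (N : nat).
Notation pt := 'rV[R]_N.

(** The operator with coefficient matrix [S^T S]. The number [m] of rows is free: one row gives a
    pure second derivative, a square [S] the operators dual to the determinant. *)
Definition ellop m (S : 'M[R]_(m, N)) (H : 'M[R]_N) : R := \tr (S *m H *m S^T).

Lemma ellopD m (S : 'M[R]_(m, N)) H K : ellop S (H + K) = ellop S H + ellop S K.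
Proof. by rewrite /ellop mulmxDr mulmxDl mxtraceD. Qed.

Lemma ellopZ m (S : 'M[R]_(m, N)) c H : ellop S (c *: H) = c * ellop S H.
Proof. by rewrite /ellop -scalemxAr -scalemxAl mxtraceZ. Qed.

Lemma ellop0 m (S : 'M[R]_(m, N)) : ellop S 0 = 0.
Proof. by rewrite /ellop mulmx0 mul0mx mxtrace0. Qed.

Lemma ellop_sum m (S : 'M[R]_(m, N)) (I : Type) (r : seq I) (H : I -> 'M[R]_N) :
  ellop S (\sum_(i <- r) H i) = \sum_(i <- r) ellop S (H i).
Proof. by apply: (big_morph _ (@ellopD m S) (ellop0 S)). Qed.

Lemma ellop_ge0 m (S : 'M[R]_(m, N)) H : psd H -> 0 <= ellop S H.
Proof. by move=> pH; apply: psd_trace_ge0; exact: psd_conj. Qed.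

(** The symbol of the operator at frequency [xi], that is, minus its eigenvalue on the corresponding
    plane waves. *)
Lemma ellop_rank1 m (S : 'M[R]_(m, N)) (xi : pt) :
  ellop S (xi^T *m xi) = ((xi *m S^T) *m (xi *m S^T)^T) 0 0.
Proof.
rewrite /ellop mulmxA -mulmxA mxtrace_mulC trmx_mul trmxK.
by rewrite [X in \tr X]mx11_scalar mxtrace_scalar mulr1n.
Qed.

Lemma is_derive_ridge (g : R -> R) (d : R) (xi x v : pt) (th : R) :
  is_derive ((x *m xi^T) 0 0 + th) 1 g d ->
  is_derive x v (fun y => g ((y *m xi^T) 0 0 + th)) (d * (v *m xi^T) 0 0).
Proof.
move=> dg; apply: is_derive_eps => e e0; set a := (v *m xi^T) 0 0.
have a1 : 0 < `|a| + 1 by rewrite ltr_wpDl.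
have [|r r0 Hr] := eps_is_derive dg (e := e / (`|a| + 1)); first by rewrite divr_gt0.
exists (r / (`|a| + 1)); first by rewrite divr_gt0.
move=> h; rewrite ltr_pdivlMr// => hr.
have ha : `|h * a| < r.
  by rewrite normrM (le_lt_trans _ hr)// ler_wpM2l// lerDl.
have -> : ((x + h *: v) *m xi^T) 0 0 + th = (x *m xi^T) 0 0 + th + (h * a) *: (1 : R).
  by rewrite mulmxDl -scalemxAl !mx00E -/a /GRing.scale/= mulr1 addrAC.
have -> : h * (d * a) = h * a * d by ring.
apply: le_trans (Hr _ ha) _; rewrite normrM (mulrC `|h|) mulrA ler_wpM2r//.
by rewrite mulrAC ler_pdivrMr// ler_pM2l// lerDl.
Qed.

Lemma continuous_lin (xi : pt) (th : R) : continuous (fun x : pt => (x *m xi^T) 0 0 + th).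
Proof.
move=> x; apply: continuousD; last exact: cst_continuous.
rewrite (_ : (fun _ => _) = (fun y : pt => \sum_i y 0 i * xi 0 i)); last first.
  by apply/funext => y; rewrite dotmxE.
apply: continuous_sumr => i; apply: continuousM; last exact: cst_continuous.
exact: coord_continuous.
Qed.

(** Functions of one linear form are the building blocks: affine functions, squares, plane waves and
    the terms of the barrier are all of this kind. *)
Lemma C2fun_ridge (g g' g'' : R -> R) (xi : pt) (th : R) :
  (forall t : R, is_derive t 1 g (g' t)) -> (forall t : R, is_derive t 1 g' (g'' t)) ->
  continuous g'' ->
  C2fun (fun x => g ((x *m xi^T) 0 0 + th))
        (fun x => g'' ((x *m xi^T) 0 0 + th) *: (xi^T *m xi)).
Proof.
move=> dg dg' cg''.
have cder (f f' : R -> R) : (forall t : R, is_derive t 1 f (f' t)) -> continuous f.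
  by move=> df t; apply: differentiable_continuous; apply/derivable1_diffP; case: (df t).
have clin (f : R -> R) : continuous f -> continuous (fun x : pt => f ((x *m xi^T) 0 0 + th)).
  by move=> cf x; apply: (continuous_comp (@continuous_lin xi th x)); exact: cf.
have eE i : (ebasis R i *m xi^T) 0 0 = xi 0 i.
  by rewrite -rowE !mxE.
exists (fun i x => xi 0 i * g' ((x *m xi^T) 0 0 + th)); split.
- exact/clin/(cder _ _ dg).
- move=> i x; apply: continuous_cstM.
  exact/clin/(cder _ _ dg').
- move=> i j; have -> : (fun x : pt => (g'' ((x *m xi^T) 0 0 + th) *: (xi^T *m xi)) i j) =
      (fun x : pt => (xi 0 i * xi 0 j) * g'' ((x *m xi^T) 0 0 + th)).
    by apply/funext => x; rewrite !mxE big_ord1 !mxE mulrC.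
  by move=> x; apply: continuous_cstM; exact: clin.
- by move=> x i; rewrite mulrC -eE; exact: is_derive_ridge.
- move=> x i j.
  have -> : (g'' ((x *m xi^T) 0 0 + th) *: (xi^T *m xi)) i j =
      xi 0 j *: (g'' ((x *m xi^T) 0 0 + th) * (ebasis R i *m xi^T) 0 0).
    by rewrite eE !mxE big_ord1 !mxE /GRing.scale/=; ring.
  by apply: is_deriveZ; exact: is_derive_ridge.
Qed.

Lemma is_derive_sqr (t : R) : is_derive t 1 (fun s : R => s ^+ 2) (2 * t).
Proof.
apply: is_derive_eps => e e0; exists e => // h he; rewrite /GRing.scale/= mulr1.
have -> : (t + h) ^+ 2 - t ^+ 2 - h * (2 * t) = h * h by ring.
by rewrite normrM ler_wpM2r// ltW.
Qed.

Lemma is_derive_lin (c t : R) : is_derive t 1 (fun s : R => c * s) c.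
Proof.
apply: is_derive_eps => e e0; exists e => // h he; rewrite /GRing.scale/= mulr1.
have -> : c * (t + h) - c * t - h * c = 0 by ring.
by rewrite normr0 mulr_ge0// ltW.
Qed.

Lemma C2fun_linear (xi : pt) (th : R) : C2fun (fun x => (x *m xi^T) 0 0 + th) (fun=> 0).
Proof.
apply: C2fun_ext (@C2fun_ridge id (fun=> 1) (fun=> 0) xi th _ _ _) => //.
- by move=> x; rewrite scale0r.
- by move=> x; exact: cst_continuous.
Qed.

Lemma C2fun_sqr_linear (xi : pt) (th : R) :
  C2fun (fun x => ((x *m xi^T) 0 0 + th) ^+ 2) (fun=> 2 *: (xi^T *m xi)).
Proof.
apply: (@C2fun_ridge (fun s => s ^+ 2) (fun s => 2 * s) (fun=> 2)).
- exact: is_derive_sqr.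
- exact: is_derive_lin.
- by move=> x; exact: cst_continuous.
Qed.

Lemma ebasis_dot (x : pt) i : (x *m (ebasis R i)^T) 0 0 = x 0 i.
Proof. by rewrite dotmxC -rowE !mxE. Qed.

Lemma C2fun_sqn (a : pt) : C2fun (fun x => ((x - a) *m (x - a)^T) 0 0) (fun=> (2%:M : 'M[R]_N)).
Proof.
apply: C2fun_ext (C2fun_sum (index_enum 'I_N)
   (fun i => @C2fun_sqr_linear (ebasis R i) (- a 0 i))) => x.
  by rewrite dotmxE; apply: eq_bigr => i _; rewrite ebasis_dot !mxE expr2.
rewrite -scaler_sumr -scalemx1; congr (_ *: _); apply/matrixP => i j.
rewrite summxE (bigD1 i)//= big1 => [|k ki].
  by rewrite !mxE big_ord1 !mxE !eqxx/= mul1r addr0 eq_sym.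
by rewrite !mxE big_ord1 !mxE/= eq_sym (negbTE ki) mul0r.
Qed.

Lemma compact_cball (x : pt) (r : R) : compact [set y : pt | `|y - x| <= r].
Proof.
apply: bounded_closed_compact.
  exists (r + `|x|); split; first exact: num_real.
  move=> M rM y /= yx; apply: le_trans (ltW rM).
  by rewrite -[y](subrK x) (le_trans (ler_normD _ _))// lerD2r.
have -> : [set y : pt | `|y - x| <= r] = (fun y : pt => `|y - x|) @^-1` [set t | t <= r] by [].
apply: preimage_closed; last exact: closed_le.
move=> y _; apply: continuous_comp; last exact: norm_continuous.
by apply: continuousB; [exact: id|exact: cst_continuous].
Qed.

End RidgeFunctions.

(** * Trigonometric polynomials and their resolvents *)

Section PlaneWaves.
Variables (R : realType) (N : nat).
Notation pt := 'rV[R]_N.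

(** An entry of [l] consists of amplitude, frequency and phase. Phases make the class closed under
    products with cosines alone. *)
Definition plane_waves (l : seq (R * pt * R)) (x : pt) : R :=
  \sum_(t <- l) t.1.1 * cos ((x *m t.1.2^T) 0 0 + t.2).

Definition is_trig (f : pt -> R) := exists l, f =1 plane_waves l.

Lemma is_trigD f g : is_trig f -> is_trig g -> is_trig (fun x => f x + g x).
Proof.
move=> [l lE] [k kE]; exists (l ++ k) => x.
by rewrite /plane_waves big_cat lE kE.
Qed.

Lemma is_trigZ c f : is_trig f -> is_trig (fun x => c * f x).
Proof.
move=> [l lE]; exists [seq (c * t.1.1, t.1.2, t.2) | t <- l] => x.
rewrite /plane_waves big_map lE mulr_sumr; apply: eq_bigr => t _ /=.
by rewrite mulrA.
Qed.

Lemma is_trig_cos (xi : pt) th : is_trig (fun x => cos ((x *m xi^T) 0 0 + th)).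
Proof. by exists [:: (1, xi, th)] => x; rewrite /plane_waves big_seq1 mul1r. Qed.

Lemma is_trig_cst c : is_trig (fun=> c).
Proof.
exists [:: (c, 0, 0)] => x.
by rewrite /plane_waves big_seq1/= trmx0 mulmx0 mxE addr0 cos0 mulr1.
Qed.

Lemma is_trig_sum (I : Type) (r : seq I) (f : I -> pt -> R) : (forall i, is_trig (f i)) ->
  is_trig (fun x => \sum_(i <- r) f i x).
Proof.
move=> H; elim: r => [|i r IH].
  by have [l lE] := is_trig_cst 0; exists l => x; rewrite big_nil.
by have [l lE] := is_trigD (H i) IH; exists l => x; rewrite big_cons.
Qed.

Lemma is_trig_ext f g : f =1 g -> is_trig f -> is_trig g.
Proof. by move=> /funext->. Qed.

(** Product-to-sum formula for cosines; closure under products puts polynomials in shifted cosines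
    into the class. *)
Lemma is_trigM f g : is_trig f -> is_trig g -> is_trig (fun x => f x * g x).
Proof.
move=> [l lE] [k kE].
apply: (is_trig_ext (f := fun x => \sum_(s <- l) \sum_(t <- k) (s.1.1 * t.1.1 / 2) *
    (cos ((x *m (s.1.2 + t.1.2)^T) 0 0 + (s.2 + t.2)) +
     cos ((x *m (s.1.2 - t.1.2)^T) 0 0 + (s.2 - t.2))))).
  move=> x; rewrite lE kE /plane_waves mulr_suml; apply: eq_bigr => s _.
  rewrite mulr_sumr; apply: eq_bigr => t _; rewrite linearB linearD/= mulmxBr mulmxDr.
  rewrite !mx00E; set a := (x *m s.1.2^T) 0 0; set b := (x *m t.1.2^T) 0 0.
  have -> : a + b + (s.2 + t.2) = (a + s.2) + (b + t.2) by ring.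
  have -> : a - b + (s.2 - t.2) = (a + s.2) - (b + t.2) by ring.
  rewrite cosD cosB.
  by set c := cos _; set d := cos _; field.
apply: is_trig_sum => s; apply: is_trig_sum => t; apply: is_trigZ; apply: is_trigD;
  exact: is_trig_cos.
Qed.

Lemma is_trig_prod (I : Type) (r : seq I) (f : I -> pt -> R) : (forall i, is_trig (f i)) ->
  is_trig (fun x => \prod_(i <- r) f i x).
Proof.
move=> H; elim: r => [|i r IH].
  by have [l lE] := is_trig_cst 1; exists l => x; rewrite big_nil.
by have [l lE] := is_trigM (H i) IH; exists l => x; rewrite big_cons.
Qed.

(* Plane waves are eigenfunctions of every constant coefficient operator, so the
   resolvent acts on each coefficient separately. *)
Lemma resolvent_trig m (S : 'M[R]_(m, N)) (k : R) f : is_trig f ->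
  exists w H, [/\ C2fun w H, forall x, w x - k ^+ 2 * ellop S (H x) = f x &
    exists C, forall x, `|w x| <= C].
Proof.
move=> [l lE].
pose lam (xi : pt) : R := ((xi *m S^T) *m (xi *m S^T)^T) 0 0.
have lam0 xi : 1 + k ^+ 2 * lam xi != 0.
  by rewrite gt_eqF// ltr_wpDr// mulr_ge0 ?sqr_ge0 ?sqn_ge0.
pose c (t : R * pt * R) := t.1.1 / (1 + k ^+ 2 * lam t.1.2).
pose w (x : pt) := \sum_(t <- l) c t * cos ((x *m t.1.2^T) 0 0 + t.2).
pose H (x : pt) := \sum_(t <- l) c t *: (- cos ((x *m t.1.2^T) 0 0 + t.2) *: (t.1.2^T *m t.1.2)).
exists w, H; split.
- apply: C2fun_sum => t; apply: C2funZ.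
  apply: (@C2fun_ridge _ _ cos (fun t => - sin t) (fun t => - cos t)).
  by move=> s; apply: continuousN; exact: continuous_cos.
- move=> x; rewrite lE ellop_sum mulr_sumr -sumrB; apply: eq_bigr => t _.
  by rewrite !ellopZ ellop_rank1 -/(lam _) /c; field.
- exists (\sum_(t <- l) `|c t|) => x; apply: le_trans (ler_norm_sum _ _ _) _.
  by apply: ler_sum => t _; rewrite normrM ler_piMr// cos_max.
Qed.

(** Minimum principle on the whole space. A penalty [eta |x|^2] makes the sum with the bounded [w]
    attain a minimum, where its Hessian is semidefinite. *)
Lemma resolvent_ge m (S : 'M[R]_(m, N)) (k b : R) w H : C2fun w H ->
  (exists C, forall x, `|w x| <= C) -> (forall x, b <= w x - k ^+ 2 * ellop S (H x)) ->
  forall x, b <= w x.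
Proof.
move=> wH [C wC] Hb x0; apply/ler_addgt0Pl => e e0.
(* [A] collects both costs of the penalty: [k^2] times its image under the operator, at the minimum,
   and its value at [x0]. *)
pose A := k ^+ 2 * ellop S 2%:M + (x0 *m x0^T) 0 0.
have A0 : 0 <= A.
  by rewrite addr_ge0 ?sqn_ge0// mulr_ge0 ?sqr_ge0// ellop_ge0//; exact: psd_scalar.
pose eta := e / (A + 1); have eta0 : 0 < eta by rewrite divr_gt0// ltr_wpDl.
have C0 : 0 <= C by apply: le_trans (wC 0).
pose g (x : pt) := w x + eta * (x *m x^T) 0 0.
have gH : C2fun g (fun x => H x + eta *: 2%:M).
  apply: C2funD => //; apply: C2funZ.
  by apply: C2fun_ext (C2fun_sqn 0) => // x; rewrite subr0.
(* On the sphere of this radius the penalty exceeds [2 C], so the minimum over the ball is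
   interior. *)
pose rho := `|x0| + 1 + (2 * C + 1) / eta.
have q0 : 0 <= (2 * C + 1) / eta.
  by apply: divr_ge0; [rewrite addr_ge0// mulr_ge0|exact: ltW].
have rho1 : 1 <= rho.
  by rewrite /rho; have := normr_ge0 x0; lra.
have [|||x1 x1r x1min] := compact_EVT_min (A := [set y : pt | `|y - 0| <= rho]) (f := g).
- by exists 0; rewrite /= subr0 normr0 (le_trans ler01).
- exact: compact_cball.
- by case: gH => G [cg _ _ _ _]; exact: continuous_subspaceT.
have x1in : `|x1| < rho.
  move: x1r; rewrite inE/= subr0 le_eqVlt => /orP[/eqP x1r|//].
  have := x1min 0; rewrite inE/= subr0 normr0 => /(_ (le_trans ler01 rho1)).
  have -> : g 0 = w 0 by rewrite /g mul0mx mxE mulr0 addr0.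
  rewrite /g => h1.
  have := wC 0; have := wC x1; rewrite !ler_norml => /andP[h2 _] /andP[_ h3].
  have h4 : rho ^+ 2 <= (x1 *m x1^T) 0 0 by rewrite -x1r sqr_norm_le_sqn.
  have h5 : rho <= rho ^+ 2 by rewrite expr2 ler_peMl// (le_trans ler01).
  have h6 : (2 * C + 1) / eta <= rho by rewrite lerDr addr_ge0.
  move: h6; rewrite ler_pdivrMr// => h6.
  have h7 : rho * eta <= eta * (x1 *m x1^T) 0 0.
    by rewrite mulrC ler_pM2l// (le_trans h5).
  lra.
have pH : psd (H x1 + eta *: 2%:M).
  apply: (C2fun_min_psd (r := rho - `|x1|) gH); first by rewrite subr_gt0.
  move=> y yx; apply: x1min; rewrite inE/= subr0.
  rewrite -[y](subrK x1) (le_trans (ler_normD _ _))//; lra.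
have := ellop_ge0 S pH; rewrite ellopD ellopZ => h1.
have h2 := Hb x1; have h3 : g x1 <= g x0.
  by apply: x1min; rewrite inE/= subr0 /rho -addrA lerDl addr_ge0.
have h4 : w x1 <= g x1 by rewrite /g lerDl mulr_ge0 ?sqn_ge0// ltW.
have h5 : - (eta * (k ^+ 2 * ellop S 2%:M)) <= k ^+ 2 * ellop S (H x1).
  rewrite -subr_ge0 opprK mulrCA -mulrDr mulr_ge0 ?sqr_ge0//.
have h6 : eta * A <= e by rewrite /eta mulrAC ler_pdivrMr ?ltr_wpDl// ler_pM2l// lerDl.
move: h3 h4 h6; rewrite /g /A mulrDr; lra.
Qed.

End PlaneWaves.

(** * A trigonometric partition of unity *)

Section BernsteinWeights.
Variable R : realType.

(** The binomial law, [binom(n, k) s^k (1 - s)^(n - k)], defined by conditioning on one trial so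
    that its moments follow by induction on [n]. *)
Fixpoint bern (s : R) (n k : nat) : R :=
  if n is n'.+1 then
    (1 - s) * bern s n' k + (if k is k'.+1 then s * bern s n' k' else 0)
  else (k == 0%N)%:R.

Lemma bern_ge0 s n k : 0 <= s <= 1 -> 0 <= bern s n k.
Proof.
move=> /andP[s0 s1]; elim: n k => [|n IH] k /=; first exact: ler0n.
rewrite addr_ge0// ?mulr_ge0// ?subr_ge0//.
by case: k => // k; rewrite mulr_ge0.
Qed.

Lemma bern_gt s n k : (n < k)%N -> bern s n k = 0.
Proof.
elim: n k => [|n IH] [|k]//= nk.
by rewrite !IH ?mulr0 ?addr0// (leq_trans _ nk).
Qed.

Lemma bern_sumS s n (F : nat -> R) :
  \sum_(k < n.+2) bern s n.+1 k * F k =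
  (1 - s) * (\sum_(k < n.+1) bern s n k * F k) + s * (\sum_(k < n.+1) bern s n k * F k.+1).
Proof.
rewrite (eq_bigr (fun k : 'I_n.+2 => (1 - s) * (bern s n k * F k) +
   (if k : nat is k'.+1 then s * bern s n k' else 0) * F k)); last first.
  by move=> k _; rewrite /= mulrDl mulrA.
rewrite big_split/=; congr (_ + _).
  by rewrite big_ord_recr/= bern_gt// mul0r mulr0 addr0 mulr_sumr.
rewrite big_ord_recl/= mul0r add0r mulr_sumr; apply: eq_bigr => k _.
by rewrite /bump/= mulrA.
Qed.

Lemma bern_sum1 s n : \sum_(k < n.+1) bern s n k = 1.
Proof.
rewrite (eq_bigr (fun k : 'I_n.+1 => bern s n k * 1)); last by move=> k _; rewrite mulr1.
elim: n => [|n IH]; first by rewrite big_ord1 /= mulr1.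
by rewrite (bern_sumS s n (fun=> 1)) IH; ring.
Qed.

(** The centre [c] is arbitrary because the induction step moves it to [c - 1]. *)
Lemma bern_variance s n (c : R) :
  \sum_(k < n.+1) bern s n k * (k%:R - c) ^+ 2 = n%:R * s * (1 - s) + (n%:R * s - c) ^+ 2.
Proof.
elim: n c => [|n IH] c; first by rewrite big_ord1/=; ring.
rewrite (bern_sumS s n (fun k => (k%:R - c) ^+ 2)) IH.
rewrite (eq_bigr (fun k : 'I_n.+1 => bern s n k * (k%:R - (c - 1)) ^+ 2)).
  by rewrite IH -natr1; ring.
by move=> k _; rewrite -natr1; congr (_ * _ ^+ 2); ring.
Qed.

(** Over intervals of a given length the cosine drops least at the ends of [[0, pi]]. In half angles
    [a = 2 A], [b = 2 B], the excess over [1 - cos (b - a)] is [4 sin A cos B sin (B - A)]. *)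
Lemma cos_gap (a b d : R) : 0 <= a -> a <= b -> b <= pi -> 0 <= d -> d <= b - a ->
  1 - cos d <= cos a - cos b.
Proof.
move=> a0 ab bpi d0 dba.
have hd : cos (b - a) <= cos d.
  rewrite leNgt; apply/negP; rewrite ltr_cos ?in_itv/=; last 2 first.
  - by apply/andP; split; lra.
  - by apply/andP; split; lra.
  by lra.
have [A aE] : exists A, a = A *+ 2 by exists (a / 2); rewrite -mulr_natr; field.
have [B bE] : exists B, b = B *+ 2 by exists (b / 2); rewrite -mulr_natr; field.
have pi0 := pi_gt0 R.
have sA : 0 <= sin A by apply: sin_ge0_pi; move: a0 ab bpi; rewrite aE bE; lra.
have cB : 0 <= cos B by apply: cos_ge0_pihalf; move: a0 ab bpi; rewrite aE bE; lra.
have sBA : 0 <= sin (B - A) by apply: sin_ge0_pi; move: a0 ab bpi; rewrite aE bE; lra.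
apply: (@le_trans _ _ (1 - cos (b - a))); first by lra.
rewrite -subr_ge0 cosB.
have -> : cos a = 1 - 2 * sin A ^+ 2 by rewrite aE cos_mulr2n cos2sin2; ring.
have -> : cos b = 2 * cos B ^+ 2 - 1 by rewrite bE cos_mulr2n; ring.
have -> : sin a = 2 * (cos A * sin A) by rewrite aE sin_mulr2n; ring.
have -> : sin b = 2 * (cos B * sin B) by rewrite bE sin_mulr2n; ring.
have := mulr_ge0 (mulr_ge0 sA cB) sBA; rewrite sinB; lra.
Qed.

Section Scaled.
Variables (rho : R).
Hypothesis rho0 : 0 < rho.

Let al : R := pi / (2 * rho).
(** With [al = pi / (2 rho)] the angle [al (t + rho)] sweeps [[0, pi]] as [t] runs over
    [[-rho, rho]]: an increasing change of variable onto [[0, 1]] that is itself trigonometric. The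
    nodes are the preimages of [k / n]. *)
Definition trigcoord (t : R) : R := (1 - cos (al * (t + rho))) / 2.
Definition trignode (n : nat) (k : nat) : R := acos (1 - 2 * (k%:R / n%:R)) / al - rho.

Let al0 : 0 < al. Proof. by rewrite divr_gt0 ?pi_gt0// mulr_gt0. Qed.

Let pin0 : pi != 0 :> R. Proof. by rewrite gt_eqF ?pi_gt0. Qed.
Let rhon0 : rho != 0. Proof. by rewrite gt_eqF. Qed.

Lemma trigcoord01 t : 0 <= trigcoord t <= 1.
Proof. by rewrite /trigcoord; have := cos_le1 (al * (t + rho)); have := cos_geN1 (al * (t + rho)); lra. Qed.

Let node_in n k : (0 < n)%N -> (k <= n)%N -> -1 <= 1 - 2 * (k%:R / n%:R : R) <= 1.
Proof.
move=> n0 kn; have : 0 <= (k%:R / n%:R : R) <= 1.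
  by rewrite divr_ge0//= ler_pdivrMr ?ltr0n// mul1r ler_nat.
by move=> /andP[? ?]; lra.
Qed.

Lemma trignode_bound n k : (0 < n)%N -> (k <= n)%N -> `|trignode n k| <= rho.
Proof.
move=> n0 kn; have H := node_in n0 kn.
have h0 := acos_ge0 H; have h1 := acos_lepi H.
rewrite /trignode; set a := acos _ in h0 h1 *.
have -> : a / al = a / pi * (2 * rho).
  by rewrite /al; move: pin0; generalize (pi : R) => p pn0; field; rewrite rhon0 pn0.
have b0 : 0 <= a / pi by rewrite divr_ge0// ltW// pi_gt0.
have b1 : a / pi <= 1 by rewrite ler_pdivrMr ?pi_gt0// mul1r.
have := mulr_ge0 b0 (ltW rho0); have := ler_wpM2r (ltW rho0) b1.
by rewrite ler_norml; lra.
Qed.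

Lemma trigcoord_node n k : (0 < n)%N -> (k <= n)%N -> trigcoord (trignode n k) = k%:R / n%:R.
Proof.
move=> n0 kn; rewrite /trigcoord /trignode subrK mulrCA divff ?gt_eqF// mulr1.
by rewrite acosK ?in_itv/= ?node_in//; field; rewrite pnatr_eq0 -lt0n.
Qed.

Lemma trigcoord_gap (t t' d : R) : `|t| <= rho -> `|t'| <= rho -> 0 <= d -> d <= `|t - t'| ->
  (1 - cos (al * d)) / 2 <= `|trigcoord t - trigcoord t'|.
Proof.
wlog tt' : t t' / t' <= t => [W tr t'r d0 dt|].
  have [h|/ltW h] := leP t' t; first exact: W.
  by rewrite distrC; apply: W => //; rewrite distrC.
rewrite !ler_norml => /andP[t1 t2] /andP[t'1 t'2] d0; rewrite ger0_norm ?subr_ge0// => dt.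
have E (z : R) : al * z = z / (2 * rho) * pi by rewrite /al; generalize (pi : R) => p; field; rewrite rhon0.
have hpi (z : R) : z <= 2 * rho -> al * z <= pi.
  move=> zr; rewrite E ger_pMl ?pi_gt0// ler_pdivrMr ?mulr_gt0//; lra.
suff : 1 - cos (al * d) <= cos (al * (t' + rho)) - cos (al * (t + rho)).
  by move=> h; apply: le_trans (ler_norm _); rewrite /trigcoord; lra.
apply: cos_gap.
- by apply: mulr_ge0; [exact: ltW|lra].
- by rewrite ler_pM2l// lerD2r.
- by apply: hpi; lra.
- by apply: mulr_ge0 => //; exact: ltW.
- by rewrite -mulrBr ler_pM2l// opprD addrACA subrr addr0.
Qed.

(** Chebyshev's inequality for the binomial law: nodes at distance at least [d] from [t] have
    coordinates at distance at least [g], and a variance of order [n] is compared with [(n g)^2].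
    The bound is uniform in [t]. *)
Lemma bern_tail (d e : R) : 0 < d -> d <= rho -> 0 < e ->
  exists2 n, (0 < n)%N & forall t, `|t| <= rho ->
    \sum_(k < n.+1) bern (trigcoord t) n k * (d <= `|t - trignode n k|)%R%:R <= e.
Proof.
move=> d0 dr e0; pose g := (1 - cos (al * d)) / 2.
have ad : 0 < al * d < pi.
  rewrite mulr_gt0//= /al mulrAC ltr_pdivrMr ?mulr_gt0// ltr_pM2l ?pi_gt0//.
  by apply: le_lt_trans dr _; rewrite ltr_pMl// ltr1n.
have g0 : 0 < g.
  case/andP: ad => ad0 adpi; apply: divr_gt0 => //; rewrite subr_gt0 -cos0 ltr_cos// in_itv/=.
    by rewrite lexx (ltW (pi_gt0 R)).
  by rewrite (ltW ad0) (ltW adpi).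
(* A variance of at most [n], divided by [(n g)^2], is at most [e] once [n e g^2 >= 1]. *)
pose n := (Num.truncn (e * g ^+ 2)^-1).+1.
have n0 : (0 < n)%N by []. have n0R : 0 < n%:R :> R by rewrite ltr0n.
have eg : 0 < e * g ^+ 2 by rewrite mulr_gt0// exprn_gt0.
have ng : 1 <= n%:R * (e * g ^+ 2).
  by rewrite -ler_pdivrMr// div1r ltW// truncnS_gt.
have ng0 : 0 < n%:R * g by apply: mulr_gt0.
exists n => // t tr; set s := trigcoord t.
have s01 := trigcoord01 t; rewrite -/s in s01.
apply: (@le_trans _ _ (\sum_(k < n.+1) bern s n k * (k%:R - n%:R * s) ^+ 2 / (n%:R * g) ^+ 2)).
  apply: ler_sum => k _; rewrite -mulrA ler_wpM2l ?bern_ge0//.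
  have [dt|_] := leP d; last by rewrite mulr_ge0 ?sqr_ge0// invr_ge0 sqr_ge0.
  have kn : (k <= n)%N by rewrite -ltnS.
  have := trigcoord_gap tr (trignode_bound n0 kn) (ltW d0) dt.
  rewrite trigcoord_node// -/s -/g => gs.
  suff h : (n%:R * g) ^+ 2 <= (k%:R - n%:R * s) ^+ 2.
    by rewrite (_ : true%:R = 1)// ler_pdivlMr ?exprn_gt0// mul1r.
  rewrite -[leRHS]real_normK ?num_real// lerXn2r ?nnegrE//; first exact: ltW.
  apply: le_trans (ler_wpM2l (ltW n0R) gs) _.
  have -> : k%:R - n%:R * s = n%:R * (k%:R / n%:R - s) by field; rewrite gt_eqF.
  by rewrite normrM (gtr0_norm n0R) distrC.
rewrite -mulr_suml bern_variance subrr expr0n/= addr0 ler_pdivrMr ?exprn_gt0//.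
case/andP: s01 => s0 s1.
have ss : s * (1 - s) <= 1 by nra.
have : n%:R * (s * (1 - s)) <= n%:R * 1 by rewrite ler_pM2l.
have : n%:R * 1 <= n%:R * (n%:R * (e * g ^+ 2)) by rewrite ler_pM2l.
rewrite [(_ * g) ^+ 2]exprMn; move: (n%:R : R) => m; lra.
Qed.

End Scaled.
End BernsteinWeights.

Section TrigPartition.
Variables (R : realType) (N : nat).
Notation pt := 'rV[R]_N.

Lemma is_trig_bern (f : pt -> R) n k : is_trig f -> is_trig (fun x => bern (f x) n k).
Proof.
move=> tf; elim: n k => [|n IH] k /=; first exact: is_trig_cst.
have t1 : is_trig (fun x => 1 - f x).
  apply: (is_trig_ext (f := fun x => 1 + (-1) * f x)) => [x|]; first by rewrite mulN1r.
  by apply: is_trigD; [exact: is_trig_cst|exact: is_trigZ].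
apply: is_trigD; first exact: is_trigM.
by case: k => [|k]; [exact: is_trig_cst|exact: is_trigM].
Qed.

Lemma is_trig_trigcoord (rho : R) (y : pt) i : is_trig (fun x => trigcoord rho (x 0 i - y 0 i)).
Proof.
pose a : R := pi / (2 * rho).
apply: (is_trig_ext (f := fun x : pt =>
    2^-1 + (- 2^-1) * cos ((x *m (a *: ebasis R i)^T) 0 0 + a * (rho - y 0 i)))).
  move=> x; rewrite linearZ/= -scalemxAr mx00E ebasis_dot /trigcoord -/a.
  have -> : a * x 0 i + a * (rho - y 0 i) = a * (x 0 i - y 0 i + rho) by ring.
  by field.
by apply: is_trigD; [exact: is_trig_cst|apply: is_trigZ; exact: is_trig_cos].
Qed.

Lemma prod_marginal n (f : 'I_N -> 'I_n.+1 -> R) (i : 'I_N) (c : 'I_n.+1 -> R) :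
  (forall j, \sum_m f j m = 1) ->
  \sum_(k : {ffun 'I_N -> 'I_n.+1}) (\prod_j f j (k j)) * c (k i) = \sum_m f i m * c m.
Proof.
move=> f1; pose F j m := if j == i then f j m * c m else f j m.
transitivity (\sum_(k : {ffun 'I_N -> 'I_n.+1}) \prod_j F j (k j)).
  apply: eq_bigr => k _; rewrite (bigD1 i)//= [RHS](bigD1 i)//= /F eqxx mulrAC.
  by congr (_ * _); apply: eq_bigr => j ji; rewrite (negbTE ji).
have F1 j : j != i -> \sum_m F j m = 1.
  by move=> ji; rewrite -(f1 j); apply: eq_bigr => m _; rewrite /F (negbTE ji).
rewrite -(bigA_distr_bigA F) [LHS](bigD1 i)//= [X in _ * X]big1 // mulr1.
by apply: eq_bigr => m _; rewrite /F eqxx.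
Qed.

(** Tensor product of the one-dimensional weights. In the sup norm a distant node is distant in some
    coordinate, so the tails add up over the coordinates. *)
Lemma trig_partition (y : pt) (rho d e : R) : 0 < rho -> 0 < d -> d <= rho -> 0 < e ->
  exists (K : finType) (b : K -> pt -> R) (node : K -> pt),
    [/\ forall k, is_trig (b k), forall k x, 0 <= b k x, forall x, \sum_k b k x = 1,
        forall k, `|node k - y| <= rho &
        forall x, `|x - y| <= rho -> \sum_k b k x * (d <= `|x - node k|)%R%:R <= e].
Proof.
move=> rho0 d0 dr e0.
(* [N.+1] in the denominator covers [N = 0] as well. *)
have e1 : 0 < e / N.+1%:R by rewrite divr_gt0.
have [n n0 Hn] := bern_tail rho0 d0 dr e1.
pose s i (x : pt) := trigcoord rho (x 0 i - y 0 i).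
pose b (k : {ffun 'I_N -> 'I_n.+1}) (x : pt) := \prod_i bern (s i x) n (k i).
pose node (k : {ffun 'I_N -> 'I_n.+1}) : pt := y + \row_i trignode rho n (k i).
have b0 k x : 0 <= b k x by apply: prodr_ge0 => i _; apply: bern_ge0; exact: trigcoord01.
exists {ffun 'I_N -> 'I_n.+1}, b, node; split=> //.
- move=> k; apply: is_trig_prod => i; apply: is_trig_bern; exact: is_trig_trigcoord.
- move=> x; rewrite /b -(bigA_distr_bigA (fun i (m : 'I_n.+1) => bern (s i x) n m)).
  by apply: big1 => i _; exact: bern_sum1.
- move=> k; rewrite /node addrAC subrr add0r; apply: rV_norm_le; first exact: ltW.
  by move=> i; rewrite mxE; apply: trignode_bound => //; rewrite -ltnS.
- move=> x xy.
  pose bad i (m : 'I_n.+1) : R := (d <= `|x 0 i - y 0 i - trignode rho n m|)%R%:R.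
  apply: (@le_trans _ _ (\sum_k \sum_i b k x * bad i (k i))).
    apply: ler_sum => k _; rewrite -mulr_sumr ler_wpM2l//.
    have [dx|_] := leP d; last by apply: sumr_ge0 => i _; exact: ler0n.
    rewrite leNgt; apply/negP => h; move: dx; rewrite leNgt => /negP; apply.
    apply: rV_norm_lt => // i; rewrite !mxE ltNge; apply/negP => dx; move: h.
    have bi : bad i (k i) = 1 by rewrite /bad -addrA -opprD dx.
    rewrite (bigD1 i)//= bi ltNge lerDl => /negP; apply.
    by apply: sumr_ge0 => j _; exact: ler0n.
  rewrite exchange_big/=; apply: (@le_trans _ _ (\sum_(i < N) e / N.+1%:R)).
    apply: ler_sum => i _; rewrite (@prod_marginal n (fun j (m : 'I_n.+1) => bern (s j x) n m)).
      apply: (Hn (x 0 i - y 0 i)); rewrite (le_trans _ xy)//.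
      by have := coord_le_norm (x - y) i; rewrite !mxE.
    by move=> j; exact: bern_sum1.
  rewrite sumr_const card_ord -(mulr_natr (e / _)) mulrAC ler_pdivrMr// ler_pM2l//.
  by rewrite ler_nat.
Qed.

End TrigPartition.

(** * The resolvent inequality *)

Section ResolventInequality.
Variables (R : realType) (N : nat).
Notation pt := 'rV[R]_N.

Lemma lipschitz_continuous_pt (g : pt -> R) (L : R) :
  (forall x x', `|g x - g x'| <= L * `|x - x'|) -> continuous g.
Proof.
move=> gL x; apply/(@cvgrPdist_lt _ _ _ (nbhs x)) => e e0.
have L1 : 0 < `|L| + 1 by rewrite ltr_wpDl.
rewrite -nbhs_nearE; apply/nbhs_ballP; exists (e / (`|L| + 1)); first by rewrite /= divr_gt0.
move=> z; rewrite -ball_normE/= ltr_pdivlMr// => xz; apply: le_lt_trans (gL _ _) _.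
apply: le_lt_trans xz; rewrite mulrC ler_wpM2l//.
by rewrite (le_trans (ler_norm _))// lerDl.
Qed.

(** The test function touches over the whole closed ball, which is what maximisation over a compact
    ball provides; the contact point itself is interior. *)
Definition visc_ge m (S : 'M[R]_(m, N)) (c : R) (g : pt -> R) (y : pt) (rho : R) : Prop :=
  forall phi H x, C2fun phi H -> `|x - y| < rho ->
    (forall x', `|x' - y| <= rho -> g x' - phi x' <= g x - phi x) ->
    c <= ellop S (H x).

Lemma is_derive_1Bcos (t : R) : is_derive t 1 (fun s : R => 1 - cos s) (sin t).
Proof.
have := is_deriveB (is_derive_cst (1 : R) t 1) (is_derive_cos t).
by rewrite sub0r opprK.
Qed.

(** With [u = 1 - cos t], the base term [u^2] is of order [t^4] and has second derivative
    [6 u - 4 u^2]. The term [6 B k^2 u] absorbs [6 u]; its own second derivative, at most [6 B k^2],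
    is absorbed by the constant [6 B^2 k^4], which is what remains at the centre. *)
Lemma barrier m (S : 'M[R]_(m, N)) (y : pt) (rho Q : R) : 0 < rho <= 1 -> 0 <= Q ->
  exists C, forall k, exists psi H,
   [/\ C2fun psi H, forall x, 0 <= psi x - k ^+ 2 * ellop S (H x),
       forall x, `|x - y| = rho -> Q <= psi x & psi y = C * k ^+ 4].
Proof.
move=> /andP[rho0 rho1] Q0.
pose e : R := 1 - cos rho.
have e0 : 0 < e.
  have p1 : 1 <= pi :> R by have := pi_ge2 R; lra.
  rewrite subr_gt0 -cos0 ltr_cos// in_itv/= ?lexx.
    by rewrite ltW ?pi_gt0.
  by rewrite (ltW rho0) (le_trans rho1).
pose be i : R := ellop S ((ebasis R i)^T *m ebasis R i).
have be0 i : 0 <= be i by rewrite /be ellop_rank1 sqn_ge0.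
pose B := \sum_i be i.
have beB i : be i <= B by rewrite /B (bigD1 i)//= lerDl sumr_ge0.
have B0 : 0 <= B by exact: sumr_ge0.
(* Scales the barrier so that it reaches [Q] as soon as one coordinate of [x - y] has modulus
   [rho]. *)
pose D := Q / e ^+ 2; have D0 : 0 <= D by rewrite divr_ge0// sqr_ge0.
exists (D * (N%:R * (6 * B ^+ 2))) => k; set K := k ^+ 2.
have K0 : 0 <= K by exact: sqr_ge0.
pose q (t : R) : R := (1 - cos t) * (1 - cos t) + (6 * B * K * (1 - cos t) + 6 * B ^+ 2 * K ^+ 2).
pose q1 (t : R) : R := 2 * (1 - cos t) * sin t + 6 * B * K * sin t.
pose q2 (t : R) : R := 2 * ((1 - cos t) * cos t + sin t * sin t) + 6 * B * K * cos t.
have dq (t : R) : is_derive t 1 q (q1 t).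
  have d1 := is_derive_1Bcos t.
  have := is_deriveD (is_deriveM d1 d1) (is_deriveD (is_deriveZ (6 * B * K) d1)
    (is_derive_cst (6 * B ^+ 2 * K ^+ 2) t 1)).
  have E (a b A : R) : (1 - b) * a + (1 - b) * a + (A * a + 0) = 2 * (1 - b) * a + A * a by ring.
  by move/is_derive_eq; apply; exact: E.
have dq1 (t : R) : is_derive t 1 q1 (q2 t).
  have d1 := is_derive_1Bcos t.
  have := is_deriveD (is_deriveM (is_deriveZ 2 d1) (is_derive_sin t))
     (is_deriveZ (6 * B * K) (is_derive_sin t)).
  have E (a b A : R) : 2 * (1 - b) * b + a * (2 * a) + A * b = 2 * ((1 - b) * b + a * a) + A * b.
    by ring.
  by move/is_derive_eq; apply; exact: E.
have cq2 : continuous q2.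
  have c1 : continuous (fun t : R => 1 - cos t).
    by move=> t; apply: continuousB; [exact: cst_continuous|exact: continuous_cos].
  move=> t.
  have c2 : {for t, continuous (fun t : R => (1 - cos t) * cos t)}.
    by apply: continuousM; [exact: c1|exact: continuous_cos].
  have c3 : {for t, continuous (fun t : R => sin t * sin t)}.
    by apply: continuousM; exact: continuous_sin.
  have c4 : {for t, continuous (fun t : R => 6 * B * K * cos t)}.
    by apply: continuous_cstM; exact: continuous_cos.
  exact: continuousD (continuous_cstM (c := 2) (continuousD c2 c3)) c4.
have qineq i t : 0 <= q t - K * (q2 t * be i).
  rewrite /q /q2 -expr2 -[sin t * _]expr2 sin2cos2.
  have := cos_le1 t; have := cos_geN1 t; have [u uE] : exists u, cos t = 1 - u by exists (1 - cos t); ring.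
  rewrite uE => h1 h2; have u0 : 0 <= u by lra. have u2 : u <= 2 by lra.
  have h3 : 0 <= K * be i by rewrite mulr_ge0.
  have Bb : 0 <= B - be i by rewrite subr_ge0.
  have h4 := mulr_ge0 (mulr_ge0 K0 u0) Bb.
  have h5 := mulr_ge0 (mulr_ge0 B0 (sqr_ge0 K)) Bb.
  have h6 := mulr_ge0 h3 (sqr_ge0 u).
  have h7 := mulr_ge0 h3 (mulr_ge0 (mulr_ge0 B0 K0) u0).
  have h8 := sqr_ge0 u.
  lra.
have q0 t : 0 <= q t.
  have h := cos_le1 t; have h1 : 0 <= 1 - cos t by lra.
  have h2 := mulr_ge0 h1 h1; have h3 := mulr_ge0 (mulr_ge0 B0 K0) h1.
  by have h4 := mulr_ge0 (sqr_ge0 B) (sqr_ge0 K); rewrite /q; lra.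
pose l i (x : pt) := (x *m (ebasis R i)^T) 0 0 + (- y 0 i).
exists (fun x => D * \sum_i q (l i x)),
   (fun x => D *: \sum_i (q2 (l i x) *: ((ebasis R i)^T *m ebasis R i))); split.
- apply: C2funZ; apply: C2fun_sum => i.
  exact: (@C2fun_ridge R N q q1 q2 (ebasis R i) (- y 0 i) dq dq1 cq2).
- move=> x; rewrite ellopZ ellop_sum mulrCA -mulrBr mulr_ge0// mulr_sumr -sumrB.
  by apply: sumr_ge0 => i _; rewrite ellopZ; exact: qineq.
- move=> x xr.
  have [i xi] : exists i, rho <= `|x 0 i - y 0 i|.
    apply: contrapT => /forallNP H; suff : `|x - y| < rho by rewrite xr ltxx.
    by apply: rV_norm_lt => // i; rewrite !mxE ltNge; apply/negP; exact: H.
  have lE : l i x = x 0 i - y 0 i by rewrite /l ebasis_dot.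
  have xi' : `|x 0 i - y 0 i| = rho.
    by apply/eqP; rewrite eq_le xi andbT -xr; have := coord_le_norm (x - y) i; rewrite !mxE.
  have ce : 1 - cos (l i x) = e by rewrite lE -cos_norm xi'.
  have : e ^+ 2 <= \sum_i q (l i x).
    rewrite (bigD1 i)//= -[leLHS]addr0 lerD//; last exact: sumr_ge0.
    have h3 := mulr_ge0 (mulr_ge0 B0 K0) (ltW e0).
    by have h4 := mulr_ge0 (sqr_ge0 B) (sqr_ge0 K); rewrite /q ce -expr2; lra.
  have {1}-> : Q = D * e ^+ 2 by rewrite divfK// gt_eqF// exprn_gt0.
  exact: ler_wpM2l.
- rewrite (eq_bigr (fun=> 6 * B ^+ 2 * K ^+ 2)); last first.
    by move=> i _; rewrite /q /l ebasis_dot subrr cos0 subrr; ring.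
  rewrite sumr_const card_ord -(mulr_natr (6 * _ * _)) /K -exprM; ring.
Qed.

(** The order of quantifiers carries the argument: [C] precedes [k], and nodes and weights precede
    [g] and [c], so the inequality can be averaged in [g] and applied with the same nodes to two
    functions. The comparison function is [W + psi + s - k^2 c], with [W] the resolvent of the
    approximation [p] of [g]. *)
Lemma resolvent_ineq m (S : 'M[R]_(m, N)) (y : pt) (rho M L c0 : R) :
  0 < rho <= 1 -> 0 <= M -> 0 <= L -> 0 <= c0 ->
  exists C, forall k s, 0 <= k <= 1 -> 0 < s ->
    exists (K : finType) (node : K -> pt) (om : K -> R),
      (forall i, `|node i - y| <= rho) /\
      forall g c, `|c| <= c0 -> (forall x, `|g x| <= M) ->
        (forall x x', `|g x - g x'| <= L * `|x - x'|) -> visc_ge S c g y rho ->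
        g y <= \sum_i om i * g (node i) + s - k ^+ 2 * c + C * k ^+ 4.
Proof.
move=> rho01 M0 L0 c00; have /andP[rho0 rho1] := rho01.
(* On the sphere the barrier must beat both [g - W <= 2 M] and [k^2 c <= c0]. *)
have [|C HC] := @barrier m S y rho (2 * M + c0) rho01; first by rewrite addr_ge0// mulr_ge0.
exists C => k s /andP[k0 k1] s0.
have [psi [Hpsi [psiH psi_sup psi_bd psiy]]] := HC k.
(* Half of [s] pays for the oscillation [L d] over near nodes, half for [2 M] times the total weight
   of the far ones. *)
pose d := Num.min rho (s / (2 * (L + 1))).
have d0 : 0 < d by rewrite lt_min rho0 divr_gt0// mulr_gt0// ltr_wpDl.
have dr : d <= rho by rewrite ge_min lexx.
have e0 : 0 < s / (4 * (M + 1)) by rewrite divr_gt0// mulr_gt0// ltr_wpDl.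
have [K [b [node [tb b0 b1 nodein btail]]]] := trig_partition y rho0 d0 dr e0.
have /choice[w /choice[H wH]] i := resolvent_trig S k (tb i).
exists K, node, (fun i => w i y); split=> // g c cc0 gM gL gvisc.
pose W x := \sum_i g (node i) * w i x.
pose HW x := \sum_i g (node i) *: H i x.
pose p x := \sum_i g (node i) * b i x.
have WH : C2fun W HW by apply: C2fun_sum => i; apply: C2funZ; case: (wH i).
have WE x : W x - k ^+ 2 * ellop S (HW x) = p x.
  rewrite /W /HW ellop_sum mulr_sumr -sumrB; apply: eq_bigr => i _.
  by rewrite ellopZ mulrCA -mulrBr; case: (wH i) => _ -> _.
have pM x : - M <= p x.
  rewrite -[leLHS]mulr1 -(b1 x) mulr_sumr; apply: ler_sum => i _.
  by rewrite ler_wpM2r//; have := gM (node i); rewrite ler_norml => /andP[].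
have pg x : `|x - y| <= rho -> g x <= p x + s.
  move=> xy; rewrite -lerBlDl -[g x]mulr1 -(b1 x) mulr_sumr -sumrB.
  apply: (@le_trans _ _ (\sum_i (b i x * (L * d) + 2 * M * (b i x * (d <= `|x - node i|)%R%:R)))).
    apply: ler_sum => i _; rewrite -mulrBl (mulrC _ (b i x)) (mulrCA (2 * M)) -mulrDr.
    apply: ler_wpM2l => //; have [dx|/ltW dx] := leP d.
      rewrite mulr1; have := gM x; have := gM (node i); rewrite !ler_norml.
      have := mulr_ge0 L0 (ltW d0); lra.
    rewrite mulr0 addr0 (le_trans (ler_norm _))// (le_trans (gL _ _))//.
    by rewrite ler_wpM2l.
  rewrite big_split/= -mulr_suml b1 mul1r -mulr_sumr.
  have h1 := ler_wpM2l (mulr_ge0 (ler0n _ 2) M0) (btail x xy).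
  have h2 : L * d <= s / 2.
    have : d <= s / (2 * (L + 1)) by rewrite ge_min lexx orbT.
    rewrite ler_pdivlMr ?mulr_gt0 ?ltr_wpDl// => h2.
    have h3 := mulr_ge0 L0 (ltW d0); lra.
  have h3 : 2 * M * (s / (4 * (M + 1))) <= s / 2.
    rewrite mulrA ler_pdivrMr ?mulr_gt0 ?ltr_wpDl//; have := mulr_ge0 M0 (ltW s0); lra.
  lra.
have Wge x : - M <= W x.
  apply: (resolvent_ge WH (S := S) (k := k)) => [|z]; last by rewrite WE.
  have /choice[B HB] i : exists C, forall x, `|w i x| <= C by case: (wH i).
  exists (\sum_i `|g (node i)| * B i) => z; apply: le_trans (ler_norm_sum _ _ _) _.
  by apply: ler_sum => i _; rewrite normrM ler_wpM2l.
pose Phi x := W x + psi x + (s - k ^+ 2 * c).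
pose HPhi x := HW x + Hpsi x.
have PhiH : C2fun Phi HPhi.
  apply: C2fun_ext (C2funD (C2funD WH psiH) (C2fun_cst _ (s - k ^+ 2 * c))) => x //.
  by rewrite addr0.
have cphi : continuous Phi by case: PhiH => G [].
have cg := lipschitz_continuous_pt gL.
have [|||x1 x1r x1max] := compact_EVT_max (A := [set z : pt | `|z - y| <= rho])
    (f := fun z => g z - Phi z).
- by exists y; rewrite /= subrr normr0 ltW.
- exact: compact_cball.
- by apply: continuous_subspaceT => z; apply: continuousB; [exact: cg|exact: cphi].
have k21 : k ^+ 2 <= 1 by rewrite expr_le1.
have k20 := sqr_ge0 k.
have kc : k ^+ 2 * c <= c0.
  rewrite (le_trans (ler_norm _))// normrM ger0_norm//.
  by rewrite (le_trans (ler_piMl _ k21)).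
(* At an interior maximum [c] is at most [ellop S] of the Hessian of [Phi]. Writing [T w] for [w]
   minus [k^2] times its [ellop], this gives [Phi >= T W + T psi + s >= p + s >= g]. On the sphere
   the barrier decides. *)
have fin : g x1 <= Phi x1.
  move: x1r; rewrite inE/= le_eqVlt => /orP[/eqP x1r|x1r].
    have := psi_bd x1 x1r; have := Wge x1; have := gM x1; rewrite ler_norml /Phi => /andP[_].
    lra.
  have h : c <= ellop S (HPhi x1).
    by apply: gvisc PhiH x1r _ => z zy; apply: x1max; rewrite inE.
  have := WE x1; have := psi_sup x1; have := pg x1 (ltW x1r).
  move: h; rewrite /HPhi ellopD /Phi => h; have := ler_wpM2l k20 h; rewrite mulrDr; lra.
have : g y - Phi y <= g x1 - Phi x1 by apply: x1max; rewrite inE/= subrr normr0 ltW.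
rewrite -subr_le0 in fin; move=> /le_trans/(_ fin); rewrite subr_le0 /Phi psiy.
have -> : W y = \sum_i w i y * g (node i) by apply: eq_bigr => i _; rewrite mulrC.
lra.
Qed.

End ResolventInequality.

(** * Averages over translations *)

Section Averages.
Variables (R : realType) (N : nat).
Notation pt := 'rV[R]_N.
Implicit Types (g : pt -> R) (x y z : pt).

(** The interval leaves room on both sides of [[0, 1]], so that derivatives at the ends of
    [[0, eps]] are two-sided. *)
Lemma antiderivative (f : R -> R) : continuous f ->
  exists F : R -> R, forall t : R, -1 < t < 2 -> is_derive t 1 F (f t).
Proof.
move=> cf; exists (fun s : R => \int[lebesgue_measure]_(t in [set` Interval (BLeft (-1)) (BRight s)]) f t)%R.
move=> t /andP[t1 t2].
have intf : lebesgue_measure.-integrable [set` Interval (BLeft (-1)) (BRight 2)] (EFin \o f).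
  by apply: continuous_compact_integrable; [exact: segment_compact|exact: continuous_subspaceT].
have [|d e] := continuous_FTC1 t2 intf _ (cf t); first by rewrite /= lte_fin.
by split; [apply: d|rewrite -derive1E; apply: e].
Qed.

Definition lip (L : R) (g : pt -> R) := forall x x', `|g x - g x'| <= L * `|x - x'|.

Lemma lip_continuous L g : lip L g -> continuous g.
Proof. exact: lipschitz_continuous_pt. Qed.

Lemma continuous_line (g : pt -> R) (x v : pt) : continuous g ->
  continuous (fun t : R => g (x + t *: v)).
Proof.
move=> cg t; apply: (@continuous_comp _ _ _ (fun t : R => x + t *: v) g); last exact: cg.
apply: continuousD; first exact: cst_continuous.
exact: scalel_continuous.
Qed.

Variable eps : R.
Hypothesis eps01 : 0 < eps <= 1.
Let eps0 : 0 < eps. Proof. by case/andP: eps01. Qed.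

(** The mean of [g] over a segment of length [eps], encoded by a chosen antiderivative. For
    continuous [g] the value does not depend on the choice, since antiderivatives differ by
    constants. *)
Definition avg (i : 'I_N) (g : pt -> R) (x : pt) : R :=
  let F := xget (fun=> 0) [set F : R -> R | forall t : R, -1 < t < 2 ->
     is_derive t 1 F (g (x + t *: ebasis R i))] in
  (F eps - F 0) / eps.

Lemma avg_ex i g x : continuous g -> exists2 F : R -> R,
  (forall t : R, -1 < t < 2 -> is_derive t 1 F (g (x + t *: ebasis R i))) &
  avg i g x = (F eps - F 0) / eps.
Proof.
move=> cg; have [F HF] := antiderivative (@continuous_line g x (ebasis R i) cg).
rewrite /avg; set F' := xget _ _; exists F' => //.
by rewrite /F'; case: xgetP => [G _ //|/(_ F)]; case.
Qed.

Lemma derive_mean (F f : R -> R) : (forall t : R, 0 <= t <= eps -> is_derive t 1 F (f t)) ->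
  exists2 t, 0 <= t <= eps & (F eps - F 0) / eps = f t.
Proof.
move=> dF; have [||t] := @MVT R F f 0 eps eps0.
- by move=> t; rewrite in_itv/= => /andP[t0 te]; apply: dF; rewrite !ltW.
- apply: derivable_within_continuous => t; rewrite in_itv/= => tt.
  by case: (dF t tt).
rewrite in_itv/= => /andP[t0 te]; rewrite subr0 => ->; exists t; first by rewrite !ltW.
by rewrite mulfK// gt_eqF.
Qed.

Lemma avgP i g x (F : R -> R) : continuous g ->
  (forall t : R, 0 <= t <= eps -> is_derive t 1 F (g (x + t *: ebasis R i))) ->
  avg i g x = (F eps - F 0) / eps.
Proof.
move=> cg dF; have [G dG ->] := avg_ex i x cg.
have [|t _] := @derive_mean (fun t => G t - F t) (fun=> 0).
  move=> t /andP[t0 te]; have {}dG := dG t.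
  have h : -1 < t < 2 by case/andP: eps01 => ? ?; apply/andP; split; lra.
  have {}dF : is_derive t 1 F (g (x + t *: ebasis R i)) by apply: dF; rewrite t0.
  by have := is_deriveB (dG h) dF; rewrite subrr.
move=> /eqP; rewrite mulf_eq0 invr_eq0 (gt_eqF eps0) orbF => /eqP E.
congr (_ / _); lra.
Qed.

(** Mean value theorem for integrals; bounds and positivity of averages are read off from it. *)
Lemma avg_mean i g x : continuous g ->
  exists2 t, 0 <= t <= eps & avg i g x = g (x + t *: ebasis R i).
Proof.
move=> cg; have [F dF ->] := avg_ex i x cg.
apply: (@derive_mean F (fun t => g (x + t *: ebasis R i))) => t /andP[t0 te].
by apply: dF; case/andP: eps01 => ? ?; apply/andP; split; lra.
Qed.

Lemma avgD i g g' x : continuous g -> continuous g' ->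
  avg i (fun y => g y + g' y) x = avg i g x + avg i g' x.
Proof.
move=> cg cg'; have [F dF E] := avg_ex i x cg; have [G dG E'] := avg_ex i x cg'.
have c1 : continuous (fun y => g y + g' y).
  by move=> y; apply: continuousD; [exact: cg|exact: cg'].
have d1 (t : R) : 0 <= t <= eps -> is_derive t 1 (fun t => F t + G t)
    (g (x + t *: ebasis R i) + g' (x + t *: ebasis R i)).
  move=> /andP[t0 te].
  have h : -1 < t < 2 by case/andP: eps01 => ? ?; apply/andP; split; lra.
  by have := is_deriveD (dF t h) (dG t h).
by rewrite (avgP c1 d1) E E'; field; rewrite gt_eqF.
Qed.

Lemma avgZ i c g x : continuous g -> avg i (fun y => c * g y) x = c * avg i g x.
Proof.
move=> cg; have [F dF E] := avg_ex i x cg.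
have c1 : continuous (fun y => c * g y) by move=> y; apply: continuous_cstM; exact: cg.
have d1 (t : R) : 0 <= t <= eps -> is_derive t 1 (fun t => c * F t)
    (c * g (x + t *: ebasis R i)).
  move=> /andP[t0 te].
  have h : -1 < t < 2 by case/andP: eps01 => ? ?; apply/andP; split; lra.
  by have := is_deriveZ c (dF t h).
by rewrite (avgP c1 d1) E; field; rewrite gt_eqF.
Qed.

Lemma avg_cst i c x : avg i (fun=> c) x = c.
Proof.
have cc : continuous (fun _ : pt => c) by move=> y; exact: cst_continuous.
by have [t _ ->] := avg_mean i x cc.
Qed.

Lemma avgB i g g' x : continuous g -> continuous g' ->
  avg i (fun y => g y - g' y) x = avg i g x - avg i g' x.
Proof.
move=> cg cg'; rewrite -[in RHS]mulN1r -avgZ// -avgD//.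
  by congr avg; apply/funext => y; rewrite mulN1r.
by move=> y; apply: continuous_cstM; exact: cg'.
Qed.

(** Both sides choose from the same set of antiderivatives, hence the same function. *)
Lemma avg_shift i g z x : avg i (fun y => g (y + z)) x = avg i g (x + z).
Proof.
rewrite /avg; set A := [set F | _]; set B := [set F | _].
suff -> : A = B by [].
by rewrite /A /B; apply/funext => F; apply/propext; split=> H t tt;
  have := H t tt; rewrite addrAC.
Qed.

Lemma continuous_shift (g : pt -> R) (z : pt) : continuous g -> continuous (fun y => g (y + z)).
Proof.
move=> cg x; apply: (@continuous_comp _ _ _ (fun x : pt => x + z) g); last exact: cg.
by apply: continuousD; [exact: id|exact: cst_continuous].
Qed.

Lemma ebasis_norm (i : 'I_N) : `|ebasis R i| <= 1.
Proof.
apply: rV_norm_le => // j; rewrite mxE eqxx/=.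
by case: (j == i); rewrite ?normr1 ?normr0.
Qed.

Lemma avg_norm_le i g x (M : R) : continuous g -> (forall y, `|g y| <= M) -> `|avg i g x| <= M.
Proof. by move=> cg gM; have [t _ ->] := avg_mean i x cg. Qed.

Lemma avg_lip i g L : lip L g -> lip L (avg i g).
Proof.
move=> gL x x'; have cg := lip_continuous gL.
have -> : avg i g x' = avg i (fun y => g (y + (x' - x))) x.
  by rewrite avg_shift addrCA subrr addr0.
rewrite -avgB//; last exact: continuous_shift.
apply: avg_norm_le.
  by move=> y; apply: continuousB; [exact: cg|exact: continuous_shift].
by move=> y; apply: le_trans (gL _ _) _; rewrite opprD addrA subrr sub0r opprB.
Qed.

Definition diffq (j : 'I_N) (g : pt -> R) (x : pt) : R := (g (x + eps *: ebasis R j) - g x) / eps.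

Lemma diffq_lip j g L : lip L g -> lip (2 * L / eps) (diffq j g).
Proof.
have ei : 0 <= eps^-1 by rewrite invr_ge0 ltW.
move=> gL x x'; rewrite /diffq -mulrBl normrM [`|eps^-1|]ger0_norm//.
rewrite [leRHS]mulrAC ler_wpM2r//.
have h1 := gL (x + eps *: ebasis R j) (x' + eps *: ebasis R j); have h2 := gL x x'.
rewrite opprD addrACA subrr addr0 in h1.
set a := g _ in h1 *; set b := g _ in h1 *; set c := g _ in h2 *; set d := g _ in h2 *.
have -> : a - c - (b - d) = (a - b) - (c - d) by ring.
by apply: le_trans (ler_normB _ _) _; move: h1 h2; lra.
Qed.

Lemma avg_diffq i j g x : continuous g -> avg i (diffq j g) x = diffq j (avg i g) x.
Proof.
move=> cg; have c1 := @continuous_shift _ (eps *: ebasis R j) cg.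
rewrite /diffq -avg_shift -avgB// mulrC -avgZ.
  by congr avg; apply/funext => y; rewrite mulrC.
by move=> y; apply: continuousB; [exact: c1|exact: cg].
Qed.

(** Shifting an antiderivative along the line yields one for the translated base point, so averaging
    gains a derivative, equal to a difference quotient of [g]. *)
Lemma is_derive_avg i g x : continuous g -> is_derive x (ebasis R i) (avg i g) (diffq i g x).
Proof.
move=> cg; have [F dF E] := avg_ex i x cg; case/andP: eps01 => _ eps1.
have epsp : 0 < eps by case/andP: eps01.
have i0 : -1 < (0 : R) < 2 by lra.
have ie : -1 < eps < 2 by lra.
have d0 := dF 0 i0; have de := dF eps ie.
apply: is_derive_eps => e e0; have ee : 0 < e * eps / 2 by rewrite divr_gt0// mulr_gt0.
have [r1 r10 H1] := eps_is_derive d0 ee; have [r2 r20 H2] := eps_is_derive de ee.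
exists (Num.min (1/2) (Num.min r1 r2)); first by rewrite !lt_min r10 r20 divr_gt0.
move=> h; rewrite !lt_min => /and3P[h0 h1 h2].
have d1 (t : R) : 0 <= t <= eps -> is_derive t 1 (fun t => F (t + h))
    (g (x + h *: ebasis R i + t *: ebasis R i)).
  move=> /andP[t0 te].
  have th : -1 < t + h < 2 by move: h0; rewrite ltr_norml => /andP[? ?]; lra.
  rewrite -addrA -scalerDl (addrC h); apply: is_derive_eps => e' e'0.
  have [r r0 Hr] := eps_is_derive (dF _ th) e'0.
  by exists r => // h' hr; have := Hr h' hr; rewrite (addrAC t).
rewrite (avgP cg d1); have := H1 h h1; have := H2 h h2.
have hE : h *: (1 : R) = h by exact: mulr1.
rewrite !hE !add0r scale0r addr0 E /diffq.
set a := F (eps + h); set b := F eps; set c := F 0; set d := F h.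
set p := g (x + eps *: _); set q := g x => hA hB.
have -> : (a - d) / eps - (b - c) / eps - h * ((p - q) / eps) =
   ((a - b - h * p) - (d - c - h * q)) / eps by field; rewrite gt_eqF.
have ei : 0 <= eps^-1 by rewrite invr_ge0 ltW.
rewrite normrM [`|eps^-1|]ger0_norm// ler_pdivrMr//.
apply: le_trans (ler_normB _ _) _.
by move: hA hB; lra.
Qed.

(** A Lipschitz [g'] makes the first-order expansion of [g] uniform in the base point, hence stable
    under averaging. *)
Lemma is_derive_avg_under i j g g' L x : continuous g -> lip L g' ->
  (forall y, is_derive y (ebasis R j) g (g' y)) ->
  is_derive x (ebasis R j) (avg i g) (avg i g' x).
Proof.
move=> cg g'L dg; have cg' := lip_continuous g'L.
apply: is_derive_eps => e e0.
have L1 : 0 < `|L| + 1 by rewrite ltr_wpDl.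
exists (e / (`|L| + 1)); first by rewrite divr_gt0.
move=> h; rewrite ltr_pdivlMr// => hL.
have c1 := @continuous_shift _ (h *: ebasis R j) cg.
have c2 : continuous (fun y => g (y + h *: ebasis R j) - g y).
  by move=> y; apply: continuousB; [exact: c1|exact: cg].
have c3 : continuous (fun y => h * g' y) by move=> y; apply: continuous_cstM; exact: cg'.
rewrite -avg_shift -avgB// -avgZ// -avgB//; apply: avg_norm_le.
  by move=> y; exact: (continuousB (c2 y) (c3 y)).
move=> y; apply: (mean_value_line (g := g')) => t th.
apply: le_trans (g'L _ _) _; rewrite addrAC subrr add0r normrZ.
have Le : `|h| * (`|L| + 1) <= e by exact: ltW.
apply: le_trans Le; rewrite mulrC.
apply: (@le_trans _ _ ((`|t| * `|ebasis R j|) * `|L|)).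
  by apply: ler_wpM2l; [exact: mulr_ge0|exact: ler_norm].
apply: ler_pM => //.
- by rewrite (le_trans _ th)// ler_piMr// ebasis_norm.
- by rewrite lerDl.
Qed.

Definition avgs (s : seq 'I_N) (g : pt -> R) : pt -> R := foldr avg g s.

Lemma avgs_lip s g L : lip L g -> lip L (avgs s g).
Proof. by move=> gL; elim: s => //= i s IH; exact: avg_lip. Qed.

Lemma avgs_norm_le s g M L x : lip L g -> (forall y, `|g y| <= M) -> `|avgs s g x| <= M.
Proof.
move=> gL gM; elim: s x => //= i s IH x; apply: avg_norm_le => //.
exact/lip_continuous/avgs_lip.
Qed.

Lemma avgs_cst s c : avgs s (fun=> c) = (fun=> c).
Proof.
elim: s => //= i s ->; apply/funext => x; exact: avg_cst.
Qed.

Lemma lipD L L' g g' : lip L g -> lip L' g' -> lip (L + L') (fun x => g x + g' x).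
Proof.
move=> gL gL' x x'; rewrite opprD addrACA (le_trans (ler_normD _ _))// mulrDl.
exact: lerD.
Qed.

Lemma lipZ L c g : lip L g -> lip (`|c| * L) (fun x => c * g x).
Proof. by move=> gL x x'; rewrite -mulrBr normrM -mulrA ler_wpM2l. Qed.

Lemma lip_shift L g z : lip L g -> lip L (fun x => g (x + z)).
Proof. by move=> gL x x'; apply: le_trans (gL _ _) _; rewrite opprD addrACA subrr addr0. Qed.

Lemma lip_cst c : lip 0 (fun=> c).
Proof. by move=> x x'; rewrite subrr normr0 mul0r. Qed.

Lemma avgsD s g g' L L' : lip L g -> lip L' g' ->
  avgs s (fun y => g y + g' y) = (fun x => avgs s g x + avgs s g' x).
Proof.
move=> gL gL'; elim: s => //= i s ->; apply/funext => x.
by rewrite avgD//; apply/lip_continuous/avgs_lip; [exact: gL|exact: gL'].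
Qed.

Lemma avgsZ s c g L : lip L g -> avgs s (fun y => c * g y) = (fun x => c * avgs s g x).
Proof.
move=> gL; elim: s => //= i s ->; apply/funext => x.
by rewrite avgZ//; apply/lip_continuous/avgs_lip; exact: gL.
Qed.

Lemma avgs_shift s g z : avgs s (fun y => g (y + z)) = (fun x => avgs s g (x + z)).
Proof.
elim: s => //= i s ->; apply/funext => x; exact: avg_shift.
Qed.

Lemma avgs_sum (I : Type) (r : seq I) s (g : I -> pt -> R) L : (forall i, lip L (g i)) ->
  (exists L', lip L' (fun y => \sum_(i <- r) g i y)) /\
  avgs s (fun y => \sum_(i <- r) g i y) = (fun x => \sum_(i <- r) avgs s (g i) x).
Proof.
move=> gL; elim: r => [|i r [[L' hL'] IH]].
  have E (f : I -> pt -> R) : (fun y => \sum_(i <- [::]) f i y) = (fun=> 0).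
    by apply/funext => y; rewrite big_nil.
  by rewrite !E avgs_cst; split=> //; exists 0; exact: lip_cst.
have E (f : I -> pt -> R) : (fun y => \sum_(j <- i :: r) f j y) =
    (fun y => f i y + \sum_(j <- r) f j y).
  by apply/funext => y; rewrite big_cons.
rewrite !E; split; first by exists (L + L'); exact: lipD.
by rewrite (avgsD _ (gL i) hL') IH.
Qed.

(** Each average looks [eps] further, so positivity is required on a ball enlarged by [eps] per
    factor. *)
Lemma avgs_ge0 s g L y r : lip L g -> 0 <= r ->
  (forall x, `|x - y| <= r + (size s)%:R * eps -> 0 <= g x) ->
  forall x, `|x - y| <= r -> 0 <= avgs s g x.
Proof.
move=> gL; elim: s r => [|i s IH] r r0 Hg x xr; first by apply: Hg; rewrite mul0r addr0.
have [|t /andP[t0 te] /= ->] := @avg_mean i (avgs s g) x.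
  exact/lip_continuous/avgs_lip/gL.
apply: (IH (r + eps)); first by rewrite addr_ge0// ltW.
  by move=> z zy; apply: Hg; rewrite /= -natr1; move: zy; lra.
rewrite addrAC (le_trans (ler_normD _ _))// lerD// normrZ ger0_norm//.
by rewrite (le_trans _ te)// ler_piMr// ebasis_norm.
Qed.

(** One occurrence of [j] is spent on the derivative; the other averages remain. *)
Lemma is_derive_avgs s j g L x : j \in s -> lip L g ->
  is_derive x (ebasis R j) (avgs s g) (diffq j (avgs (rem j s) g) x).
Proof.
move=> + gL; elim: s x => //= i s IH x; rewrite in_cons eq_sym.
have [-> _|ij /= js] := eqVneq i j.
  by apply: is_derive_avg; exact/lip_continuous/avgs_lip/gL.
rewrite -avg_diffq; last exact/lip_continuous/avgs_lip/gL.
apply: is_derive_avg_under.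
- exact/lip_continuous/avgs_lip/gL.
- apply: diffq_lip; exact: avgs_lip gL.
- by move=> y; exact: IH.
Qed.

Lemma remC (T : eqType) (a b : T) s : rem a (rem b s) = rem b (rem a s).
Proof.
elim: s => //= c s IH; have [cb|cb] := eqVneq c b; have [ca|ca] := eqVneq c a => //=.
- by rewrite -cb -ca.
- by rewrite cb eqxx.
- by rewrite ca eqxx.
- by rewrite (negbTE cb) (negbTE ca) IH.
Qed.

Lemma mem_rem_cat (T : eqType) (a b : T) s1 s2 :
  b \in s1 -> a \in s2 -> a \in rem b (s1 ++ s2).
Proof.
move=> + as2; elim: s1 => //= c s IH; rewrite in_cons eq_sym.
have [_ _|_ /= bs] := eqVneq c b; first by rewrite mem_cat as2 orbT.
by rewrite in_cons IH ?orbT.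
Qed.

(** Every coordinate occurs twice, so that two derivatives can be taken even in the same
    direction. *)
Definition smoothing (g : pt -> R) : pt -> R := avgs (enum 'I_N ++ enum 'I_N) g.

Lemma smoothing_C2 g L : lip L g ->
  exists2 H, C2fun (smoothing g) H & forall x, (H x)^T = H x.
Proof.
move=> gL; pose s := enum 'I_N ++ enum 'I_N.
exists (fun x => \matrix_(i, j) diffq j (diffq i (avgs (rem i (rem j s)) g)) x).
  exists (fun j => diffq j (avgs (rem j s) g)); split.
  - exact/lip_continuous/avgs_lip/gL.
  - by move=> i; apply/lip_continuous/diffq_lip/avgs_lip/gL.
  - move=> i j.
    have -> : (fun x : pt => (\matrix_(i, j) diffq j (diffq i (avgs (rem i (rem j s)) g)) x) i j) =
      diffq j (diffq i (avgs (rem i (rem j s)) g)) by apply/funext => x; rewrite mxE.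
    exact/lip_continuous/diffq_lip/diffq_lip/avgs_lip/gL.
  - move=> x i; apply: is_derive_avgs gL.
    by rewrite mem_cat mem_enum.
  - move=> x i j; rewrite mxE.
    have d1 z : is_derive z (ebasis R i) (avgs (rem j s) g) (diffq i (avgs (rem i (rem j s)) g) z).
      by apply: is_derive_avgs gL; by apply: mem_rem_cat; rewrite mem_enum.
    have d2 : is_derive x (ebasis R i) (fun y => avgs (rem j s) g (y + eps *: ebasis R j))
        (diffq i (avgs (rem i (rem j s)) g) (x + eps *: ebasis R j)).
      apply: is_derive_eps => e e0; have [r r0 Hr] := eps_is_derive (d1 (x + eps *: ebasis R j)) e0.
      by exists r => // h hr; rewrite (addrAC x); exact: Hr.
    have -> : diffq j (avgs (rem j s) g) = (fun y => eps^-1 *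
        (avgs (rem j s) g (y + eps *: ebasis R j) - avgs (rem j s) g y)).
      by apply/funext => y; rewrite /diffq mulrC.
    rewrite [X in is_derive _ _ _ X]mulrC.
    exact: (is_deriveZ eps^-1 (is_deriveB d2 (d1 x))).
move=> x; apply/matrixP => i j; rewrite !mxE remC.
rewrite /diffq [x + _ + _]addrAC; set a := avgs _ _; field; by rewrite gt_eqF.
Qed.

Lemma smoothing_near g L x : 0 <= L -> lip L g ->
  `|smoothing g x - g x| <= L * ((N + N)%:R * eps).
Proof.
move=> L0 gL; pose s := enum 'I_N ++ enum 'I_N; pose d : R := (N + N)%:R * eps.
have sz : size s = (N + N)%N by rewrite size_cat size_enum_ord.
have P (c : R) : `|c| <= 1 -> 0 <= c * smoothing g x + (L * d - c * g x).
  move=> c1; have := @avgs_ge0 s (fun y => c * g y + (L * d - c * g x)) _ x 0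
    (lipD (lipZ c gL) (lip_cst _)) (lexx _) _ x.
  rewrite (avgsD _ (lipZ c gL) (lip_cst _)) avgs_cst (avgsZ _ _ gL) subrr normr0; apply => //.
  move=> z; rewrite add0r sz -/d => zx.
  have : `|c * (g x - g z)| <= L * d.
    rewrite normrM (le_trans (ler_piMl _ c1))// distrC (le_trans (gL _ _))//.
    by rewrite ler_wpM2l.
  by rewrite ler_norml => /andP[_]; rewrite mulrBr; lra.
have := P 1; have := P (-1); rewrite normrN normr1 => /(_ (lexx _)) h1 /(_ (lexx _)) h2.
by rewrite ler_norml -/d; lra.
Qed.

End Averages.

(** * Averages preserve linear viscosity inequalities *)

Section SmoothingPreservesSubsolutions.
Variables (R : realType) (N : nat).
Notation pt := 'rV[R]_N.

Definition visc_loc m (S : 'M[R]_(m, N)) (c : R) (g : pt -> R) (y : pt) (r : R) : Prop :=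
  forall phi H x, C2fun phi H -> `|x - y| < r ->
    (exists2 d : R, 0 < d & forall x', `|x' - x| < d -> g x' - phi x' <= g x - phi x) ->
    c <= ellop S (H x).

Lemma continuous_ellop m (S : 'M[R]_(m, N)) (H : pt -> 'M[R]_N) (x : pt) :
  (forall i j, continuous (fun x => H x i j)) -> {for x, continuous (fun x => ellop S (H x))}.
Proof.
move=> cH; have -> : (fun x => ellop S (H x)) =
    (fun x => \sum_i \sum_k S i k * (\sum_j S i j * H x j k)).
  apply/funext => z; rewrite /ellop /mxtrace; apply: eq_bigr => i _; rewrite mxE.
  by apply: eq_bigr => k _; rewrite !mxE mulrC.
apply: continuous_sumr => i; apply: continuous_sumr => k; apply: continuous_cstM.
by apply: continuous_sumr => j; apply: continuous_cstM; exact: cH.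
Qed.

Lemma visc_loc_shift m (S : 'M[R]_(m, N)) c g (y z : pt) (r rho : R) :
  visc_loc S c g y r -> rho + `|z| <= r -> visc_ge S c (fun x => g (x + z)) y rho.
Proof.
move=> gv zr phi H x pH xy xmax.
have := gv (fun x => phi (x - z)) (fun x => H (x - z)) (x + z).
rewrite addrK; apply.
- exact: C2fun_shift.
- by rewrite addrAC (le_lt_trans (ler_normD _ _))//; move: zr xy; lra.
- exists (rho - `|x - y|); first by rewrite subr_gt0.
  move=> x' x'x; have := xmax (x' - z); rewrite subrK; apply.
  have -> : x' - z - y = (x' - (x + z)) + (x - y) by apply/rowP => i; rewrite !mxE; ring.
  by rewrite (le_trans (ler_normD _ _))//; move: x'x; lra.
Qed.

(** By contradiction: if [ellop S (H y) < c], then near [y] the smooth [- f] is a subsolution with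
    constant [- c'] for some [c' < c]. The averaged resolvent inequality for [g] and the one for
    [- f] share their nodes, so the sums cancel and leave [k^2 (c - c') <= 2 s + 2 C k^4]. *)
Lemma smoothing_ellop m (S : 'M[R]_(m, N)) (c : R) (g : pt -> R) (L M eps r : R) (y : pt) H :
  0 < eps <= 1 -> 0 <= L -> lip L g -> (forall x, `|g x| <= M) ->
  (N + N)%:R * eps < r -> visc_loc S c g y r ->
  C2fun (smoothing eps g) H -> c <= ellop S (H y).
Proof.
move=> eps01 L0 gL gM epsr gv fH; rewrite leNgt; apply/negP => Hc.
have eps0 : 0 < eps by case/andP: eps01.
pose f := smoothing eps g; pose c' := (ellop S (H y) + c) / 2.
have c'c : c' < c by rewrite /c'; lra.
have [rho1 rho10 Hrho1] : exists2 rho : R, 0 < rho & forall x, `|x - y| < rho -> ellop S (H x) <= c'.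
  have cH : {for y, continuous (fun x => ellop S (H x))}.
    by apply: continuous_ellop; case: fH => G [].
  have e0 : 0 < c' - ellop S (H y) by rewrite /c'; lra.
  have /cvgrPdist_lt/(_ _ e0) := cH; rewrite -nbhs_nearE => /nbhs_ballP[rho /= rho0 Hr].
  exists rho => // x xy; have := Hr x; rewrite -ball_normE/= distrC => /(_ xy).
  by rewrite ltr_norml => /andP[h _]; lra.
pose d : R := (N + N)%:R * eps; rewrite -/d in epsr.
have d0 : 0 <= d by rewrite mulr_ge0// ltW.
pose rho := Num.min 1 (Num.min (rho1 / 2) (r - d)).
have rho0 : 0 < rho by rewrite !lt_min ltr01 divr_gt0// subr_gt0.
have rho01 : 0 < rho <= 1 by rewrite rho0 ge_min lexx.
have rhor : rho <= r - d by rewrite !ge_min lexx !orbT.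
have rhorho1 : rho < rho1.
  apply: (@le_lt_trans _ _ (rho1 / 2)); first by rewrite !ge_min lexx orbT.
  by rewrite ltr_pdivrMr// ltr_pMr// ltr1n.
have M0 : 0 <= M by exact: le_trans (gM 0).
have c00 : 0 <= `|c| + `|c'| by rewrite addr_ge0.
have [C HC] := resolvent_ineq S y rho01 M0 L0 c00.
pose D := c - c'; have D0 : 0 < D by rewrite subr_gt0.
have C1 : 0 < 4 * (`|C| + 1) by rewrite mulr_gt0// ltr_wpDl.
(* Makes [C k^4] at most [k^2 D / 4]; with [s = k^2 D / 8] the total error is three quarters of
   [k^2 D]. *)
pose k := Num.min 1 (D / (4 * (`|C| + 1))).
have k0 : 0 < k by rewrite lt_min ltr01 divr_gt0.
have k1 : k <= 1 by rewrite ge_min lexx.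
have kD : k * (4 * (`|C| + 1)) <= D by rewrite -ler_pdivlMr// ge_min lexx orbT.
have k20 : 0 < k ^+ 2 by rewrite exprn_gt0.
pose s := k ^+ 2 * D / 8; have s0 : 0 < s by rewrite divr_gt0// mulr_gt0.
have k01 : 0 <= k <= 1 by rewrite ltW.
have [K [node [om [nodein Hom]]]] := HC k s k01 s0.
pose c1 := s - k ^+ 2 * c + C * k ^+ 4.
pose t := enum 'I_N ++ enum 'I_N.
have sz : size t = (N + N)%N by rewrite size_cat size_enum_ord.
have fL : lip L f by exact: avgs_lip.
(* The inequality at [y] for the translate of [g] by [x - y] is one between functions of [x], valid
   for [|x - y| <= d], the reach of the smoothing; averaging in [x] replaces [g] by [f]. *)
have up : f y <= \sum_i om i * f (node i) + c1.
  pose gk i x := om i * g (x + (node i - y)).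
  have gkL : forall i, lip ((\sum_i `|om i|) * L) (gk i).
    move=> i x x'; rewrite /gk -mulrBr normrM -mulrA; apply: ler_pM => //.
      by rewrite (bigD1 i)//= lerDl sumr_ge0.
    by apply: le_trans (gL _ _) _; rewrite opprD addrACA subrr addr0.
  have [[L' hL'] sumE] := avgs_sum eps01 (index_enum K) t gkL.
  have hB : lip (L' + 0) (fun x => \sum_i gk i x + c1) by apply: lipD => //; exact: lip_cst.
  have hN : lip (`|-1| * L) (fun x => -1 * g x) by exact: lipZ.
  have := @avgs_ge0 R N eps eps01 t (fun x => (\sum_i gk i x + c1) + (-1 * g x)) _ y 0
     (lipD hB hN) (lexx _).
  rewrite (avgsD eps01 _ hB hN) (avgsD eps01 _ hL' (lip_cst c1)) avgs_cst// sumE (avgsZ eps01 _ _ gL).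
  rewrite sz add0r -/d.
  have pos (x : pt) : `|x - y| <= d -> 0 <= \sum_i gk i x + c1 + -1 * g x.
    move=> xy; have h : g x <= \sum_i om i * g (node i + (x - y)) + s - k ^+ 2 * c + C * k ^+ 4.
      have := Hom (fun z => g (z + (x - y))) c; rewrite addrCA subrr addr0; apply.
      - by rewrite lerDl.
      - by [].
      - by move=> z z'; apply: le_trans (gL _ _) _; rewrite opprD addrACA subrr addr0.
      - by apply: visc_loc_shift gv _; move: rhor xy; lra.
    rewrite (eq_bigr (fun i => om i * g (node i + (x - y)))); first by rewrite /c1; lra.
    by move=> i _; rewrite /gk addrCA.
  move=> /(_ pos y); rewrite subrr normr0 => /(_ (lexx _)); rewrite mulN1r subr_ge0 -/(f y).
  move=> h; apply: le_trans h _; rewrite lerD2r; apply: ler_sum => i _.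
  by rewrite /gk (avgsZ eps01 _ _ (lip_shift _ gL)) avgs_shift addrCA subrr addr0.
have dn : - f y <= - (\sum_i om i * f (node i)) + s + k ^+ 2 * c' + C * k ^+ 4.
  have h := Hom (fun x => - f x) (- c'); rewrite mulrN opprK in h.
  rewrite (_ : - (\sum_i om i * f (node i)) = \sum_i om i * - f (node i)); last first.
    by rewrite -sumrN; apply: eq_bigr => i _; rewrite mulrN.
  apply: h.
  - by rewrite normrN lerDr.
  - by move=> x; rewrite normrN; exact: avgs_norm_le gL gM.
  - by move=> x x'; rewrite -opprD normrN; exact: fL.
  - move=> phi P x pP xy xmax.
    have fpsi : psd (P x + H x).
      apply: (@C2fun_min_psd R N (fun x => phi x + f x) (fun x => P x + H x) x (rho - `|x - y|)).
      + exact: C2funD.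
      + by rewrite subr_gt0.
      + move=> x' x'x; have h' : `|x' - y| <= rho.
          by rewrite -[x'](subrK x) -addrA (le_trans (ler_normD _ _))//; move: x'x; lra.
        by have := xmax x' h'; lra.
    have := ellop_ge0 S fpsi; rewrite ellopD.
    have := Hrho1 x (lt_trans xy rhorho1); lra.
have hC : C * k ^+ 4 <= k ^+ 2 * D / 4.
  apply: (@le_trans _ _ (`|C| * (k ^+ 2 * k))).
    apply: (@le_trans _ _ (`|C| * k ^+ 4)).
      by rewrite ler_wpM2r ?ler_norm// exprn_ge0// ltW.
    rewrite ler_wpM2l// (_ : k ^+ 4 = k ^+ 2 * (k * k)); last by ring.
    by rewrite ler_pM2l// ler_piMr// ltW.
  rewrite mulrCA -mulrA ler_pM2l//; move: kD; lra.
move: up dn; rewrite /c1 /s; have : 0 < k ^+ 2 * D by rewrite mulr_gt0.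
have : k ^+ 2 * D = k ^+ 2 * c - k ^+ 2 * c' by rewrite /D mulrBr.
lra.
Qed.

End SmoothingPreservesSubsolutions.

(** * Convexity and regularity of subsolutions *)

Section Semicontinuity.
Variables (R : realType) (N : nat).
Notation pt := 'rV[R]_N.
Implicit Types (D : set pt) (u v g : pt -> R).

(** The sets where [g] is at least [g x] form a filter base on [D]; semicontinuity makes [g] at a
    cluster point dominate every value. *)
Lemma usc_max D g : compact D -> D !=set0 -> usc_on D g ->
  exists2 x, D x & forall y, D y -> g y <= g x.
Proof.
move=> cD [x0 Dx0] ug.
pose F := filter_from D (fun x => [set y | D y /\ g x <= g y]).
have FF : ProperFilter F.
  apply: filter_from_proper; last by move=> x Dx; exists x.
  apply: filter_from_filter; first by exists x0.
  move=> x y Dx Dy; have [xy|/ltW yx] := leP (g x) (g y).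
    by exists y => // z [Dz yz]; split; split=> //; exact: le_trans yz.
  by exists x => // z [Dz xz]; split; split=> //; exact: le_trans xz.
have FD : F D by exists x0 => // y [].
have [p [Dp clp]] := cD F FF FD.
exists p => // x Dx; apply/ler_addgt0Pr => e e0.
have [d d0 Hd] := ug p Dp e e0.
have Fx : F [set y | D y /\ g x <= g y] by exists x.
have Bp : nbhs p (ball p d) by exact: nbhsx_ballx.
have [z [[Dz xz]]] := clp _ _ Fx Bp; rewrite -ball_normE/= distrC => zp.
by apply: le_trans xz _; apply: ltW; exact: Hd.
Qed.

Lemma usc_onB D u v : usc_on D u -> lsc_on D v -> usc_on D (fun x => u x - v x).
Proof.
move=> uu lv x Dx e e0; have e20 : 0 < e / 2 by rewrite divr_gt0.
have [d1 d10 H1] := uu x Dx _ e20; have [d2 d20 H2] := lv x Dx _ e20.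
exists (Num.min d1 d2); first by rewrite lt_min d10.
move=> y Dy; rewrite lt_min => /andP[y1 y2].
by have := H1 y Dy y1; have := H2 y Dy y2; lra.
Qed.

Lemma continuous_near_pt g x (e : R) : {for x, continuous g} -> 0 < e ->
  exists2 d : R, 0 < d & forall y, `|y - x| < d -> `|g y - g x| < e.
Proof.
move=> cg e0; have /cvgrPdist_lt/(_ e e0) := cg.
rewrite -nbhs_nearE => /nbhs_ballP[d /= d0 H].
by exists d => // y yx; rewrite distrC; apply: H; rewrite -ball_normE/= distrC.
Qed.

Lemma continuous_lsc_on D g : continuous g -> lsc_on D g.
Proof.
move=> cg x Dx e e0; have [d d0 H] := continuous_near_pt (cg x) e0.
by exists d => // y _ yx; have := H y yx; rewrite ltr_norml; lra.
Qed.

Lemma usc_onS D D' g : D' `<=` D -> usc_on D g -> usc_on D' g.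
Proof.
move=> DD ug x Dx e e0; have [d d0 H] := ug x (DD _ Dx) e e0.
by exists d => // y Dy; apply: H; exact: DD.
Qed.

Lemma lsc_onS D D' g : D' `<=` D -> lsc_on D g -> lsc_on D' g.
Proof.
move=> DD ug x Dx e e0; have [d d0 H] := ug x (DD _ Dx) e e0.
by exists d => // y Dy; apply: H; exact: DD.
Qed.

End Semicontinuity.

Section Subsolutions.
Variables (R : realType) (N : nat).
Notation pt := 'rV[R]_N.
Variables (Omega : set pt) (h u : pt -> R).
Hypothesis usub : Q_subsolution Omega h u.
Hypothesis uusc : usc_on (closure Omega) u.

Lemma subsolution_test phi H x (r : R) : Omega x -> C2fun phi H -> 0 < r ->
  (forall y, Omega y -> `|y - x| < r -> u y - phi y <= u x - phi x) ->
  0 <= Fop h x (u x) (H x) /\ Qset (u x, H x).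
Proof.
move=> Ox pH r0 xmax; pose c := u x - phi x.
have pcH : C2fun (fun y => phi y + c) H.
  by apply: C2fun_ext (C2funD pH (C2fun_cst N c)) => // y; rewrite addr0.
have [C2 hE] := C2fun_C2_near x pcH.
have uE : u x = phi x + c by rewrite /c addrC subrK.
rewrite uE; apply: (@usub x Ox (phi x + c, H x)).
exists (fun y => phi y + c); split=> //.
- exists r => // y Oy; rewrite -ball_normE/= distrC => yx.
  by have := xmax y Oy yx; rewrite /c; lra.
- by rewrite hE.
Qed.

Let cball (x : pt) (r : R) : set pt := [set y | `|y - x| <= r].

Lemma cball_usc x r : cball x r `<=` Omega -> usc_on (cball x r) u.
Proof. by move=> BO; apply: usc_onS uusc; apply: subset_trans BO _; exact: subset_closure. Qed.

(** Jets at [x0] may be empty. A steep paraboloid centred at [x0] produces a jet at some [x1] of the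
    ball, and [u x0 <= u x1 - phi x1 <= u x1 <= 0]. *)
Lemma subsolution_le0 x0 (r : R) : 0 < r -> cball x0 r `<=` Omega -> u x0 <= 0.
Proof.
move=> r0 BO.
have B0 : cball x0 r !=set0 by exists x0; rewrite /cball/= subrr normr0 ltW.
have [xb _ bmax] := usc_max (@compact_cball R N x0 r) B0 (cball_usc BO).
(* On the sphere the paraboloid exceeds [u xb - u x0], which keeps the maximum inside. *)
pose K := (`|u xb| + `|u x0| + 1) / r ^+ 2.
have r2 : 0 < r ^+ 2 by rewrite exprn_gt0.
have K0 : 0 < K by rewrite divr_gt0// ltr_wpDl// addr_ge0.
pose phi (x : pt) : R := K * ((x - x0) *m (x - x0)^T) 0 0.
have phiH : C2fun phi (fun=> K *: 2%:M) by apply: C2funZ; exact: C2fun_sqn.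
have cphi : continuous phi by case: phiH => G [].
have phi0 : phi x0 = 0 by rewrite /phi subrr mul0mx mxE mulr0.
have [x1 x1B x1max] := usc_max (@compact_cball R N x0 r) B0
   (usc_onB (cball_usc BO) (continuous_lsc_on cphi)).
have h1 : u x0 <= u x1 - phi x1.
  by have := x1max x0; rewrite phi0 subr0; apply; rewrite /cball/= subrr normr0 ltW.
have phi1 : 0 <= phi x1 by rewrite mulr_ge0 ?sqn_ge0// ltW.
have x1r : `|x1 - x0| < r.
  move: x1B; rewrite /cball/= le_eqVlt => /orP[/eqP E|//].
  have := bmax x1; rewrite /cball/= E lexx => /(_ isT) h2.
  have h3 : `|u xb| + `|u x0| + 1 <= phi x1.
    rewrite /phi -[leLHS](@divfK _ (r ^+ 2)) ?gt_eqF// ler_pM2l// -E.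
    exact: sqr_norm_le_sqn.
  by have := ler_norm (u xb); have := ler_norm (- u x0); rewrite normrN; lra.
have O1 : Omega x1 by apply: BO; rewrite /cball/= ltW.
have r1 : 0 < r - `|x1 - x0| by rewrite subr_gt0.
have loc y : Omega y -> `|y - x1| < r - `|x1 - x0| -> u y - phi y <= u x1 - phi x1.
  move=> Oy yx; apply: x1max; rewrite /cball/= -[y](subrK x1) -addrA.
  by rewrite (le_trans (ler_normD _ _))//; move: yx; lra.
have [_ [_ [/= u1 _]]] := subsolution_test O1 phiH r1 loc.
by move: h1 phi1 u1; lra.
Qed.

(* If convexity failed on a segment, the paraboloid that is very steep across the segment and
   slightly concave along it would touch [u] from above. *)
Lemma subsolution_convex x0 (r : R) (a b : pt) (lam : R) : cball x0 r `<=` Omega ->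
  `|a - x0| < r -> `|b - x0| < r -> 0 <= lam <= 1 ->
  u (a + lam *: (b - a)) <= u a + lam * (u b - u a).
Proof.
move=> BO ar br /andP[lam0 lam1]; rewrite leNgt; apply/negP => contra.
pose d := b - a; pose dd : R := (d *m d^T) 0 0.
have dn0 : d != 0.
  apply/eqP => d0; move: contra.
  have ba : b = a by apply/eqP; rewrite -subr_eq0 -/d d0.
  by rewrite ba !subrr scaler0 mulr0 !addr0 ltxx.
have dd0 : 0 < dd.
  by rewrite lt_neqAle sqn_ge0 andbT eq_sym; apply: contra_neq dn0 => /sqn_eq0.
(* An affine coordinate along the segment, [0] at [a] and [1] at [b]; [pp] below is the squared
   distance to the line through them. *)
pose xi : pt := dd^-1 *: d; pose th : R := - (a *m xi^T) 0 0.
pose t (x : pt) : R := (x *m xi^T) 0 0 + th.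
have dxi : (d *m xi^T) 0 0 = 1 by rewrite linearZ/= -scalemxAr mx00E mulVf// gt_eqF.
have ta : t a = 0 by rewrite /t /th subrr.
have tE (x : pt) (s : R) : t (x + s *: d) = t x + s.
  by rewrite /t mulmxDl -scalemxAl !mx00E dxi; ring.
have tb : t b = 1 by have := tE a 1; rewrite scale1r /d addrC subrK ta add0r.
pose pp (x : pt) : R := ((x - a) *m (x - a)^T) 0 0 - dd * t x ^+ 2.
have ppE (x : pt) : pp x = ((x - a - t x *: d) *m (x - a - t x *: d)^T) 0 0.
  have tE' : t x = dd^-1 * ((x - a) *m d^T) 0 0.
    by rewrite /t /th linearZ/= -!scalemxAr !mx00E mulmxBl !mx00E; ring.
  have dE : ((x - a) *m d^T) 0 0 = dd * t x by rewrite tE' mulrA divff ?gt_eqF// mul1r.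
  have := @quadformD R N 1%:M (x - a) d (- t x) (trmx1 _ _).
  by rewrite !mulmx1 scaleNr => ->; rewrite dE -/dd /pp; ring.
have pp0 (x : pt) : 0 <= pp x by rewrite ppE sqn_ge0.
pose dl := u b - u a.
pose m (x : pt) : R := u x - (u a + dl * t x).
pose c := a + lam *: d.
have tc : t c = lam by rewrite tE ta add0r.
pose m0 := m c; have m00 : 0 < m0.
  by rewrite /m0 /m tc mulrC subr_gt0.
have ct : continuous t by exact: continuous_lin.
have cl : continuous (fun x => u a + dl * t x).
  have h1 := C2funD (C2fun_cst N (u a)) (C2funZ dl (C2fun_linear xi th)).
  by case: h1 => G [].
have B0 : cball x0 r !=set0 by exists a; rewrite /cball/= ltW.
have um : usc_on (cball x0 r) m := usc_onB (cball_usc BO) (continuous_lsc_on cl).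
have [xb _ bmax] := usc_max (@compact_cball R N x0 r) B0 um.
have aB : cball x0 r a by rewrite /cball/= ltW.
have bB : cball x0 r b by rewrite /cball/= ltW.
have m04 : 0 < m0 / 4 by rewrite divr_gt0.
have [da da0 Ha] := um a aB _ m04; have [db db0 Hb] := um b bB _ m04.
have ma : m a = 0 by rewrite /m ta; ring.
have mb : m b = 0 by rewrite /m tb /dl; ring.
rewrite ma add0r in Ha; rewrite mb add0r in Hb.
pose del := Num.min (Num.min da db) (Num.min (r - `|a - x0|) (r - `|b - x0|)).
have del0 : 0 < del by rewrite !lt_min da0 db0 !subr_gt0 ar br.
have [dela delb delar delbr] : [/\ del <= da, del <= db, del <= r - `|a - x0| & del <= r - `|b - x0|].
  by split; rewrite !ge_min lexx ?orbT.
pose B := `|m xb| + 1.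
have B0' : 0 < B by rewrite ltr_wpDl.
have mB (x : pt) : cball x0 r x -> m x < B.
  by move=> /bmax h1; rewrite (le_lt_trans h1)// (le_lt_trans (ler_norm _))// ltrDl.
(* At distance [del] or more from the line, [K pp >= B], which exceeds [m] on the ball. *)
pose K := B / del ^+ 2.
have del2 : 0 < del ^+ 2 by rewrite exprn_gt0.
have K0 : 0 < K by rewrite divr_gt0.
(* Along [d] the term in [pp] contributes nothing and the concave term has second derivative
   [- 2 m0], against semidefiniteness of the Hessian; in height that term costs at most [m0 / 4] on
   the slab. *)
pose phi (x : pt) : R := (u a + dl * t x) + m0 * (t x * (1 - t x)) + K * pp x.
have phiH : C2fun phi (fun=> - (2 * (m0 + K * dd)) *: (xi^T *m xi) + (2 * K)%:M).
  have h1 := C2funZ (dl + m0) (C2fun_linear xi th).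
  have h2 := C2funZ (- (m0 + K * dd)) (C2fun_sqr_linear xi th).
  have h3 := C2funZ K (C2fun_sqn a).
  apply: C2fun_ext (C2funD (C2funD (C2funD (C2fun_cst N (u a)) h1) h2) h3) => x.
    by rewrite /phi /pp -/(t x); ring.
  rewrite scaler0 !add0r scalerA scale_scalar_mx; congr (_ *: _ + _%:M); ring.
have cphi : continuous phi by case: phiH => G [].
pose Z := cball x0 r `&` [set x | 0 <= t x <= 1].
have cZ : compact Z.
  apply: (subclosed_compact _ (@compact_cball R N x0 r)); last by move=> x [].
  apply: closedI; first exact: compact_closed (@compact_cball R N _ _).
  have -> : [set x | 0 <= t x <= 1] = (t @^-1` [set s | 0 <= s]) `&` (t @^-1` [set s | s <= 1]).
    by apply/seteqP; split=> x /= => [/andP[]|[-> ->]].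
  by apply: closedI; (apply: preimage_closed => [x _|]; [exact: ct|]);
    [exact: closed_ge|exact: closed_le].
have segB (s : R) : 0 <= s <= 1 -> `|a + s *: d - x0| <= r - del.
  move=> /andP[s0 s1].
  have -> : a + s *: d - x0 = (1 - s) *: (a - x0) + s *: (b - x0).
    by apply/rowP => i; rewrite !mxE; ring.
  rewrite (le_trans (ler_normD _ _))// !normrZ !ger0_norm// ?subr_ge0//.
  have a1 : `|a - x0| <= r - del by lra.
  have b1 : `|b - x0| <= r - del by lra.
  have s1' : 0 <= 1 - s by lra.
  have := ler_wpM2l s1' a1; have := ler_wpM2l s0 b1; lra.
have cZc : Z c.
  split; last by rewrite /= tc lam0.
  by rewrite /cball/= (le_trans (segB lam _)) ?lam0//; lra.
have uZ : usc_on Z (fun x => u x - phi x).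
  apply: usc_onB; last exact: continuous_lsc_on.
  by apply: usc_onS (cball_usc BO) => x [].
have [x1 [x1B /andP[t10 t11]] x1max] := usc_max cZ (ex_intro _ c cZc) uZ.
have psiE (x : pt) : u x - phi x = m x - m0 * (t x * (1 - t x)) - K * pp x.
  by rewrite /phi /m; ring.
have h1 : 3 / 4 * m0 <= u x1 - phi x1.
  apply: le_trans (x1max c cZc); rewrite psiE tc -/m0.
  have -> : pp c = 0.
    by rewrite ppE tc /c [a + _]addrC addrK subrr mul0mx mxE.
  have h2 : 0 <= (lam - 1 / 2) ^+ 2 by exact: sqr_ge0.
  have := mulr_ge0 (ltW m00) h2; lra.
have tt0 : 0 <= m0 * (t x1 * (1 - t x1)).
  have t1' : 0 <= 1 - t x1 by rewrite subr_ge0.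
  exact: mulr_ge0 (ltW m00) (mulr_ge0 t10 t1').
have clo : `|x1 - (a + t x1 *: d)| < del.
  rewrite -(@ltr_pXn2r _ 2)// ?nnegrE ?normr_ge0 ?(ltW del0)//.
  apply: le_lt_trans (sqr_norm_le_sqn _) _; rewrite opprD addrA -ppE.
  have h2 : K * pp x1 < B by have := mB x1 x1B; move: h1; rewrite psiE; lra.
  by move: h2; rewrite /K mulrAC ltr_pdivrMr// ltr_pM2l.
have kpp : 0 <= K * pp x1 by rewrite mulr_ge0// ltW.
(* On a face of the slab [x1] would be [del]-close to an endpoint, where [m < m0 / 4], against
   [m x1 >= 3 m0 / 4]. *)
have t1n0 : t x1 != 0.
  apply/eqP => t0; have E : a + t x1 *: d = a by rewrite t0 scale0r addr0.
  have xa := clo; rewrite E in xa.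
  by have := Ha x1 x1B (lt_le_trans xa dela); move: h1; rewrite psiE; lra.
have t1n1 : t x1 != 1.
  apply/eqP => t1; have E : a + t x1 *: d = b by rewrite t1 scale1r /d (addrC a) subrK.
  have xa := clo; rewrite E in xa.
  by have := Hb x1 x1B (lt_le_trans xa delb); move: h1; rewrite psiE; lra.
have t1p : 0 < t x1 by rewrite lt_neqAle eq_sym t1n0.
have t1m : t x1 < 1 by rewrite lt_neqAle t1n1.
have x1r : `|x1 - x0| < r.
  have t01 : 0 <= t x1 <= 1 by rewrite t10.
  have := segB _ t01 => h2.
  rewrite (_ : x1 - x0 = (x1 - (a + t x1 *: d)) + (a + t x1 *: d - x0)).
    by rewrite (le_lt_trans (ler_normD _ _))//; lra.
  by rewrite addrA subrK.
have e0 : 0 < Num.min (t x1) (1 - t x1) by rewrite lt_min t1p subr_gt0.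
have [d1 d10 Hd1] := continuous_near_pt (ct x1) e0.
have O1 : Omega x1 by exact: BO.
have r1 : 0 < Num.min d1 (r - `|x1 - x0|) by rewrite lt_min d10 subr_gt0.
have loc y : Omega y -> `|y - x1| < Num.min d1 (r - `|x1 - x0|) ->
    u y - phi y <= u x1 - phi x1.
  move=> Oy; rewrite lt_min => /andP[y1 y2]; apply: x1max; split.
    rewrite /cball/= -[y](subrK x1) -addrA.
    by rewrite (le_trans (ler_normD _ _))//; move: y2; lra.
  by have := Hd1 y y1; rewrite lt_min !ltr_norml /=; lra.
have [_ [_ [_ /= pH]]] := subsolution_test O1 phiH r1 loc.
have := pH d; rewrite mulmxDr mulmxDl mx00E quadform_scalar -scalemxAr -scalemxAl mx00E.
have -> : (d *m (xi^T *m xi) *m d^T) 0 0 = 1.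
  rewrite mulmxA -(mulmxA _ xi) [d *m xi^T]mx11_scalar dxi mul_scalar_mx scale1r.
  by rewrite dotmxC.
rewrite -/dd.
by have := mulr_gt0 K0 dd0; move: m00; lra.
Qed.

End Subsolutions.

(** * Local Lipschitz continuity of subsolutions *)

Section LocalLipschitz.
Variables (R : realType) (N : nat).
Notation pt := 'rV[R]_N.

(** Coordinatewise projection onto a cube, the ball of the sup norm. Composition with it extends [u]
    to a bounded, globally Lipschitz function. *)
Definition clamp (x0 : pt) (r : R) (x : pt) : pt :=
  \row_i Num.max (x0 0 i - r) (Num.min (x0 0 i + r) (x 0 i)).

Lemma clamp_in x0 (r : R) x : 0 <= r -> `|clamp x0 r x - x0| <= r.
Proof.
move=> r0; apply: rV_norm_le => // i; rewrite !mxE ler_distl le_max lexx/= ge_max.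
by rewrite ge_min lexx/= andbT; lra.
Qed.

Lemma clamp_id x0 (r : R) (x : pt) : `|x - x0| <= r -> clamp x0 r x = x.
Proof.
move=> xr; apply/rowP => i; rewrite mxE.
have := coord_le_norm (x - x0) i; rewrite !mxE => /le_trans/(_ xr).
rewrite ler_distl => /andP[h1 h2].
by rewrite (min_idPr h2) (max_idPr h1).
Qed.

Lemma clamp_lip x0 (r : R) (x y : pt) : 0 <= r -> `|clamp x0 r x - clamp x0 r y| <= `|x - y|.
Proof.
move=> r0; apply: rV_norm_le => // i; rewrite !mxE.
have := coord_le_norm (x - y) i; rewrite !mxE; apply: le_trans.
move: (x 0 i) (y 0 i) (x0 0 i) => a b c.
wlog ab : a b / a <= b => [W|].
  by have [/W//|/ltW/W] := leP a b; rewrite distrC (distrC b).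
have [h1 h2] : Num.min (c + r) a <= Num.min (c + r) b /\
    Num.min (c + r) b - Num.min (c + r) a <= b - a.
  by case: (leP (c + r) a) => ?; case: (leP (c + r) b) => ?; lra.
rewrite distrC (distrC a) [leRHS]ger0_norm ?subr_ge0// ler_norml.
move: (Num.min _ _) (Num.min _ _) h1 h2 => p q h1 h2.
by case: (leP (c - r) p) => ?; case: (leP (c - r) q) => ?; lra.
Qed.

(** A convex function bounded above is bounded below by reflection through the centre; being bounded
    on a ball, it is Lipschitz on half of it, by comparison of slopes with a point further out. *)
Lemma subsolution_local_lip (Omega : set pt) (h u : pt -> R) x0 (r : R) :
  Q_subsolution Omega h u -> usc_on (closure Omega) u -> 0 < r ->
  [set y | `|y - x0| <= r] `<=` Omega ->
  exists (g : pt -> R) (L M : R),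
    [/\ 0 <= L, lip L g, forall x, `|g x| <= M & forall x, `|x - x0| <= r / 2 -> g x = u x].
Proof.
move=> usub uusc r0 BO.
have u0 x : `|x - x0| < r -> u x <= 0.
  move=> xr; apply: (@subsolution_le0 R N Omega h u usub uusc x (r - `|x - x0|)); first by rewrite subr_gt0.
  apply: subset_trans BO => y /= yx; rewrite -[y](subrK x) -addrA.
  by rewrite (le_trans (ler_normD _ _))//; move: yx; lra.
(* From [2 u x0 <= u x + u x'], where [x'] is the reflection of [x] and [u x' <= 0]. *)
pose B := - 2 * u x0.
have B0 : 0 <= B by have := u0 x0; rewrite subrr normr0 => /(_ r0); rewrite /B; lra.
have uB x : `|x - x0| < r -> - B <= u x.
  move=> xr; have br : `|(x0 + (x0 - x)) - x0| < r by rewrite addrAC subrr add0r distrC.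
  have l01 : 0 <= (1 / 2 : R) <= 1 by lra.
  have := subsolution_convex usub uusc BO xr br l01.
  have -> : x + (1 / 2) *: (x0 + (x0 - x) - x) = x0.
    by apply/rowP => i; rewrite !mxE; field.
  by have := u0 _ br; rewrite /B; lra.
pose L := 4 * B / r; have L0 : 0 <= L by rewrite divr_ge0 ?(ltW r0)// mulr_ge0.
have half x y : `|x - x0| <= r / 2 -> `|y - x0| <= r / 2 -> u y - u x <= L * `|x - y|.
  move=> xr yr; have [->|yx] := eqVneq y x; first by rewrite !subrr normr0 mulr0.
  pose e := `|x - y|; have e0 : 0 < e by rewrite normr_gt0 subr_eq0 eq_sym.
  have er0 : 0 < e + r / 4 by rewrite addr_gt0// divr_gt0.
  (* Prolongs the segment from [x] beyond [y] by [r / 4], still inside the ball, whence the slope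
     bound [B / (r / 4)]. *)
  pose z := x + ((e + r / 4) / e) *: (y - x).
  have zr : `|z - x0| < r.
    have -> : z - x0 = (y - x0) + (r / 4 / e) *: (y - x).
      by apply/rowP => i; rewrite !mxE; field; rewrite gt_eqF.
    rewrite (le_lt_trans (ler_normD _ _))// normrZ (distrC y x) -/e [`|_ / e|]ger0_norm; last first.
      by rewrite !divr_ge0// ltW.
    by rewrite divfK ?gt_eqF//; move: yr; lra.
  pose lam := e / (e + r / 4).
  have lam01 : 0 <= lam <= 1.
    rewrite divr_ge0 ?(ltW e0) ?(ltW er0)//= ler_pdivrMr// mul1r lerDl.
    by rewrite divr_ge0// ltW.
  have xr' : `|x - x0| < r by rewrite (le_lt_trans xr)//; lra.
  have := subsolution_convex usub uusc BO xr' zr lam01.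
  have -> : x + lam *: (z - x) = y.
    have k : lam * ((e + r / 4) / e) = 1.
      by rewrite /lam mulrA divfK ?(gt_eqF er0)// divff// gt_eqF.
    by rewrite /z addrAC subrr add0r scalerA k scale1r addrC subrK.
  have h1 := u0 z zr; have h2 := uB x xr' => h3.
  have h4 : lam * (u z - u x) <= lam * B by apply: ler_wpM2l; [case/andP: lam01|lra].
  have h5 : lam * B <= L * e.
    rewrite /L /lam mulrAC ler_pdivrMr// (_ : 4 * B / r * e * (e + r / 4) = e * B + e * B * (4 * e / r)).
      have re : 0 <= 4 * e / r by apply: divr_ge0; [apply: mulr_ge0 => //|]; exact: ltW.
      by rewrite lerDl; exact: mulr_ge0 (mulr_ge0 (ltW e0) B0) re.
    by field; rewrite gt_eqF.
  rewrite -/e; lra.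
exists (fun x => u (clamp x0 (r / 2) x)), L, B.
have r20 : 0 <= r / 2 by rewrite divr_ge0// ltW.
have cr x : `|clamp x0 (r / 2) x - x0| < r.
  by rewrite (le_lt_trans (clamp_in _ _ r20))//; lra.
split=> //.
- move=> x y; apply: (@le_trans _ _ (L * `|clamp x0 (r / 2) x - clamp x0 (r / 2) y|)).
    rewrite ler_norml; have := half _ _ (clamp_in x0 x r20) (clamp_in x0 y r20).
    by have := half _ _ (clamp_in x0 y r20) (clamp_in x0 x r20); rewrite distrC; lra.
  by rewrite ler_wpM2l// clamp_lip.
- by move=> x; rewrite ler_norml uB//=; have := u0 _ (cr x); lra.
- by move=> x xr; rewrite clamp_id.
Qed.

End LocalLipschitz.

(** * Comparison *)

Section DeterminantDuality.
Variables (R : realType) (N : nat).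
Hypothesis hN : (0 < N)%N.
Variables (q P : R) (H : 'M[R]_N).
Hypothesis P0 : 0 < P.
Hypothesis dualH : forall m (S : 'M[R]_(m, N)) c,
  (forall K : 'M[R]_N, K^T = K -> psd K -> q <= P * \det K -> c <= ellop S K) -> c <= ellop S H.

(** [dualH] says that [H] satisfies every linear inequality valid on the set of semidefinite [K]
    with [q <= P det K]. A single row with [c = 0] recovers semidefiniteness. *)
Lemma ellop_dual_psd : psd H.
Proof.
move=> x; have := @dualH 1 x 0; rewrite /ellop /mxtrace big_ord1; apply => K _ pK _.
by rewrite big_ord1; exact: pK.
Qed.

(* The matrix arithmetic-geometric inequality [N (det B det K)^(1/N) <= tr (B K)], which is an
   equality for [B] proportional to the inverse of [K]. *)
Lemma ellop_dual_det e : H^T = H -> 0 < e -> q <= P * \det (H + e%:M).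
Proof.
move=> sH e0; rewrite leNgt; apply/negP => contra.
have pH := ellop_dual_psd.
have sHe : (H + e%:M)^T = H + e%:M by rewrite linearD/= tr_scalar_mx sH.
have pe : psd (e%:M : 'M[R]_N) by apply: psd_scalar; exact: ltW.
have pHe : psd (H + e%:M) by exact: psdD.
have dHe : 0 < \det (H + e%:M).
  have := psd_det_superadd hN sH (tr_scalar_mx _ e) pH pe; rewrite det_scalar.
  by have := psd_det_ge0 sH pH; have := exprn_gt0 N e0; lra.
(* This [S] gives equality: [ellop S (H + e I) = N], while every admissible [K] has a larger
   determinant and so [ellop S K >= N]. Duality then yields [ellop S H >= N], and the surplus
   [e tr (S S^T)] is the contradiction. *)
have [S [SE dS]] := psd_normalize sHe pHe (lt0r_neq0 dHe).
have dS2 : 0 < \det S ^+ 2.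
  rewrite lt_neqAle sqr_ge0 andbT eq_sym; apply/eqP => S0.
  by move: dS => /eqP; rewrite S0 mul0r eq_sym oner_eq0.
have N0 : 0 < N%:R :> R by rewrite ltr0n.
have h1 : N%:R <= ellop S H.
  apply: dualH => K sK pK qK.
  have dK : \det (H + e%:M) <= \det K.
    by rewrite -(ler_pM2l P0); apply: ltW; exact: lt_le_trans contra qK.
  have sC := symmx_conj S sK; have pC := @psd_conj R N N K S pK.
  have := psd_det_le_trace sC pC; rewrite -/(ellop S K).
  have -> : \det (S *m K *m S^T) = \det S ^+ 2 * \det K by rewrite !det_mulmx det_tr; ring.
  have h2 : 1 <= \det S ^+ 2 * \det K by rewrite -dS ler_pM2l.
  have h3 : N%:R ^+ N <= N%:R ^+ N * (\det S ^+ 2 * \det K) :> R.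
    by rewrite ler_peMr// exprn_ge0// ltW.
  move=> /(le_trans h3); rewrite ler_pXn2r// nnegrE; first exact: ltW.
  exact: ellop_ge0.
have h2 : ellop S (H + e%:M) = N%:R by rewrite /ellop SE mxtrace1.
have h3 : ellop S e%:M = e * \tr (S *m 1%:M *m S^T).
  by rewrite -[e%:M]scalemx1 ellopZ.
have p1 : psd (1%:M : 'M[R]_N) by apply: psd_scalar.
have h4 := psd_det_le_trace (symmx_conj S (trmx1 _ _)) (@psd_conj R N N _ S p1).
have h5 : 0 < (\tr (S *m 1%:M *m S^T)) ^+ N.
  apply: lt_le_trans h4; rewrite mulr_gt0 ?exprn_gt0//.
  by rewrite !det_mulmx det_tr det1 mulr1 -expr2.
have h6 : 0 < \tr (S *m 1%:M *m S^T).
  rewrite lt_neqAle psd_trace_ge0; last exact: psd_conj.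
  rewrite andbT eq_sym; apply/eqP => t0; move: h5.
  by rewrite t0 expr0n gtn_eqF ?ltxx.
have := mulr_gt0 e0 h6; rewrite -h3.
by move: h2; rewrite ellopD; lra.
Qed.

End DeterminantDuality.

Section Comparison.
Variables (R : realType) (N : nat).
Notation pt := 'rV[R]_N.

Lemma bounded_closure_cball (Omega : set pt) : bounded_set Omega ->
  exists2 B : R, 0 <= B & closure Omega `<=` [set x | `|x - 0| <= B].
Proof.
move=> [M [_ HM]]; exists (`|M| + 1); first by rewrite addr_ge0.
have cB : closed [set x : pt | `|x - 0| <= `|M| + 1].
  exact: compact_closed (@compact_cball R N 0 _).
rewrite [X in _ `<=` X](iffLR (closure_id _) cB); apply: closureS => x Ox /=.
rewrite subr0; apply: (HM (`|M| + 1)) => //.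
by rewrite (le_lt_trans (ler_norm _))// ltrDl.
Qed.

Lemma continuous_usc_on (D : set pt) (g : pt -> R) : continuous g -> usc_on D g.
Proof.
move=> cg x Dx e e0; have [d d0 Hd] := continuous_near_pt (cg x) e0.
by exists d => // y _ yx; have := Hd y yx; rewrite ltr_norml; lra.
Qed.

Lemma supersolution_test (Omega : set pt) (h v phi : pt -> R) Hs (y : pt) (r : R) :
  Q_supersolution Omega h v -> Omega y -> C2fun phi Hs -> 0 < r ->
  (forall x, `|x - y| < r -> phi x - v x <= phi y - v y) ->
  rinterior (@Qset R N) (v y, Hs y) -> Fop h y (v y) (Hs y) <= 0.
Proof.
move=> vsup Oy pH r0 ymax int; pose c := v y - phi y.
have pcH : C2fun (fun x => phi x + c) Hs.
  by apply: C2fun_ext (C2funD pH (C2fun_cst N c)) => // x; rewrite addr0.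
have [C2 hE] := C2fun_C2_near y pcH.
have vE : v y = phi y + c by rewrite /c addrC subrK.
have jet : jet_minus Omega v y (phi y + c, Hs y).
  exists (fun x => phi x + c); split=> //; last by rewrite hE.
  exists r => // x Ox; rewrite -ball_normE/= distrC => xy.
  by have := ymax x xy; rewrite /c; lra.
have [F0|nint] := vsup y Oy _ jet; first by rewrite vE.
by case: nint; rewrite -vE.
Qed.

Lemma comparison (Omega : set pt) (h u v : pt -> R) : (0 < N)%N ->
  open Omega -> bounded_set Omega -> {within Omega, continuous h} ->
  usc_on (closure Omega) u -> lsc_on (closure Omega) v ->
  Q_subsolution Omega h u -> Q_supersolution Omega h v ->
  (forall x, (closure Omega `\` Omega) x -> u x <= v x) ->
  forall x, Omega x -> u x <= v x.
Proof.
move=> hN oO bO ch uusc vlsc usub vsup ubd x1 Ox1; rewrite leNgt; apply/negP => contra.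
have [B B0 clB] := bounded_closure_cball bO.
have cO : compact (closure Omega).
  exact: subclosed_compact (@closed_closure _ _) (@compact_cball R N 0 B) clB.
pose sqn (x : pt) : R := (x *m x^T) 0 0.
pose C : R := N%:R * B ^+ 2; have C0 : 0 <= C by rewrite mulr_ge0// sqr_ge0.
have sqnC x : closure Omega x -> sqn x <= C.
  move=> /clB/=; rewrite subr0 => xB; apply: le_trans (sqn_le_norm _) _.
  by rewrite ler_wpM2l// lerXn2r ?nnegrE.
pose u0 := u x1 - v x1; have u00 : 0 < u0 by rewrite subr_gt0.
(* Small enough that the penalty, at most [del C] in size, leaves the maximum positive. *)
pose del := u0 / (2 * (C + 1)).
have C1 : 0 < 2 * (C + 1) by rewrite mulr_gt0// ltr_wpDl.
have del0 : 0 < del by rewrite divr_gt0.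
have delC : del * C < u0.
  rewrite /del mulrAC ltr_pdivrMr// ltr_pM2l//; lra.
(* Nonpositive on the closure, so that the boundary inequality persists, and with Hessian
   [2 del I]. *)
pose q (x : pt) : R := del * (sqn x - C).
have qH : C2fun q (fun=> del *: 2%:M).
  apply: C2funZ; apply: C2fun_ext (C2funD (C2fun_sqn 0) (C2fun_cst N (- C))) => x.
    by rewrite subr0.
  by rewrite addr0.
have cq : continuous q by case: qH => G [].
have q0 x : closure Omega x -> q x <= 0.
  by move=> /sqnC h1; rewrite pmulr_rle0// subr_le0.
pose W (x : pt) : R := u x - v x - (- q x).
have uW : usc_on (closure Omega) W.
  apply: usc_onB; first exact: usc_onB.
  by apply: continuous_lsc_on => x; apply: continuousN; exact: cq.
have Oc x : Omega x -> closure Omega x by exact: subset_closure.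
have [xd cxd xdmax] := usc_max cO (ex_intro _ x1 (Oc _ Ox1)) uW.
pose M0 := W xd; have M00 : 0 < M0.
  apply: lt_le_trans (xdmax _ (Oc _ Ox1)); rewrite /W opprK -/u0 /q mulrBr.
  have := mulr_ge0 (ltW del0) (sqn_ge0 x1); rewrite -/(sqn x1); lra.
have Oxd : Omega xd.
  apply: contrapT => nO; have := ubd xd (conj cxd nO); have := q0 xd cxd.
  by move: M00; rewrite /M0 /W; lra.
have [r0 r00 BO] : exists2 r0 : R, 0 < r0 & [set y | `|y - xd| <= r0] `<=` Omega.
  have /nbhs_ballP[r /= rp Hr] : nbhs xd Omega by exact: open_nbhs_nbhs.
  exists (r / 2); first by rewrite divr_gt0.
  move=> y /= yr; apply: Hr; rewrite -ball_normE/= distrC; lra.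
have [g [L [Mg [L0 gL gM gu]]]] := subsolution_local_lip usub uusc r00 BO.
have uxd : u xd <= 0 := subsolution_le0 usub uusc r00 BO.
pose a := - u xd; have a0 : 0 <= a by rewrite oppr_ge0.
(* The gap [M0] is shared out in sixteenths: the oscillation of [u] and twice the smoothing error
   take three of them, which leaves [- v y] above [m']. *)
pose m' := a + M0 / 16; have m'0 : 0 < m' by rewrite /m'; lra.
pose P := m' ^+ (N + 2); have P0 : 0 < P by rewrite exprn_gt0.
have del20 : 0 < del / 2 by rewrite divr_gt0.
(* A third of the determinant gain: [h] may deviate from [h xd] by [tau] on either side, [2 tau] in
   all. *)
pose tau := P * (del / 2) ^+ N / 3.
have tau0 : 0 < tau by rewrite divr_gt0// mulr_gt0// exprn_gt0.
have [r1 r10 Hr1] := within_open_continuous_near oO ch Oxd tau0.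
pose r := Num.min (r0 / 2) (Num.min (r1 / 2) (M0 / 16 / (L + 1))).
have L1 : 0 < L + 1 by rewrite ltr_wpDl.
have rp : 0 < r by rewrite !lt_min !divr_gt0.
have [rr0 rr1 rL] : [/\ r <= r0 / 2, r <= r1 / 2 & r <= M0 / 16 / (L + 1)].
  by split; rewrite !ge_min lexx ?orbT.
have inO x : `|x - xd| <= r -> Omega x by move=> xr; apply: BO => /=; lra.
have gur x : `|x - xd| <= r -> g x = u x by move=> xr; apply: gu; lra.
have unear x : `|x - xd| <= r -> `|u x - u xd| <= M0 / 16.
  move=> xr; rewrite -gur// -(gur xd) ?subrr ?normr0 ?(ltW rp)//.
  apply: le_trans (gL _ _) _; move: rL; rewrite ler_pdivlMr// => rL.
  have := ler_wpM2l L0 xr; lra.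
have hnear x : `|x - xd| <= r -> h xd - tau <= h x <= h xd + tau.
  move=> xr; have xr1 : `|xd - x| < r1 by rewrite distrC; lra.
  by have [_] := Hr1 x xr1; rewrite ltr_norml; lra.
pose R2 := r / 2; have R20 : 0 < R2 by rewrite divr_gt0.
(* On the sphere of radius [R2] the subtracted paraboloid costs [del R2^2 / 2 >= 4 eta], more than
   the [2 eta] lost by smoothing. *)
pose eta := Num.min (M0 / 16) (del * R2 ^+ 2 / 8).
have eta0 : 0 < eta.
  rewrite lt_min; apply/andP; split; first by rewrite divr_gt0.
  by rewrite divr_gt0// mulr_gt0// exprn_gt0.
have [eta1 eta2] : eta <= M0 / 16 /\ eta <= del * R2 ^+ 2 / 8.
  by split; rewrite !ge_min lexx ?orbT.
pose K : R := (N + N)%:R; have K0 : 0 <= K by exact: ler0n.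
have K1 : 0 < K + 1 by rewrite ltr_wpDl.
pose eps := Num.min 1 (Num.min (R2 / (K + 1)) (eta / ((L + 1) * (K + 1)))).
have LK : 0 < (L + 1) * (K + 1) by rewrite mulr_gt0.
have eps0 : 0 < eps by rewrite !lt_min ltr01 !divr_gt0.
have eps01 : 0 < eps <= 1 by rewrite eps0 ge_min lexx.
have epsR : K * eps < R2.
  have : eps <= R2 / (K + 1) by rewrite !ge_min lexx ?orbT.
  by rewrite ler_pdivlMr//; lra.
have epsL : L * (K * eps) <= eta.
  have : eps <= eta / ((L + 1) * (K + 1)) by rewrite !ge_min lexx ?orbT.
  rewrite ler_pdivlMr//; have := mulr_ge0 (mulr_ge0 L0 K0) (ltW eps0).
  have := mulr_ge0 L0 (ltW eps0); have := mulr_ge0 K0 (ltW eps0); lra.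
pose f := smoothing eps g.
have [Hf fH sH] := smoothing_C2 eps01 gL.
have fg x : `|f x - g x| <= eta.
  by apply: le_trans (smoothing_near eps01 x L0 gL) _; exact: epsL.
(* Half of the Hessian [2 del I] of [q] is spent on pushing the maximum off the sphere; [del I]
   remains. *)
pose phi (x : pt) : R := f x + q x + (- (del / 2)) * ((x - xd) *m (x - xd)^T) 0 0.
have phiH : C2fun phi (fun x => Hf x + del%:M).
  have E : del *: 2%:M + (- (del / 2)) *: 2%:M = del%:M :> 'M[R]_N.
    by rewrite -scalerDl scale_scalar_mx; congr (_%:M); field.
  apply: C2fun_ext (C2funD (C2funD fH qH) (C2funZ (- (del / 2)) (C2fun_sqn xd))) => // x.
  by rewrite -addrA E.
have cphi : continuous phi by case: phiH => G [].
have RO : [set x | `|x - xd| <= R2] `<=` closure Omega.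
  by move=> x /= xr; apply: Oc; apply: inO; rewrite /R2 in xr; lra.
have R2ne : [set x | `|x - xd| <= R2] !=set0 by exists xd; rewrite /= subrr normr0 ltW.
have [y yB ymax] := usc_max (@compact_cball R N xd R2) R2ne
   (usc_onB (continuous_usc_on cphi) (lsc_onS RO vlsc)).
have yr : `|y - xd| <= r by move: yB rp; rewrite /R2/=; clear; lra.
have Oy := inO y yr.
have phixd : M0 - eta <= phi y - v y.
  have := ymax xd; rewrite /= subrr normr0 => /(_ (ltW R20)); apply: le_trans.
  have := fg xd; rewrite (gur xd) ?subrr ?normr0 ?(ltW rp)// ler_norml => /andP[h1 _].
  by move: h1; rewrite /phi subrr mul0mx mxE mulr0 addr0 /M0 /W; clear; lra.
have fy : f y <= u y + eta.
  by have := fg y; rewrite gur// ler_norml; clear; lra.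
have yR : `|y - xd| < R2.
  move: yB; rewrite /= le_eqVlt => /orP[/eqP yE|//].
  have h1 : R2 ^+ 2 <= ((y - xd) *m (y - xd)^T) 0 0 by rewrite -yE sqr_norm_le_sqn.
  have h2 := ler_wpM2l (ltW del0) h1.
  have := xdmax y (Oc _ Oy); rewrite -/M0 /W.
  by move: eta0 eta2 phixd fy h2; rewrite /phi; clear; lra.
have vy : m' <= - v y.
  have h1 := q0 y (Oc _ Oy).
  have h2 := mulr_ge0 (ltW del0) (sqn_ge0 (y - xd)).
  have := unear y yr; rewrite ler_norml => /andP[_ h3].
  by move: M00 eta1 phixd fy h1 h2 h3; rewrite /phi /m' /a; clear; lra.
(* A function touching [g] from above at [x] near [y] also touches [u] there; [(- u x)^(N+2) <= P]
   and [h x >= h xd - tau] then make its Hessian an admissible [K]. *)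
have dual m (S : 'M[R]_(m, N)) c :
    (forall K : 'M[R]_N, K^T = K -> psd K -> h xd - tau <= P * \det K -> c <= ellop S K) ->
    c <= ellop S (Hf y).
  move=> HK; apply: (smoothing_ellop eps01 L0 gL gM epsR _ fH).
  move=> psi Kf x psiK xy [d d0 xmax].
  have xr : `|x - xd| < r.
    rewrite (_ : x - xd = (x - y) + (y - xd)); last by rewrite addrA subrK.
    by rewrite (le_lt_trans (ler_normD _ _))//; move: xy yR; rewrite /R2; clear; lra.
  have Ox := inO x (ltW xr).
  have rd : 0 < Num.min d (r - `|x - xd|) by rewrite lt_min d0 subr_gt0.
  have loc z : Omega z -> `|z - x| < Num.min d (r - `|x - xd|) -> u z - psi z <= u x - psi x.
    move=> _; rewrite lt_min => /andP[zd zr]; have := xmax z zd.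
    rewrite !gur ?(ltW xr)//.
    by rewrite -[z](subrK x) -addrA (le_trans (ler_normD _ _))//; move: zr; clear; lra.
  have [F0 [/= sK [/= ux pK]]] := subsolution_test usub Ox psiK rd loc.
  apply: HK => //; have dK := psd_det_ge0 sK pK.
  have /andP[h1 _] := hnear x (ltW xr).
  apply: (le_trans h1); move: F0; rewrite /Fop subr_ge0 => /le_trans; apply.
  rewrite ler_wpM2r// lerXn2r ?nnegrE ?oppr_ge0 ?(ltW m'0)//.
  by have := unear x (ltW xr); rewrite ler_norml /m' /a; clear; lra.
have pH := ellop_dual_psd dual.
(* Half of the remaining [del I] is used to pass from the linear inequalities to the determinant,
   the other half yields the gain [3 tau]. *)
have detH := ellop_dual_det hN P0 dual (sH y) del20.
have sHd : (Hf y + del%:M)^T = Hf y + del%:M by rewrite linearD/= tr_scalar_mx sH.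
have int : rinterior (@Qset R N) (v y, Hf y + del%:M).
  apply: (rinterior_Qset (e := Num.min del m')) => //.
  - by rewrite lt_min del0.
  - by rewrite lerNr ge_min vy orbT.
  - rewrite -addrA -raddfB/=; apply: psdD => //; apply: psd_scalar.
    by rewrite subr_ge0 ge_min lexx.
have rR : 0 < R2 - `|y - xd| by rewrite subr_gt0.
have loc x : `|x - y| < R2 - `|y - xd| -> phi x - v x <= phi y - v y.
  move=> xy; apply: ymax; rewrite /= -[x](subrK y) -addrA.
  by rewrite (le_trans (ler_normD _ _))//; move: xy; clear; lra.
have := supersolution_test vsup Oy phiH rR loc int; rewrite /Fop subr_le0 => F0.
have [_ hy] := andP (hnear y yr).
have pd2 : psd ((del / 2)%:M : 'M[R]_N) by apply: psd_scalar; exact: ltW.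
have sd2 : (Hf y + (del / 2)%:M)^T = Hf y + (del / 2)%:M by rewrite linearD/= tr_scalar_mx sH.
have := psd_det_superadd hN sd2 (tr_scalar_mx _ (del / 2)) (psdD pH pd2) pd2.
rewrite det_scalar -addrA -raddfD/= -splitr => dsum.
have d0 := psd_det_ge0 sHd (psdD pH (@psd_scalar R N _ (ltW del0))).
have h1 : P * \det (Hf y + del%:M) <= h y.
  apply: le_trans F0; rewrite ler_wpM2r// lerXn2r ?nnegrE ?(ltW m'0)//.
  exact: le_trans (ltW m'0) vy.
have h2 := ler_wpM2l (ltW P0) dsum; rewrite mulrDr in h2.
have h3 : P * (del / 2) ^+ N = 3 * tau by rewrite /tau; field.
by move: h2; rewrite h3; lra.
Qed.

End Comparison.

Theorem theorem6p14 (R : realType) (N : nat) (hN : (0 < N)%N)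
  (Omega : set 'rV[R]_N) (h : 'rV[R]_N -> R) :
  open Omega -> connected Omega -> bounded_set Omega ->
  {within Omega, continuous h} -> (forall x, Omega x -> 0 <= h x) ->
  (proper_elliptic Omega (ThetaMA h)
   /\ hausdorff_continuous Omega (ThetaMA h)
   /\ (forall x, Omega x ->
         rboundary (ThetaMA h x) `<=`
         [set p | SymPairs p /\ (- p.1) ^+ (N + 2) * \det p.2 = h x]))
  /\
  (forall u v : 'rV[R]_N -> R,
     usc_on (closure Omega) u -> lsc_on (closure Omega) v ->
     Q_subsolution Omega h u -> Q_supersolution Omega h v ->
     (forall x, (closure Omega `\` Omega) x -> u x <= v x) ->
     forall x, Omega x -> u x <= v x).
Proof.
move=> oO _ bO ch h0; split; last first.
  by move=> u v uusc vlsc usub vsup ubd x Ox; exact: (comparison hN oO bO ch uusc vlsc usub vsup).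
split; first exact: ThetaMA_elliptic.
split; first exact: ThetaMA_hausdorff_continuous.
by move=> x Ox; apply: ThetaMA_boundary => //; exact: h0.
Qed.
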